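(* Let $\mathcal{P}=(\mathcal{P}_1,\mathcal{P}_2,\dots)$ be an index-invariant distribution property. Suppose that for every $\epsilon'\in(0,1)$ there are integers $s(\epsilon'),q(\epsilon')$ (not depending on $n$) such that $\mathcal{P}$ admits an $\epsilon'$-tester in the Huge Object model using $s(\epsilon')$ samples and $q(\epsilon')$ queries. Then there exist an absolute constant $c>0$ and a polynomial $p$ such that for every $\epsilon\in(0,1)$, writing $s=s(c\epsilon)$ and $q=q(c\epsilon)$, and for every $n\ge 2^{p(2^{q},s,1/\epsilon)}$, there is a randomized algorithm that, given Huge Object oracle access to an unknown distribution $\mu$ over $\{0,1\}^n$, makes at most $\exp\left(\exp\left(2^{q}\cdot p(s,q,1/\epsilon)\right)\right)$ queries and outputs a value $\widetilde{d}$ such that with probability at least $2/3$, $|\widetilde{d}-d_{EM}(\mu,\mathcal{P})|\le\epsilon$.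
   Context: For $x,y\in\{0,1\}^n$, $d_H(x,y)=\frac1n|\{i:x_i\ne y_i\}|$ is the normalized Hamming distance. A transfer distribution between distributions $\mu,\tau$ is a distribution $T$ on pairs whose first marginal is $\mu$ and second marginal is $\tau$. The Earth Mover distance is $d_{EM}(\mu,\tau)=\min_T \mathbb{E}_{(x,y)\sim T}[d_H(x,y)]$ over transfer distributions $T$. A distribution property is a sequence $\mathcal{P}_1,\mathcal{P}_2,\dots$ where $\mathcal{P}_n$ is a compact set of distributions over $\{0,1\}^n$; $d_{EM}(\mu,\mathcal{P})=\min_{\tau\in\mathcal{P}_n}d_{EM}(\mu,\tau)$. $\mathcal P$ is index-invariant if for every permutation $\pi$ of $[n]$, $\{\mu_\pi:\mu\in\mathcal{P}_n\}=\mathcal{P}_n$, where $\mu_\pi(x_{\pi(1)},\dots,x_{\pi(n)})=\mu(x_1,\dots,x_n)$. Huge Object oracle: the algorithm may at any time request a fresh independent sample $x\sim\mu$ (receiving no bits of it), or query a coordinate $j\in[n]$ of a previously obtained sample, receiving its bit; complexity counts the queries. An $\epsilon'$-tester accepts with probability at least $2/3$ every $\mu\in\mathcal{P}_n$ and rejects with probability at least $2/3$ every $\mu$ with $d_{EM}(\mu,\mathcal{P})>\epsilon'$. *)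

(* Defs.v *)
From HB Require Import structures.
From mathcomp Require Import all_boot all_order all_algebra all_fingroup.
From mathcomp Require Import all_classical all_reals.
From mathcomp Require Import topology normedtype sequences exp.
Import numFieldNormedType.Exports.
Set Implicit Arguments. Unset Strict Implicit. Unset Printing Implicit Defensive.
Import Order.TTheory GRing.Theory Num.Theory.
Local Open Scope classical_set_scope.
Local Open Scope ring_scope.

Section HugeObject.
Variable R : realType.

Definition bvec (n : nat) : finType := {ffun 'I_n -> bool}.

Definition is_dist (T : finType) (mu : {ffun T -> R}) : Prop :=
  (forall x, 0 <= mu x) /\ \sum_x mu x = 1.

Definition dH (n : nat) (x y : bvec n) : R :=
  #|[set i | x i != y i]|%:R / n%:R.

Definition transfer (n : nat) (T : {ffun bvec n * bvec n -> R})
  (mu tau : {ffun bvec n -> R}) : Prop :=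
  is_dist T /\
  (forall x, \sum_y T (x, y) = mu x) /\
  (forall y, \sum_x T (x, y) = tau y).

(* Earth Mover distance (the paper's min, written as an infimum) *)
Definition dEM (n : nat) (mu tau : {ffun bvec n -> R}) : R :=
  inf [set r : R | exists T, transfer T mu tau /\
                     r = \sum_p T p * dH p.1 p.2].

Definition dprop := forall n : nat, set {ffun bvec n -> R}.

Definition seq_compact (T : finType) (A : set {ffun T -> R}) : Prop :=
  forall u : nat -> {ffun T -> R}, (forall k, A (u k)) ->
    exists (phi : nat -> nat) (l : {ffun T -> R}),
      (forall a b, (a < b)%N -> (phi a < phi b)%N) /\ A l /\
      forall x, (fun k => u (phi k) x) @ \oo --> l x.

Definition is_dprop (P : dprop) : Prop :=
  forall n, (forall mu, P n mu -> is_dist mu) /\ P n !=set0 /\ seq_compact (P n).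

Definition dEMP (P : dprop) (n : nat) (mu : {ffun bvec n -> R}) : R :=
  inf [set d : R | exists tau, P n tau /\ d = dEM mu tau].

(* mu_pi (x_{pi(1)},...,x_{pi(n)}) = mu (x_1,...,x_n) *)
Definition dperm (n : nat) (pi : {perm 'I_n}) (mu : {ffun bvec n -> R})
  : {ffun bvec n -> R} :=
  [ffun y : bvec n => mu [ffun j => y (pi^-1%g j)]].

Definition index_invariant (P : dprop) : Prop :=
  forall n (pi : {perm 'I_n}), [set dperm pi mu | mu in P n] = P n.

(* Randomized algorithms in the Huge Object model, as finite decision trees.
   The index c is the number of samples obtained so far.
   - HRet v      : stop and output v
   - HSample A   : obtain a fresh independent sample (no bits revealed)
   - HQuery i j k: query coordinate j of the i-th sample, continue with k bit
   - HCoin p k   : internal random coin, true with probability p (clamped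
                   to [0,1]) *)
Inductive halg (n : nat) (O : Type) : nat -> Type :=
| HRet c : O -> halg n O c
| HSample c : halg n O c.+1 -> halg n O c
| HQuery c : 'I_c -> 'I_n -> (bool -> halg n O c) -> halg n O c
| HCoin c : R -> (bool -> halg n O c) -> halg n O c.

Definition ext_samples (n c : nat) (xs : 'I_c -> bvec n) (x : bvec n)
  : 'I_c.+1 -> bvec n :=
  fun i => if unlift ord_max i is Some j then xs j else x.

Definition clamp01 (p : R) : R := Num.min 1 (Num.max 0 p).

Fixpoint hprob (n : nat) (O : Type) (mu : {ffun bvec n -> R}) (S : O -> bool)
  (c : nat) (A : halg n O c) : ('I_c -> bvec n) -> R :=
  match A in halg _ _ c0 return ('I_c0 -> bvec n) -> R with
  | HRet _ v => fun _ => if S v then 1 else 0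
  | HSample c0 A' => fun xs =>
      \sum_(x : bvec n) mu x * hprob mu S A' (ext_samples xs x)
  | HQuery _ i j k => fun xs => hprob mu S (k (xs i j)) xs
  | HCoin _ p k => fun xs =>
      clamp01 p * hprob mu S (k true) xs +
      (1 - clamp01 p) * hprob mu S (k false) xs
  end.

Definition no_samples (n : nat) : 'I_0 -> bvec n := fun _ => [ffun => false].

Definition Pr (n : nat) (O : Type) (mu : {ffun bvec n -> R}) (A : halg n O 0)
  (S : O -> bool) : R := hprob mu S A (@no_samples n).

Fixpoint nqueries (n : nat) (O : Type) (c : nat) (A : halg n O c) : nat :=
  match A with
  | HRet _ _ => 0
  | HSample _ A' => nqueries A'
  | HQuery _ _ _ k => (maxn (nqueries (k false)) (nqueries (k true))).+1
  | HCoin _ _ k => maxn (nqueries (k false)) (nqueries (k true))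
  end.

Fixpoint nsamples (n : nat) (O : Type) (c : nat) (A : halg n O c) : nat :=
  match A with
  | HRet _ _ => 0
  | HSample _ A' => (nsamples A').+1
  | HQuery _ _ _ k => maxn (nsamples (k false)) (nsamples (k true))
  | HCoin _ _ k => maxn (nsamples (k false)) (nsamples (k true))
  end.

Definition is_tester (P : dprop) (eps' : R) (n : nat) (A : halg n bool 0) : Prop :=
  (forall mu, P n mu -> Pr mu A id >= 2/3) /\
  (forall mu, is_dist mu -> dEMP P mu > eps' -> Pr mu A negb >= 2/3).

Definition poly3 := {d : nat & 'I_d.+1 -> 'I_d.+1 -> 'I_d.+1 -> R}.
Definition peval3 (p : poly3) (x y z : R) : R :=
  \sum_(i < (projT1 p).+1) \sum_(j < (projT1 p).+1) \sum_(k < (projT1 p).+1)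
     projT2 p i j k * x ^+ i * y ^+ j * z ^+ k.

End HugeObject.

(* Main.v *)
(** View a distribution on bit vectors as a random 0/1 array: rows are samples,
    columns are coordinates. The sketch of mu is the law of a random square
    subarray, whose side is polynomial in s, q and 1/eps. The estimator learns
    the sketch empirically and outputs the distance to P of any distribution
    with a matching sketch. It is correct because the distance to P is
    continuous in the sketch.

    For continuity, let tau in P be nearly closest to mu, and consider the array
    of pairs (x, z) given by a coupling of mu and tau. An entropy increment
    argument, run at three nested levels of pinned rows and columns, shows that
    z can be regenerated from x, up to small total variation on the test rows
    and columns, by rules that use only the pins, one hidden variable for each
    row, one for each column, and fresh randomness for each entry. The same
    rules applied to mu' produce some tau' for which the transfer cost and the
    acceptance probability of the tester are nearly those of tau; so tau' is
    close to P, hence so is mu'. Averaging over coordinate permutations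
    (index-invariance) lets the tester read uniformly random columns. *)

Require Import Defs.
From HB Require Import structures.
From mathcomp Require Import all_boot all_order all_algebra all_fingroup.
From mathcomp Require Import all_classical all_reals.
From mathcomp Require Import topology normedtype sequences exp.
From mathcomp Require Import ring lra zify.
From mathcomp Require Import fintype finset.
Set Implicit Arguments. Unset Strict Implicit. Unset Printing Implicit Defensive.
Import Order.TTheory GRing.Theory Num.Theory.
Local Open Scope ring_scope.

(** * Products of finite distributions *)

Section ProductLaws.
Variable R : realType.

(** [tau'] must be the law of a single row, so the pins, their z-bits and the hidden column
    variables have to be frozen, and this is done by averaging. An average controls one quantity
    only, hence transfer cost and acceptance are merged into the single functional [deviation]. The
    gap between 2/3 and 1/3 absorbs a constant change of acceptance, so the weight of the square
    does not depend on eps.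

    The three levels come from the following obstacle. A conditioning set can absorb the other tests
    only after they have been swapped into fresh pins, and this must not enlarge the block that is
    being conditioned. [blockZ] uses no pins, [blockK] and [blockTh] those of level 0, [blockL]
    those of levels 0 and 1, and the pinned x-entries all three levels. Each block is therefore
    untouched when the level above it grows, its entropy is bounded in terms of the lower levels,
    and a level long enough compared with that bound contains a step where the entropy hardly
    drops. *)

Definition pdist (T : finType) (w : T -> R) : Prop :=
  (forall x, 0 <= w x) /\ \sum_x w x = 1.

Definition join (A B : finType) (T : Type) (g : {ffun A -> T})
    (h : {ffun B -> T}) : {ffun A + B -> T} :=
  [ffun i => match i with inl a => g a | inr b => h b end].

Lemma sum_join (A B : finType) (T : finType) (F : {ffun A + B -> T} -> R) :
  \sum_f F f = \sum_g \sum_h F (join g h).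
Proof.
rewrite pair_big /=.
rewrite (reindex (fun gh : {ffun A -> T} * {ffun B -> T} => join gh.1 gh.2)) //=.
exists (fun f => ([ffun a => f (inl a)], [ffun b => f (inr b)])).
  by move=> [g h] _ /=; congr pair; apply/ffunP => i; rewrite !ffunE.
by move=> f _; apply/ffunP => -[a|b]; rewrite !ffunE.
Qed.

Lemma prod_join (A B : finType) (T : finType) (w : T -> R) g h :
  \prod_i w (@join A B T g h i) = (\prod_a w (g a)) * \prod_b w (h b).
Proof. by rewrite big_sumType /=; congr (_ * _); apply: eq_bigr => i _; rewrite ffunE. Qed.

Lemma sum_prod1 (I B : finType) (w : I -> B -> R) :
  (forall i, \sum_b w i b = 1) ->
  \sum_(f : {ffun I -> B}) \prod_i w i (f i) = 1.
Proof. by move=> w1; rewrite -bigA_distr_bigA big1. Qed.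

Lemma pdist_prod (I B : finType) (w : B -> R) : pdist w ->
  pdist (fun f : {ffun I -> B} => \prod_i w (f i)).
Proof.
move=> [w0 w1]; split; first by move=> f; apply: prodr_ge0.
exact: (sum_prod1 (fun _ => w1)).
Qed.

Lemma pdist_uniform n : (0 < n)%N -> pdist (fun _ : 'I_n => n%:R^-1).
Proof.
move=> n0; split=> [j|]; rewrite ?invr_ge0 //.
by rewrite sumr_const card_ord -[_ *+ _]mulr_natl mulfV // pnatr_eq0 -lt0n.
Qed.

Lemma sum_pair (A B : finType) (F : A * B -> R) : \sum_p F p = \sum_a \sum_b F (a, b).
Proof. by rewrite pair_big /=; apply: eq_bigr => -[a b]. Qed.

Lemma sum_indic (T : finType) (v : T) (F : T -> R) : \sum_y (v == y)%:R * F y = F v.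
Proof.
rewrite (bigD1 v) //= eqxx mul1r big1 ?addr0 // => y yv.
by rewrite eq_sym (negbTE yv) mul0r.
Qed.

Lemma indic_prod (I : finType) (b : I -> bool) :
  (([forall i, b i] : bool)%:R : R) = \prod_i (b i)%:R.
Proof.
case: (boolP [forall i, b i]) => [/forallP bP|].
  by rewrite big1 // => i _; rewrite bP.
by rewrite negb_forall => /existsP [i /negbTE bi]; rewrite (bigD1 i) //= bi mul0r.
Qed.

(** Coordinates outside the image of [c] integrate to 1. Injectivity keeps the selected coordinates
    independent; where it fails for test columns, a collision probability has to be paid. *)
Lemma sum_prod_inj (I J B : finType) (c : J -> I) (w : I -> B -> R)
    (G : {ffun J -> B} -> R) :
  injective c -> (forall i, \sum_b w i b = 1) ->
  \sum_(f : {ffun I -> B}) (\prod_i w i (f i)) * G [ffun j => f (c j)] =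
  \sum_(g : {ffun J -> B}) (\prod_j w (c j) (g j)) * G g.
Proof.
move=> cI w1.
rewrite (partition_big (fun f : {ffun I -> B} => [ffun j => f (c j)]) xpredT) //=.
apply: eq_bigr => g _.
(* The condition that [f] restricts to [g] is moved inside the product over [i], so that the sum
   over [f] distributes over the coordinates. *)
transitivity (\sum_(f : {ffun I -> B})
    (\prod_i (w i (f i) * \prod_(j | c j == i) (f i == g j)%:R)) * G g).
  rewrite big_mkcond /=; apply: eq_bigr => f _.
  rewrite big_split /=.
  have -> : \prod_i \prod_(j | c j == i) ((f i == g j)%:R : R)
     = ([ffun j => f (c j)] == g)%:R.
    rewrite (exchange_big_dep xpredT) //=.
    transitivity (\prod_j ((f (c j) == g j)%:R : R)).
      by apply: eq_bigr => j _; rewrite (big_pred1 (c j)) // => i; rewrite eq_sym.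
    rewrite -indic_prod; congr (nat_of_bool _)%:R.
    apply/forallP/eqP => [e|<- j]; last by rewrite ffunE.
    by apply/ffunP => j; rewrite ffunE; apply/eqP.
  by case: eqP => [->|]; rewrite ?mulr1 ?mulr0 ?mul0r.
rewrite -big_distrl /=; congr (_ * _).
rewrite -(bigA_distr_bigA (fun i b => w i b * \prod_(j | c j == i) (b == g j)%:R)).
rewrite (bigID (fun i => i \in codom c)) /= [X in _ * X]big1 ?mulr1; last first.
  move=> i ni; rewrite -[RHS](w1 i); apply: eq_bigr => b _.
  rewrite big1 ?mulr1 // => j /eqP ji; by rewrite -ji codom_f in ni.
rewrite -big_uniq /=; last by rewrite map_inj_uniq ?enum_uniq.
rewrite big_image /=; apply: eq_bigr => j _.
rewrite (bigD1 (g j)) //= big1; last first.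
  by move=> i /eqP /cI ->; rewrite eqxx.
rewrite mulr1 big1 ?addr0 //.
by move=> b bg; rewrite (bigD1 j) ?eqxx //= (negbTE bg) mul0r mulr0.
Qed.

Lemma sum_prod_weight_inj (I J B : finType) (c : J -> I) (w : B -> R)
    (G : {ffun J -> B} -> R) :
  injective c -> pdist w ->
  \sum_(f : {ffun I -> B}) (\prod_i w (f i)) * G [ffun j => f (c j)] =
  \sum_(g : {ffun J -> B}) (\prod_j w (g j)) * G g.
Proof.
by move=> cI [_ w1]; apply: (@sum_prod_inj _ _ _ c (fun=> w)) => // i.
Qed.

Lemma le_weighted_sum (T : finType) (w F G : T -> R) :
  (forall x, 0 <= w x) -> (forall x, F x <= G x) ->
  \sum_x w x * F x <= \sum_x w x * G x.
Proof. by move=> w0 FG; apply: ler_sum => x _; apply: ler_wpM2l. Qed.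

Lemma weighted_sum_le (T : finType) (w F : T -> R) (b : R) :
  pdist w -> (forall x, F x <= b) -> \sum_x w x * F x <= b.
Proof.
move=> [w0 w1] Fb; apply: (le_trans (le_weighted_sum w0 Fb)).
by rewrite -big_distrl /= w1 mul1r.
Qed.

Lemma weighted_sum_ge (T : finType) (w F : T -> R) (b : R) :
  pdist w -> (forall x, b <= F x) -> b <= \sum_x w x * F x.
Proof.
move=> [w0 w1] Fb; apply: le_trans (le_weighted_sum w0 Fb).
by rewrite -big_distrl /= w1 mul1r.
Qed.

(** The averaging principle by which pins, their bits and the hidden column variables get frozen. *)
Lemma weighted_sum_exists_le (T : finType) (w F : T -> R) (b : R) :
  pdist w -> \sum_x w x * F x <= b -> exists x, F x <= b.
Proof.
move=> [w0 w1] Fb; apply: contrapT => nx.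
have lt x : b < F x by rewrite ltNge; apply/negP => h; apply: nx; exists x.
have [x wx] : exists x, 0 < w x.
  apply: contrapT => nw; have : \sum_x w x = 0.
    apply: big1 => x _; apply: le_anti; rewrite w0 andbT leNgt.
    by apply/negP => h; apply: nw; exists x.
  by rewrite w1 => /eqP; rewrite oner_eq0.
move: Fb; apply/negP; rewrite -ltNge -[b]mul1r -w1 big_distrl /=.
rewrite (bigD1 x) //= [ltRHS](bigD1 x) //=; apply: ltr_leD.
  by rewrite ltr_pM2l.
by apply: ler_sum => y _; apply: ler_wpM2l => //; apply: ltW.
Qed.

End ProductLaws.

(** * Entropy of a random bit array *)

Section Forgetting.
Variables (R : realType) (E : finType).
Local Notation V := {ffun E -> bool}.
Implicit Types (A B C U W : {set E}) (w v u : V) (f g : V -> R).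

Definition kloc (b x y : bool) : R := if b then (x == y)%:R else 2^-1.
(** A symmetric Markov kernel. Hence the same operator serves as marginalisation of a law and as
    conditional expectation of a function given the A-coordinates. *)
Definition forget_kernel A w v : R := \prod_e kloc (e \in A) (w e) (v e).
Local Notation K := forget_kernel.

(* For a probability f this is the law that agrees with f on the coordinates
   in A and is uniform and independent elsewhere. *)
Definition forget A f w : R := \sum_v K A w v * f v.

Definition depends_on A f := forall w v, {in A, w =1 v} -> f w = f v.

Lemma kloc_ge0 b x y : 0 <= kloc b x y.
Proof. by rewrite /kloc; case: b => //; rewrite invr_ge0. Qed.

Lemma kernel_ge0 A w v : 0 <= K A w v.
Proof. by apply: prodr_ge0 => e _; apply: kloc_ge0. Qed.

Lemma klocC b x y : kloc b x y = kloc b y x.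
Proof. by rewrite /kloc eq_sym. Qed.

Lemma kernelC A w v : K A w v = K A v w.
Proof. by apply: eq_bigr => e _; rewrite klocC. Qed.

Lemma half_double : 2^-1 + 2^-1 = 1 :> R. Proof. by lra. Qed.

Lemma kloc_sum1 b x : \sum_y kloc b x y = 1.
Proof.
rewrite big_bool /kloc; case: b => /=; first by case: x; rewrite /= ?addr0 ?add0r.
exact: half_double.
Qed.

Lemma kernel_sum1 A w : \sum_v K A w v = 1.
Proof. by apply: (@sum_prod1 R E _ (fun e b => kloc (e \in A) (w e) b)) => e; apply: kloc_sum1. Qed.

Lemma kernel_refl_gt0 A w : 0 < K A w w.
Proof.
apply: prodr_gt0 => e _; rewrite /kloc; case: (_ \in _); rewrite ?eqxx //.
by rewrite invr_gt0.
Qed.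

Lemma kernel_depends A f w v : depends_on A f -> K A w v * f v = K A w v * f w.
Proof.
move=> Af; case: (boolP [forall e in A, w e == v e]) => [/forall_inP h|].
  by rewrite (Af v w) // => e eA; rewrite (eqP (h e eA)).
rewrite negb_forall_in => /exists_inP [e eA ne].
by rewrite /forget_kernel (bigD1 e) //= /kloc eA (negbTE ne) !mul0r.
Qed.

Lemma depends_onS A B f : A \subset B -> depends_on A f -> depends_on B f.
Proof. by move=> /subsetP AB Af w v h; apply: Af => e /AB; apply: h. Qed.

Lemma depends_onM A f g :
  depends_on A f -> depends_on A g -> depends_on A (fun w => f w * g w).
Proof. by move=> Af Ag w v h; rewrite (Af _ _ h) (Ag _ _ h). Qed.

Lemma depends_on_prod A (I : finType) (P : pred I) (F : I -> V -> R) :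
  (forall i, P i -> depends_on A (F i)) -> depends_on A (fun w => \prod_(i | P i) F i w).
Proof. by move=> h w v e; apply: eq_bigr => i Pi; apply: h. Qed.

Lemma kernel_depends_on A w : depends_on A (K A w).
Proof.
move=> v u h; apply: eq_bigr => e _; rewrite /kloc.
by case: ifP => // eA; rewrite h.
Qed.

Lemma forget_depends_on A f : depends_on A (forget A f).
Proof.
move=> w v h; apply: eq_bigr => u _; congr (_ * _).
by rewrite ![K A _ u]kernelC; apply: kernel_depends_on.
Qed.

Lemma forget_ge0 A f : (forall w, 0 <= f w) -> forall w, 0 <= forget A f w.
Proof. by move=> f0 w; apply: sumr_ge0 => v _; rewrite mulr_ge0 ?kernel_ge0. Qed.

Lemma forget_gt0 A f w : (forall w, 0 <= f w) -> 0 < f w -> 0 < forget A f w.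
Proof.
move=> f0 fw; rewrite /forget (bigD1 w) //=; apply: ltr_pwDl.
  by rewrite mulr_gt0 ?kernel_refl_gt0.
by apply: sumr_ge0 => v _; rewrite mulr_ge0 ?kernel_ge0.
Qed.

Lemma forgetM A f g w : depends_on A g ->
  forget A (fun v => f v * g v) w = forget A f w * g w.
Proof.
move=> Ag; rewrite /forget big_distrl /=; apply: eq_bigr => v _.
by rewrite mulrCA (kernel_depends _ _ Ag) mulrCA mulrA.
Qed.

(** The kernel is symmetric, so [forget A] is self-adjoint, and functions of the A-coordinates pass
    through it. *)
Lemma sum_forgetM A f g : depends_on A g ->
  \sum_w forget A f w * g w = \sum_w f w * g w.
Proof.
move=> Ag; under eq_bigr do rewrite -(forgetM _ _ Ag).
rewrite exchange_big /=; apply: eq_bigr => v _.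
under eq_bigr do rewrite kernelC.
by rewrite -big_distrl /= kernel_sum1 mul1r.
Qed.

Lemma sum_forget A f : \sum_w forget A f w = \sum_w f w.
Proof.
have := @sum_forgetM A f (fun=> 1) (fun _ _ _ => erefl).
by under eq_bigr do rewrite mulr1; move=> ->; apply: eq_bigr => w _; rewrite mulr1.
Qed.

(** Checked one coordinate at a time: a bit survives two resamplings only if both of them keep
    it. *)
Lemma kernel_comp B C w u : \sum_v K B w v * K C v u = K (B :&: C) w u.
Proof.
transitivity (\sum_(v : V) \prod_e (kloc (e \in B) (w e) (v e) * kloc (e \in C) (v e) (u e))).
  by apply: eq_bigr => v _; rewrite big_split.
rewrite -(bigA_distr_bigA (fun e b => kloc (e \in B) (w e) b * kloc (e \in C) b (u e))).
apply: eq_bigr => e _; rewrite in_setI big_bool /kloc.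
case: (e \in B); case: (e \in C); case: (w e); case: (u e) => /=; lra.
Qed.

Lemma forget_forget B C f w : forget B (forget C f) w = forget (B :&: C) f w.
Proof.
rewrite /forget; under eq_bigr do rewrite big_distrr /=.
rewrite exchange_big /=; apply: eq_bigr => u _.
by rewrite -kernel_comp big_distrl /=; apply: eq_bigr => v _; rewrite mulrA.
Qed.

(** Forgetting one more coordinate replaces an indicator by 1/2, so a kernel value loses at most a
    factor 2. *)
Lemma forget_doubling W U f w : (forall w, 0 <= f w) ->
  forget (W :|: U) f w <= 2 ^+ #|U| * forget W f w.
Proof.
move=> f0; rewrite /forget big_distrr /=; apply: ler_sum => v _.
rewrite mulrA ler_wpM2r //.
have -> : 2 ^+ #|U| = \prod_e (if e \in U then 2 else 1 : R).
  by rewrite -big_mkcond /= prodr_const.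
rewrite -big_split /=; apply: ler_prod => e _; rewrite kloc_ge0 /= /kloc in_setU.
by case: (e \in W); case: (e \in U); case: (w e); case: (v e) => /=; lra.
Qed.

Lemma forget_perm (s : {perm E}) A f w :
  (forall v, f [ffun e => v (s e)] = f v) ->
  forget A f w = forget (s @^-1: A) f [ffun e => w (s e)].
Proof.
move=> fs; rewrite /forget.
rewrite [RHS](reindex_inj (h := fun v : V => [ffun e => v (s e)])) /=; last first.
  move=> v u /ffunP h; apply/ffunP => e; have := h (s^-1%g e).
  by rewrite !ffunE permKV.
apply: eq_bigr => v _; rewrite fs; congr (_ * _).
rewrite /forget_kernel (reindex_inj (h := s)) /=; last exact: perm_inj.
by apply: eq_bigr => e _; rewrite !ffunE inE.
Qed.

End Forgetting.

Section Entropy.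
Variables (R : realType) (E : finType) (p : {ffun E -> bool} -> R).
Hypothesis p_dist : pdist p.
Local Notation V := {ffun E -> bool}.
Local Notation pm A := (forget A p).
Implicit Types (A B C U W : {set E}) (w v u : V).

(* Entropy of the A-coordinates, shifted by ln 2 for each forgotten coordinate. *)
Definition entropy A : R := - \sum_w p w * ln (pm A w).
(** Because of the shift this is the usual conditional entropy minus ln 2 for each bit of [U]
    outside [W], that is, minus a divergence from uniform bits; hence it is never positive. *)
Definition cond_entropy U W : R := entropy (W :|: U) - entropy W.

Let p_ge0 w : 0 <= p w. Proof. by have [] := p_dist. Qed.
Let p_sum1 : \sum_w p w = 1. Proof. by have [] := p_dist. Qed.

Lemma pm_ge0 A w : 0 <= pm A w. Proof. exact: forget_ge0. Qed.
Lemma pm_gt0 A w : 0 < p w -> 0 < pm A w. Proof. exact: forget_gt0. Qed.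

Lemma ln_le_sub1 (x : R) : 0 < x -> ln x <= x - 1.
Proof.
move=> x0; have -> : x = 1 + (x - 1) by rewrite addrC subrK.
apply: (le_trans (le_ln1Dx _)); lra.
Qed.

(** A change of measure: by self-adjointness [p] may be replaced by [pm A], which cancels the
    denominator wherever it does not vanish. *)
Lemma sum_div_pm_le A (g : V -> R) : depends_on A g -> (forall w, 0 <= g w) ->
  \sum_w p w * (g w / pm A w) <= \sum_w g w.
Proof.
move=> Ag g0.
have d : depends_on A (fun w => g w / pm A w).
  by move=> w v h; rewrite (Ag _ _ h) (forget_depends_on _ h).
rewrite -(sum_forgetM _ d); apply: ler_sum => w _.
have [->|ne] := eqVneq (pm A w) 0; first by rewrite mul0r.
by rewrite mulrCA divff ?mulr1.
Qed.

(** Gibbs's inequality, in the form that follows from [ln h >= 1 - h^-1]. *)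
Lemma sum_ln_ge0 (h : V -> R) : (forall w, 0 < p w -> 0 < h w) ->
  \sum_w p w * (h w)^-1 <= 1 -> 0 <= \sum_w p w * ln (h w).
Proof.
move=> h0 h1; apply: (@le_trans _ _ (\sum_w p w * (1 - (h w)^-1))).
  under eq_bigr do rewrite mulrBr mulr1.
  by rewrite sumrB p_sum1 subr_ge0.
apply: ler_sum => w _; have := p_ge0 w; rewrite le_eqVlt => /predU1P[<-|pw].
  by rewrite !mul0r.
rewrite ler_pM2l //; have hw := h0 w pw.
have := @ln_le_sub1 (h w)^-1; rewrite invr_gt0 => /(_ hw).
by rewrite lnV ?posrE //; lra.
Qed.

(** Gibbs's inequality against the law that makes B and C conditionally independent given their
    intersection; its density is [pm B * pm C / pm (B :&: C)], of total mass at most 1. *)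
Lemma entropy_submod B C :
  entropy (B :|: C) + entropy (B :&: C) <= entropy B + entropy C.
Proof.
rewrite -subr_ge0 /entropy.
have -> : - (\sum_w p w * ln (pm B w)) + - (\sum_w p w * ln (pm C w)) -
   (- (\sum_w p w * ln (pm (B :|: C) w)) + - (\sum_w p w * ln (pm (B :&: C) w)))
  = \sum_w p w * ln (pm (B :|: C) w * pm (B :&: C) w / (pm B w * pm C w)).
  transitivity (\sum_w (p w * ln (pm (B :|: C) w) + p w * ln (pm (B :&: C) w)
     - (p w * ln (pm B w) + p w * ln (pm C w)))).
    by rewrite sumrB !big_split /=; lra.
  apply: eq_bigr => w _; have := p_ge0 w; rewrite le_eqVlt => /predU1P[<-|pw].
    by rewrite !mul0r; lra.
  rewrite ln_div ?posrE ?mulr_gt0 ?pm_gt0 // !lnM ?posrE ?pm_gt0 //; lra.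
apply: sum_ln_ge0 => [w pw|]; first by rewrite divr_gt0 ?mulr_gt0 ?pm_gt0.
apply: (@le_trans _ _ (\sum_w p w * (pm B w * pm C w / pm (B :&: C) w / pm (B :|: C) w))).
  apply: ler_sum => w _; rewrite ler_wpM2l // le_eqVlt; apply/orP; left; apply/eqP.
  by rewrite invf_div invfM (mulrC (pm (B :|: C) w)^-1) mulrA.
apply: (@le_trans _ _ (\sum_w pm B w * pm C w / pm (B :&: C) w)).
  apply: sum_div_pm_le => [w v h|w]; last by rewrite divr_ge0 ?mulr_ge0 ?pm_ge0.
  have hB : {in B, w =1 v} by move=> e eB; apply: h; rewrite inE eB.
  have hC : {in C, w =1 v} by move=> e eB; apply: h; rewrite inE eB orbT.
  have hI : {in B :&: C, w =1 v} by move=> e; rewrite inE => /andP[/hB].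
  by rewrite (forget_depends_on _ hB) (forget_depends_on _ hC) (forget_depends_on _ hI).
have dC : depends_on C (fun w => pm C w / pm (B :&: C) w).
  move=> w v hC; have hI : {in B :&: C, w =1 v} by move=> e; rewrite inE => /andP[_ /hC].
  by rewrite (forget_depends_on _ hC) (forget_depends_on _ hI).
under eq_bigr do rewrite -mulrA.
(* The quotient depends on the C-coordinates only, so [pm B] may be smoothed by [forget C], which
   turns it into [pm (B :&: C)] and cancels the denominator. *)
rewrite -(sum_forgetM _ dC).
rewrite -[leRHS]p_sum1 -[leRHS](sum_forget C); apply: ler_sum => w _.
rewrite forget_forget setIC.
have [->|ne] := eqVneq (pm (B :&: C) w) 0; first by rewrite mul0r pm_ge0.
by rewrite mulrCA divff ?mulr1.
Qed.

Lemma cond_entropy_le0 U W : cond_entropy U W <= 0.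
Proof.
rewrite /cond_entropy /entropy opprK addrC -sumrB -oppr_ge0 -sumrN.
have -> : \sum_w - (p w * ln (pm W w) - p w * ln (pm (W :|: U) w))
  = \sum_w p w * ln (pm (W :|: U) w / pm W w).
  apply: eq_bigr => w _; have := p_ge0 w; rewrite le_eqVlt => /predU1P[<-|pw].
    by rewrite !mul0r; lra.
  rewrite ln_div ?posrE ?pm_gt0 //; lra.
apply: sum_ln_ge0 => [w pw|]; first by rewrite divr_gt0 ?pm_gt0.
rewrite -[leRHS]p_sum1 -[leRHS](sum_forget W).
under eq_bigr do rewrite invf_div.
apply: sum_div_pm_le => [|w]; last exact: pm_ge0.
by apply: depends_onS (forget_depends_on _); apply: subsetUl.
Qed.

(** By [forget_doubling] each bit costs at most ln 2, which is rounded up to 1. *)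
Lemma cond_entropy_ge U W : - #|U|%:R <= cond_entropy U W.
Proof.
rewrite /cond_entropy /entropy opprK addrC -sumrB.
rewrite -[- _]mul1r -p_sum1 big_distrl /=; apply: ler_sum => w _.
have := p_ge0 w; rewrite le_eqVlt => /predU1P[<-|pw]; first by rewrite !mul0r subr0.
rewrite -mulrBr ler_pM2l //.
have h1 : ln (pm (W :|: U) w) <= ln (2 ^+ #|U| * pm W w).
  by rewrite ler_ln ?posrE ?mulr_gt0 ?pm_gt0 ?exprn_gt0 // forget_doubling.
have h2 : ln (2 : R) *+ #|U| <= #|U|%:R.
  by rewrite lerMn2r; have := @ln_le_sub1 2 (ltr0Sn _ _) => h; apply/orP; right; lra.
move: h1; rewrite lnM ?posrE ?pm_gt0 ?exprn_gt0 // lnXn // => h1.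
by rewrite p_sum1 lerBrDl -lerBrDr opprK addrC (le_trans h1) ?lerD2r.
Qed.

(** Submodularity for [W :|: U] and [W']; disjointness makes their intersection equal to [W]. *)
Lemma cond_entropyS U W W' : W \subset W' -> [disjoint U & W'] ->
  cond_entropy U W' <= cond_entropy U W.
Proof.
move=> sW dU; have := entropy_submod (W :|: U) W'; rewrite /cond_entropy.
have -> : W :|: U :|: W' = W' :|: U.
  by rewrite setUAC (setUidPr sW).
have -> : (W :|: U) :&: W' = W.
  rewrite setIUl (setIidPl sW).
  by move: dU; rewrite -setI_eq0 => /eqP ->; rewrite setU0.
lra.
Qed.

Lemma entropy_perm (s : {perm E}) A :
  (forall v, p [ffun e => v (s e)] = p v) -> entropy (s @^-1: A) = entropy A.
Proof.
move=> ps; rewrite /entropy; congr (- _).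
rewrite (reindex_inj (h := fun v : V => [ffun e => v (s e)])) /=; last first.
  move=> v u /ffunP h; apply/ffunP => e; have := h (s^-1%g e).
  by rewrite !ffunE permKV.
by apply: eq_bigr => w _; rewrite ps -forget_perm.
Qed.

Lemma cond_entropy_perm (s : {perm E}) U W :
  (forall v, p [ffun e => v (s e)] = p v) ->
  cond_entropy (s @^-1: U) (s @^-1: W) = cond_entropy U W.
Proof. by move=> ps; rewrite /cond_entropy -preimsetU !entropy_perm. Qed.

(** The chain rule reveals the blocks one at a time, conditioning each on [V0] and the blocks
    already revealed. Passing to the larger set [G i] only lowers each term. *)
Lemma entropy_bigcup_ge (I : eqType) (s : seq I) (U G : I -> {set E}) (V0 : {set E}) :
  uniq s ->
  (forall i, i \in s -> V0 \subset G i /\ [disjoint U i & G i]) ->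
  (forall i j, i \in s -> j \in s -> i != j -> U j \subset G i) ->
  \sum_(i <- s) cond_entropy (U i) (G i) <=
    entropy (V0 :|: \bigcup_(i <- s) U i) - entropy V0.
Proof.
elim: s V0 => [|i s IH] V0 /=; first by rewrite !big_nil setU0 subrr.
move=> /andP[ni us] hG hU; rewrite !big_cons.
have [iV iD] := hG i (mem_head _ _).
have h1 := cond_entropyS iV iD.
have /= h2 := IH (V0 :|: U i) us.
rewrite -setUA in h2; apply: (le_trans (lerD h1 (h2 _ _))) => [j js|j k js ks jk|].
- have [jV jD] := hG j (@mem_behead _ (i :: s) _ js); split=> //.
  rewrite subUset jV hU // ?mem_head ?inE ?js ?orbT //.
  by apply: contraNneq ni => <-.
- by apply: hU; rewrite ?inE ?js ?ks ?orbT.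
rewrite /cond_entropy; lra.
Qed.

End Entropy.

(** * A Pinsker-type inequality *)

Section Divergence.
Variables (R : realType) (T : finType).

(** A pointwise Pinsker inequality. The free parameter [s] takes the place of a Cauchy-Schwarz step,
    and the correction [- P + Q] makes the divergence term nonnegative at every point. *)
Lemma abs_sub_le_kl (P Q s : R) : 0 <= P -> 0 <= Q -> (0 < P -> 0 < Q) -> 0 < s ->
  `|P - Q| <= s / 2 * (P * ln (P / Q) - P + Q) + s^-1 * (P + Q).
Proof.
move=> P0 Q0 PQ s0.
set a := Num.sqrt P; set b := Num.sqrt Q.
have a0 : 0 <= a by apply: sqrtr_ge0.
have b0 : 0 <= b by apply: sqrtr_ge0.
have aP : P = a ^+ 2 by rewrite sqr_sqrtr.
have bQ : Q = b ^+ 2 by rewrite sqr_sqrtr.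
(* [ln (P / Q) >= 2 (1 - sqrt (Q / P))] turns the divergence into a squared
   Hellinger distance. *)
have kl : (a - b) ^+ 2 <= P * ln (P / Q) - P + Q.
  case: (ltrP 0 P) => [Pp|]; last first.
    move=> Pn; have Pe : P = 0 by apply/eqP; rewrite eq_le Pn P0.
    have -> : a = 0 by rewrite /a Pe sqrtr0.
    by rewrite Pe mul0r bQ; lra.
  have Qp := PQ Pp.
  have ap : 0 < a by rewrite sqrtr_gt0.
  have bp : 0 < b by rewrite sqrtr_gt0.
  have -> : P / Q = ((b / a) ^+ 2)^-1 by rewrite aP bQ -expr_div_n -exprVn invf_div.
  have ba : 0 < b / a by rewrite divr_gt0.
  rewrite lnV ?posrE ?exprn_gt0 // lnXn //.
  have h := ln_le_sub1 ba.
  have : a ^+ 2 * ln (b / a) <= a ^+ 2 * (b / a - 1) by rewrite ler_wpM2l ?sqr_ge0.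
  have -> : a ^+ 2 * (b / a - 1) = a * b - a ^+ 2 by field; rewrite gt_eqF.
  rewrite aP bQ mulrN -mulr_natr; nra.
apply: (@le_trans _ _ (s / 2 * (a - b) ^+ 2 + s^-1 * (P + Q))); last first.
  by rewrite lerD2r ler_wpM2l // divr_ge0 // ltW.
have -> : P - Q = (a - b) * (a + b) by rewrite aP bQ; ring.
rewrite normrM (ger0_norm (addr_ge0 a0 b0)).
have -> : (a - b) ^+ 2 = `|a - b| ^+ 2 by rewrite real_normK ?num_real.
set x := `|a - b|; have x0 : 0 <= x by apply: normr_ge0.
have h2 : (a + b) ^+ 2 <= 2 * (P + Q) by rewrite aP bQ; have := sqr_ge0 (a - b); rewrite !expr2; nra.
have h3 : x * (a + b) <= s / 2 * x ^+ 2 + s^-1 / 2 * (a + b) ^+ 2.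
  rewrite -subr_ge0.
  have -> : s / 2 * x ^+ 2 + s^-1 / 2 * (a + b) ^+ 2 - x * (a + b)
    = s^-1 / 2 * (s * x - (a + b)) ^+ 2 by field; rewrite gt_eqF.
  by rewrite mulr_ge0 ?sqr_ge0 // divr_ge0 // invr_ge0 ltW.
apply: (le_trans h3); rewrite lerD2l.
have := ler_wpM2l _ h2; move=> /(_ (s^-1 / 2)).
rewrite divr_ge0 ?invr_ge0 ?(ltW s0) // => /(_ isT) h4; apply: (le_trans h4).
by rewrite le_eqVlt; apply/orP; left; apply/eqP; field; rewrite gt_eqF.
Qed.

Lemma l1_le_kl (P Q : T -> R) (s : R) : pdist P -> pdist Q ->
  (forall x, 0 < P x -> 0 < Q x) -> 0 < s ->
  \sum_x `|P x - Q x| <= s / 2 * (\sum_x P x * ln (P x / Q x)) + 2 / s.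
Proof.
move=> [P0 P1] [Q0 Q1] PQ s0.
apply: (le_trans (ler_sum _ (fun x _ => abs_sub_le_kl (P0 x) (Q0 x) (PQ x) s0))).
rewrite big_split /= -!big_distrr /= !big_split /= sumrN P1 Q1 le_eqVlt.
by apply/orP; left; apply/eqP; field; rewrite gt_eqF.
Qed.

End Divergence.

(** * Conditional densities and their normalisation *)

Section ConditionalDensity.
Variables (R : realType) (E : finType) (p : {ffun E -> bool} -> R).
Hypothesis p_dist : pdist p.
Local Notation V := {ffun E -> bool}.
Local Notation pm A := (forget A p).
Implicit Types (A B C U W : {set E}) (w v u : V).

(* Density, relative to uniform bits, of the U-coordinates given the
   W-coordinates; uniform when the conditioning event is null. *)
Definition cdens U W w : R :=
  if pm W w == 0 then 1 else pm (W :|: U) w / pm W w.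

Let p_ge0 w : 0 <= p w. Proof. by have [] := p_dist. Qed.
Let p_sum1 : \sum_w p w = 1. Proof. by have [] := p_dist. Qed.

Lemma cdens_ge0 U W w : 0 <= cdens U W w.
Proof. by rewrite /cdens; case: ifP => // _; rewrite divr_ge0 ?forget_ge0. Qed.

Lemma cdens_gt0 U W w : 0 < p w -> 0 < cdens U W w.
Proof.
by move=> pw; rewrite /cdens gt_eqF ?divr_gt0 ?forget_gt0.
Qed.

Lemma cdens_depends_on U W : depends_on (W :|: U) (cdens U W).
Proof.
move=> w v h; rewrite /cdens (forget_depends_on _ h).
have hW : {in W, w =1 v} by move=> e eW; apply: h; rewrite inE eW.
by rewrite (forget_depends_on _ hW).
Qed.

(** Averaging over the U-coordinates turns [pm (W :|: U)] into [pm W]. The value 1 chosen on null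
    conditioning events is what lets this hold at every point. *)
Lemma forget_cdens U U' W w : U \subset U' -> [disjoint U' & W] ->
  forget (~: U') (cdens U W) w = 1.
Proof.
move=> sU dW.
have WU' : W \subset ~: U' by rewrite -disjoints_subset disjoint_sym.
have dinv : depends_on (~: U') (fun v => (pm W v)^-1).
  by apply: (depends_onS WU') => u v h; rewrite (forget_depends_on _ h).
have dnul : depends_on (~: U') (fun v => (pm W v == 0)%:R : R).
  by apply: (depends_onS WU') => u v h; rewrite (forget_depends_on _ h).
(* Null and non-null conditioning events are separated; the first summand vanishes on the null ones
   because the inverse of 0 is 0. *)
transitivity (forget (~: U') (fun v => pm (W :|: U) v * (pm W v)^-1) w +
              forget (~: U') (fun v => 1 * (pm W v == 0)%:R) w).
  rewrite /forget -big_split /=; apply: eq_bigr => v _; rewrite -mulrDr; congr (_ * _).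
  rewrite -!/(forget _ _ _) /cdens.
  by have [->|_] := eqVneq (pm W v) 0; rewrite ?invr0 ?mulr0 ?mul1r ?add0r ?addr0.
rewrite !forgetM // forget_forget.
have -> : ~: U' :&: (W :|: U) = W.
  rewrite setIUr (setIidPr WU').
  have -> : ~: U' :&: U = set0 by apply/eqP; rewrite setIC setI_eq0 disjoints_subset setCK.
  by rewrite setU0.
have -> : forget (~: U') (fun=> 1) w = 1 :> R.
  by rewrite /forget -[RHS](kernel_sum1 R (~: U') w); apply: eq_bigr => v _; rewrite mulr1.
by have [->|ne] := eqVneq (pm W w) 0; rewrite ?mul0r ?mulfV ?mulr1 ?mulr0 ?add0r ?addr0.
Qed.

Lemma sum_ln_cdens U W : \sum_w p w * ln (cdens U W w) = - cond_entropy p U W.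
Proof.
rewrite /cond_entropy /entropy opprD opprK opprK -sumrB; apply: eq_bigr => w _.
have := p_ge0 w; rewrite le_eqVlt => /predU1P[<-|pw]; first by rewrite !mul0r subr0.
by rewrite /cdens gt_eqF ?forget_gt0 // ln_div ?posrE ?forget_gt0 // mulrBr.
Qed.

(** The factors are integrated out one at a time: each averages to 1 over its own [U i], on which
    neither [g] nor the other factors depend. *)
Lemma sum_prod_cdens (I : eqType) (s : seq I) (U W : I -> {set E}) (V0 : {set E})
    (g : V -> R) :
  uniq s -> depends_on V0 g ->
  (forall i, i \in s -> W i \subset V0 /\ [disjoint U i & V0]) ->
  (forall i j, i \in s -> j \in s -> i != j -> [disjoint U i & U j]) ->
  \sum_w g w * \prod_(i <- s) cdens (U i) (W i) w = \sum_w g w.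
Proof.
elim: s => [|i s IH] /=; first by move=> *; apply: eq_bigr => w _; rewrite big_nil mulr1.
move=> /andP[ni us] dg hW hU.
have [iW iD] := hW i (mem_head _ _).
have d : depends_on (~: U i) (fun w => g w * \prod_(j <- s) cdens (U j) (W j) w).
  apply: depends_onM.
    by apply: depends_onS dg; rewrite -disjoints_subset disjoint_sym.
  move=> w v h; apply: eq_big_seq => j js.
  have [jW jD] := hW j (@mem_behead _ (i :: s) _ js).
  have ij : i != j by apply: contraNneq ni => ->.
  apply: cdens_depends_on => e; rewrite inE => he; apply: h; move: he.
  have sub : W j :|: U j \subset ~: U i.
    rewrite subUset -!disjoints_subset; apply/andP; split.
      by rewrite disjoint_sym; apply: disjointWr iD.
    by apply: hU; rewrite ?mem_head ?inE ?js ?orbT // eq_sym.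
  by move=> he; apply: (subsetP sub); rewrite inE.
rewrite -[RHS](IH us dg) => [|j js|j k js ks]; last 2 first.
- by apply: hW; rewrite inE js orbT.
- by apply: hU; rewrite inE ?js ?ks orbT.
transitivity (\sum_w cdens (U i) (W i) w * (g w * \prod_(j <- s) cdens (U j) (W j) w)).
  by apply: eq_bigr => w _; rewrite big_cons mulrCA.
rewrite -(sum_forgetM _ d); apply: eq_bigr => w _; rewrite forget_cdens ?mul1r //.
by apply: disjointWr iD.
Qed.

End ConditionalDensity.

(** * Regularity of exchangeable arrays *)

(** The components are the level, the block inside the level, and the test of which the pin is a
    copy. *)
Definition pin_index (Tt : finType) (N : nat) : finType := ('I_3 * 'I_N * Tt)%type.
(* Rows and columns are indexed alike: test indices on the left, pinned ones,
   grouped in blocks that are copies of the tests, on the right. *)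
Definition idx (Tt : finType) (N : nat) : finType := (Tt + pin_index Tt N)%type.
(* Entries of the array of pairs: [false] selects x and [true] selects z. *)
Definition entry (Tt : finType) (N : nat) : finType := (idx Tt N * idx Tt N * bool)%type.

Section Levels.
Variables (Tt : finType) (N : nat).
Local Notation I := (idx Tt N).
Local Notation E := (entry Tt N).
Implicit Types (i j : I) (lv : 'I_3 -> nat) (e : E) (a b : Tt).

Definition is_test i : bool := if i is inl _ then true else false.

Definition pinned (c : nat) lv i : bool :=
  if i is inr (k, l, _) then (k <= c)%N && (l < lv k)%N else false.

Definition incr lv (k : 'I_3) : 'I_3 -> nat :=
  fun k' => if k' == k then (lv k).+1 else lv k'.

(** The exempted test [s] is the one whose own block is being conditioned: it stays in place while
    the other tests become pins. With [None] every test moves. *)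
Definition swap_fun (k : 'I_3) (l : 'I_N) (s : option Tt) i : I :=
  match i with
  | inl a => if Some a == s then inl a else inr (k, l, a)
  | inr (k', l', a) =>
      if [&& k' == k, l' == l & Some a != s] then inl a else inr (k', l', a)
  end.

Lemma swap_funK k l s : involutive (swap_fun k l s).
Proof.
case=> [a|[[k' l'] a]] /=.
  by case: ifP => h /=; rewrite ?h // !eqxx.
case: ifP => h /=; last by rewrite h.
by have /and3P[/eqP -> /eqP -> /negbTE ->] := h.
Qed.

Definition swap k l s : {perm I} := perm (inv_inj (swap_funK k l s)).

Lemma swapE k l s i : swap k l s i = swap_fun k l s i.
Proof. by rewrite permE. Qed.

Lemma swap_special_eq k l a i : (swap k l (Some a) i == inl a) = (i == inl a).
Proof.
rewrite swapE; case: i => [a'|[[k' l'] a']] /=.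
  case: ifP => [/eqP [->]|] //; by move/eqP => h; apply/esym/eqP => -[ha]; apply: h; rewrite ha.
by case: ifP => // /and3P[_ _ ne]; apply/eqP => -[ha]; rewrite ha eqxx in ne.
Qed.

Lemma pinned_swap c lv (k : 'I_3) (l : 'I_N) s i : l = lv k :> nat ->
  pinned c lv i -> pinned c (incr lv k) (swap k l s i).
Proof.
move=> lk; rewrite swapE; case: i => [//|[[k' l'] a]] /= /andP[kc h].
case: ifP => [/and3P[/eqP ek /eqP el _]|_] /=.
  by move: h; rewrite ek el lk ltnn.
rewrite kc /= /incr; case: eqP => [e|_] //.
by rewrite -e (ltn_trans h).
Qed.

Lemma test_swap c lv (k : 'I_3) (l : 'I_N) s a : l = lv k :> nat -> (k <= c)%N ->
  Some a != s -> pinned c (incr lv k) (swap k l s (inl a)).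
Proof.
move=> lk kc ne; rewrite swapE /= (negbTE ne) /= kc /incr eqxx /=.
by rewrite lk.
Qed.

Lemma pinned_swap_below c lv (k : 'I_3) (l : 'I_N) s i : (c < k)%N ->
  pinned c lv (swap k l s i) = pinned c lv i.
Proof.
move=> ck; rewrite swapE; case: i => [a|[[k' l'] a]] /=.
  by case: ifP => //= _; rewrite leqNgt ck.
by case: ifP => //= /and3P[/eqP -> _ _]; rewrite leqNgt ck.
Qed.

Lemma pinned_incr_below c lv (k : 'I_3) i : (c < k)%N ->
  pinned c (incr lv k) i = pinned c lv i.
Proof.
move=> ck; case: i => [//|[[k' l'] a]] /=; rewrite /incr; case: eqP => // ->.
by rewrite leqNgt ck.
Qed.

Lemma card_pinned c lv : (c <= 2)%N -> (forall k : 'I_3, (lv k <= N)%N) ->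
  (#|[set i | pinned c lv i]| <= (\sum_(k < 3 | (k <= c)%N) lv k) * #|Tt|)%N.
Proof.
move=> c2 lvN.
have -> : [set i | pinned c lv i] = \bigcup_(k < 3 | (k <= c)%N)
   [set (inr (k, widen_ord (lvN k) x.1, x.2) : I) | x in [set: ('I_(lv k) * Tt)%type]].
  apply/setP => i; rewrite inE; apply/idP/bigcupP.
    case: i => [//|[[k l] a]] /= /andP[kc ll]; exists k => //.
    apply/imsetP; exists (Ordinal ll, a); rewrite ?inE //=.
    by congr (inr (_, _, _)); apply: val_inj.
  by move=> [k kc /imsetP [[l a] _ ->]] /=; rewrite kc ltn_ord.
apply: (@leq_trans (\sum_(k < 3 | (k <= c)%N) lv k * #|Tt|)); last by rewrite big_distrl.
elim/big_ind2: _ => [|A n B m hA hB|k _]; first by rewrite cards0.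
  by apply: (leq_trans (leq_card_setU _ _)); apply: leq_add.
by apply: (leq_trans (leq_imset_card _ _)); rewrite cardsT card_prod card_ord.
Qed.

Variable lv : 'I_3 -> nat.

(* The z-entries are regenerated from the x-entries in the order L, K, Th, Z:
   L between pins, K a for a test row a, Th b for a test column b, and Z (a, b)
   for a test entry. Each block may only consult its conditioning set, which
   sees no other test row or column. *)
Definition blockX : {set E} := [set e | ~~ e.2 &&
  ((is_test e.1.1 || pinned 2 lv e.1.1) && (is_test e.1.2 || pinned 2 lv e.1.2))].
Definition blockXp : {set E} := [set e | ~~ e.2 && (pinned 2 lv e.1.1 && pinned 2 lv e.1.2)].
Definition inL e := e.2 && ((pinned 1 lv e.1.1 && pinned 0 lv e.1.2)
   || (pinned 0 lv e.1.1 && pinned 1 lv e.1.2)).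
Definition blockL : {set E} := [set e | inL e].
Definition blockK a : {set E} := [set e | e.2 && ((e.1.1 == inl a) && pinned 0 lv e.1.2)].
Definition condK a : {set E} := [set e | inL e || ~~ e.2 &&
  (((e.1.1 == inl a) || pinned 2 lv e.1.1) && pinned 2 lv e.1.2)].
Definition blockTh b : {set E} := [set e | e.2 && (pinned 0 lv e.1.1 && (e.1.2 == inl b))].
Definition condTh b : {set E} := [set e | inL e || ~~ e.2 &&
  (pinned 2 lv e.1.1 && ((e.1.2 == inl b) || pinned 2 lv e.1.2))].
Definition blockZ (ab : Tt * Tt) : {set E} := [set (inl ab.1, inl ab.2, true)].
Definition condZ (ab : Tt * Tt) : {set E} := [set e | [|| inL e, e \in blockK ab.1,
   e \in blockTh ab.2 | ~~ e.2 && (((e.1.1 == inl ab.1) || pinned 2 lv e.1.1) &&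
   ((e.1.2 == inl ab.2) || pinned 2 lv e.1.2))]].

Definition layer1 := blockX :|: blockL.
Definition layer2 := layer1 :|: \bigcup_(a <- index_enum Tt) blockK a.
Definition layer3 := layer2 :|: \bigcup_(b <- index_enum Tt) blockTh b.
Definition layer4 := layer3 :|: \bigcup_(ab <- index_enum (Tt * Tt)%type) blockZ ab.

Lemma in_layer1 e : (e \in layer1) = (e \in blockX) || inL e.
Proof. by rewrite !inE. Qed.

Lemma in_layer2 e : (e \in layer2) = [|| e \in blockX, inL e |
   e.2 && (is_test e.1.1 && pinned 0 lv e.1.2)].
Proof.
rewrite in_setU in_layer1 -orbA; congr (_ || (_ || _)).
apply/bigcupP/idP => [[a _]|]; first by rewrite inE => /and3P[-> /eqP -> ->].
move: e => [[i j] []] //=; case: i => [a|] //= h.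
by exists a => //; rewrite inE /= eqxx h.
Qed.

Lemma in_layer3 e : (e \in layer3) = [|| e \in blockX, inL e |
   e.2 && ((is_test e.1.1 && pinned 0 lv e.1.2) || (pinned 0 lv e.1.1 && is_test e.1.2))].
Proof.
rewrite in_setU in_layer2 -!orbA andb_orr; congr (_ || (_ || (_ || _))).
apply/bigcupP/idP => [[a _]|]; first by rewrite inE => /and3P[-> -> /eqP ->].
move: e => [[i j] []] //=; case: j => [b|] /=; rewrite ?andbF // andbT => h.
by exists b => //; rewrite inE /= eqxx h.
Qed.
End Levels.
Arguments blockX {Tt N} lv.
Arguments blockXp {Tt N} lv.
Arguments blockL {Tt N} lv.
Arguments blockK {Tt N} lv a.
Arguments condK {Tt N} lv a.
Arguments blockTh {Tt N} lv b.
Arguments condTh {Tt N} lv b.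
Arguments blockZ {Tt N} ab.
Arguments condZ {Tt N} lv ab.
Arguments layer1 {Tt N} lv.
Arguments layer2 {Tt N} lv.
Arguments layer3 {Tt N} lv.
Arguments layer4 {Tt N} lv.

(** * Conditional entropies at the next level against layer increments *)

Section Regularity.
Variables (R : realType) (Tt : finType) (N : nat).
Local Notation I := (idx Tt N).
Local Notation E := (entry Tt N).
Local Notation V := {ffun E -> bool}.

Lemma entry_perm_inj (s s' : {perm I}) :
  injective (fun e : E => (s e.1.1, s' e.1.2, e.2) : E).
Proof. by move=> [[i j] b] [[i' j'] b'] /= [/perm_inj -> /perm_inj -> ->]. Qed.

Definition entry_perm (s s' : {perm I}) : {perm E} := perm (@entry_perm_inj s s').

Definition exchangeable (p : V -> R) := forall (s s' : {perm I}) (v : V),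
  p [ffun e : E => v (entry_perm s s' e)] = p v.

Variable p : V -> R.
Hypotheses (p_dist : pdist p) (p_exch : exchangeable p).
Local Notation H := (entropy p).
Local Notation Hc := (cond_entropy p).

Definition entL lv := Hc (blockL lv) (blockXp lv).
Definition entK lv := \sum_(a : Tt) Hc (blockK lv a) (condK lv a).
Definition entTh lv := \sum_(b : Tt) Hc (blockTh lv b) (condTh lv b).
Definition entZ lv := \sum_(ab : Tt * Tt) Hc (blockZ ab) (condZ lv ab).

Section Level.
Variable lv : 'I_3 -> nat.
Hypothesis lvN : forall k, (lv k < N)%N.
Let blk k := Ordinal (lvN k).
Let sw k (s : option Tt) := swap k (blk k) s.

Let cover c (k : 'I_3) (s : option Tt) i : (k <= c)%N -> is_test i || pinned c lv i ->
  (if s is Some a then i == inl a else false) || pinned c (incr lv k) (sw k s i).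
Proof.
move=> kc; case/orP => [|h]; last by rewrite pinned_swap ?orbT.
case: i => // a _; case: s => [a'|]; last by rewrite test_swap.
case: (eqVneq a a') => [->|ne]; first by rewrite eqxx.
by rewrite test_swap ?orbT //; apply: contraNneq ne => -[->].
Qed.

Let coverN c (k : 'I_3) i : (k <= c)%N -> is_test i || pinned c lv i ->
  pinned c (incr lv k) (sw k None i).
Proof. by move=> kc h; have := cover None kc h. Qed.

Let coverS c (k : 'I_3) a i : (k <= c)%N -> is_test i || pinned c lv i ->
  (i == inl a) || pinned c (incr lv k) (sw k (Some a) i).
Proof. by move=> kc h; have := cover (Some a) kc h. Qed.

Let lift_pin c k (s : option Tt) i : pinned c lv i -> pinned c (incr lv k) (sw k s i).
Proof. exact: pinned_swap. Qed.

Let o0 : 'I_3 := @Ordinal 3 0 isT.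
Let o1 : 'I_3 := @Ordinal 3 1 isT.
Let o2 : 'I_3 := @Ordinal 3 2 isT.

Let lift_L k s s' i j b : inL lv (i, j, b) ->
  inL (incr lv k) (sw k s i, sw k s' j, b).
Proof.
rewrite /inL /= => /andP[-> /orP[/andP[hi hj]|/andP[hi hj]]] /=;
by rewrite (lift_pin _ _ hi) (lift_pin _ _ hj) ?orbT.
Qed.

(* In each of the four bounds below, exchanging the remaining tests with the
   first unused block carries everything revealed so far into the conditioning
   set of the next level. *)
Lemma entL_drop : entL (incr lv o2) <= H (layer1 lv) - H (blockX lv).
Proof.
set s := entry_perm (sw o2 None) (sw o2 None).
have sE i j b : s (i, j, b) = (sw o2 None i, sw o2 None j, b) by rewrite permE.
have -> : entL (incr lv o2) = Hc (blockL lv) (s @^-1: blockXp (incr lv o2)).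
  rewrite /entL -[LHS](cond_entropy_perm _ _ (p_exch (sw o2 None) (sw o2 None))) -/s.
  have e : s @^-1: blockL (incr lv o2) = blockL lv; last by rewrite e.
  apply/setP => -[[i j] b].
  by rewrite !inE /inL sE /= !pinned_swap_below // !pinned_incr_below.
apply: (@cond_entropyS _ _ _ p_dist (blockL lv) (blockX lv)).
  apply/subsetP => -[[i j] b]; rewrite !inE sE /= => /and3P[-> hi hj] /=.
  by rewrite (coverN _ hi) // (coverN _ hj).
rewrite disjoints_subset; apply/subsetP => -[[i j] b].
by rewrite !inE /inL sE /= => /andP[->].
Qed.

(** The test rows other than [a] go to level 1, so their z-entries at level-0 columns become entries
    between levels 1 and 0. This is why [inL] reaches up to level 1. *)
Lemma entK_drop : entK (incr lv o1) <= H (layer2 lv) - H (layer1 lv).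
Proof.
pose s a := entry_perm (sw o1 (Some a)) (sw o1 None).
have sE a i j b : s a (i, j, b) = (sw o1 (Some a) i, sw o1 None j, b) by rewrite permE.
have -> : entK (incr lv o1) =
    \sum_(a <- index_enum Tt) Hc (blockK lv a) (s a @^-1: condK (incr lv o1) a).
  apply: eq_bigr => a _.
  rewrite -[LHS](cond_entropy_perm _ _ (p_exch (sw o1 (Some a)) (sw o1 None))) -/(s a).
  have e : s a @^-1: blockK (incr lv o1) a = blockK lv a; last by rewrite e.
  apply/setP => -[[i j] b].
  by rewrite !inE sE /= swap_special_eq pinned_swap_below // pinned_incr_below.
apply: entropy_bigcup_ge => //; first exact: index_enum_uniq.
  move=> a _; split.
    apply/subsetP => -[[i j] b]; rewrite in_layer1 !inE sE /= => /orP[/and3P[-> hi hj]|h].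
      rewrite swap_special_eq (coverN _ hj) // andbT.
      by rewrite (coverS a _ hi) ?orbT.
    by rewrite lift_L.
  rewrite disjoints_subset; apply/subsetP => -[[i j] b].
  rewrite !inE /inL sE /= => /and3P[-> /eqP -> hj] /=.
  by rewrite !swapE /= eqxx /= ?orbF.
move=> a a' _ _ ne; apply/subsetP => -[[i j] b].
rewrite !inE /inL sE /= => /and3P[-> /eqP -> hj] /=.
rewrite (@test_swap _ _ 1 lv o1 _ (Some a) a') //= ?(lift_pin _ _ hj) //.
by apply: contraNneq ne => -[->].
Qed.

(** All test rows move as well, so that the blocks [blockK] already revealed land in [inL]; among
    the columns only [a] stays in place. *)
Lemma entTh_drop : entTh (incr lv o1) <= H (layer3 lv) - H (layer2 lv).
Proof.
pose s a := entry_perm (sw o1 None) (sw o1 (Some a)).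
have sE a i j b : s a (i, j, b) = (sw o1 None i, sw o1 (Some a) j, b) by rewrite permE.
have -> : entTh (incr lv o1) =
    \sum_(a <- index_enum Tt) Hc (blockTh lv a) (s a @^-1: condTh (incr lv o1) a).
  apply: eq_bigr => a _.
  rewrite -[LHS](cond_entropy_perm _ _ (p_exch (sw o1 None) (sw o1 (Some a)))) -/(s a).
  have e : s a @^-1: blockTh (incr lv o1) a = blockTh lv a; last by rewrite e.
  apply/setP => -[[i j] b].
  by rewrite !inE sE /= swap_special_eq pinned_swap_below // pinned_incr_below.
apply: entropy_bigcup_ge => //; first exact: index_enum_uniq.
  move=> a _; split.
    apply/subsetP => -[[i j] b]; rewrite in_layer2 !inE sE /=.
    case/or3P => [/and3P[-> hi hj]|h|/and3P[-> hi hj]].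
    - rewrite swap_special_eq (coverN _ hi) // (coverS a _ hj) //.
      by rewrite orbT.
    - by rewrite lift_L.
    - rewrite /inL /=; case: i hi => // a' _.
      by rewrite test_swap //= lift_pin.
  rewrite disjoints_subset; apply/subsetP => -[[i j] b].
  rewrite !inE /inL sE /= => /and3P[-> hi /eqP ->] /=.
  by rewrite !swapE /= eqxx /= ?andbF.
move=> a a' _ _ ne; apply/subsetP => -[[i j] b].
rewrite !inE /inL sE /= => /and3P[-> hi /eqP ->] /=.
rewrite (@test_swap _ _ 1 lv o1 _ (Some a) a') //=.
  by rewrite (lift_pin _ _ hi) orbT.
by apply: contraNneq ne => -[->].
Qed.

(** Another test entry ends up in [blockK] if only its column moves, in [blockTh] if only its row
    moves, and in [inL] if both do. All three belong to [condZ] at the next level. *)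
Lemma entZ_drop : entZ (incr lv o0) <= H (layer4 lv) - H (layer3 lv).
Proof.
pose s (ab : Tt * Tt) := entry_perm (sw o0 (Some ab.1)) (sw o0 (Some ab.2)).
have sE ab i j b : s ab (i, j, b) = (sw o0 (Some ab.1) i, sw o0 (Some ab.2) j, b).
  by rewrite permE.
have -> : entZ (incr lv o0) =
    \sum_(ab <- index_enum (Tt * Tt)%type)
       Hc (blockZ ab) (s ab @^-1: condZ (incr lv o0) ab).
  apply: eq_bigr => ab _.
  rewrite -[LHS](cond_entropy_perm _ _ (p_exch (sw o0 (Some ab.1)) (sw o0 (Some ab.2)))) -/(s ab).
  have e : s ab @^-1: blockZ ab = blockZ ab; last by rewrite e.
  apply/setP => -[[i j] b].
  by rewrite !inE sE !xpair_eqE /= !swap_special_eq.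
apply: entropy_bigcup_ge => //; first exact: index_enum_uniq.
  move=> ab _; split.
    apply/subsetP => -[[i j] b]; rewrite in_layer3 !inE sE /= !swap_special_eq.
    case/or3P => [/and3P[-> hi hj]|h|/andP[-> /orP[/andP[hi hj]|/andP[hi hj]]]].
    - by rewrite (coverS ab.1 _ hi) // (coverS ab.2 _ hj) // !orbT.
    - by rewrite lift_L.
    - have := @coverS 1 o0 ab.1 i isT; rewrite hi => /(_ isT).
      by rewrite /inL /= => /orP[->|->]; rewrite (lift_pin _ _ hj) ?orbT.
    - have := @coverS 1 o0 ab.2 j isT; rewrite hj => /(_ isT).
      by rewrite /inL /= => /orP[->|->]; rewrite (lift_pin _ _ hi) ?orbT.
  rewrite disjoints_subset; apply/subsetP => -[[i j] b].
  rewrite !inE /inL sE /= => /eqP [-> -> ->] /=.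
  by rewrite !swapE /= !eqxx /= ?andbF.
move=> ab ab' _ _ ne; apply/subsetP => -[[i j] b].
rewrite !inE => /eqP [-> -> ->]; rewrite sE /inL /= !swap_special_eq.
have c0 c a a' : (inl a' == inl a :> I) || pinned c (incr lv o0) (sw o0 (Some a) (inl a')).
  exact: (coverS a).
case: (eqVneq ab'.1 ab.1) => [e1|n1].
  have n2 : ab'.2 != ab.2.
    by apply: contraNneq ne => e2; rewrite (surjective_pairing ab) (surjective_pairing ab') e1 e2.
  rewrite e1 eqxx /=.
  by rewrite (@test_swap _ _ 0 lv o0 _ (Some ab.2)) ?orbT //; apply: contraNneq n2 => -[->].
have t1 c : pinned c (incr lv o0) (sw o0 (Some ab.1) (inl ab'.1)).
  by apply: test_swap => //; apply: contraNneq n1 => -[->].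
by rewrite !t1 /=; case/orP: (c0 0 ab.2 ab'.2) => ->; rewrite ?orbT.
Qed.

End Level.
End Regularity.

(** * The regenerated law and its divergence *)

Section Regenerated.
Variables (R : realType) (Tt : finType) (N : nat).
Local Notation I := (idx Tt N).
Local Notation E := (entry Tt N).
Local Notation V := {ffun E -> bool}.
Variable p : V -> R.
Hypothesis p_dist : pdist p.
Local Notation H := (entropy p).
Local Notation cd := (cdens p).
Let p_ge0 w : 0 <= p w. Proof. by have [] := p_dist. Qed.

Definition cond_prod lv (w : V) : R :=
  cd (blockL lv) (blockXp lv) w *
  \prod_(a : Tt) cd (blockK lv a) (condK lv a) w *
  \prod_(b : Tt) cd (blockTh lv b) (condTh lv b) w *
  \prod_(ab : Tt * Tt) cd (blockZ ab) (condZ lv ab) w.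

(** The factors of [cond_prod] are densities against uniform bits, which is why they multiply a law
    already made uniform outside [blockX]. *)
Definition regen lv w : R := forget (blockX lv) p w * cond_prod lv w.

Variable lv : 'I_3 -> nat.

Lemma Xp_sub_X : @blockXp Tt N lv \subset blockX lv.
Proof. by apply/subsetP => -[[i j] b]; rewrite !inE /= => /and3P[-> -> ->]; rewrite !orbT. Qed.

Lemma condK_sub a : @condK Tt N lv a \subset layer1 lv.
Proof.
apply/subsetP => -[[i j] b]; rewrite in_layer1 !inE /= => /orP[->|]; first by rewrite orbT.
case/and3P => -> hi ->; rewrite orbT andbT.
by case/orP: hi => [/eqP ->|->] //=; rewrite !orbT.
Qed.

Lemma condTh_sub b : @condTh Tt N lv b \subset layer2 lv.
Proof.
apply/subsetP => -[[i j] c]; rewrite in_layer2 !inE /= => /orP[->|]; first by rewrite orbT.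
case/and3P => -> -> hj; rewrite orbT /=.
by case/orP: hj => [/eqP ->|->] //=; rewrite !orbT.
Qed.

Lemma condZ_sub ab : @condZ Tt N lv ab \subset layer3 lv.
Proof.
apply/subsetP => -[[i j] c]; rewrite in_layer3 !inE /=.
case/or4P => [->|/and3P[-> /eqP -> ->]|/and3P[-> -> /eqP ->]|/and3P[-> hi hj]].
- by rewrite orbT.
- by rewrite /= ?orbT.
- by rewrite /= ?orbT.
by case/orP: hi => [/eqP ->|->]; case/orP: hj => [/eqP ->|->]; rewrite /= ?orbT.
Qed.

Lemma L_disj : [disjoint @blockL Tt N lv & blockX lv].
Proof.
rewrite disjoints_subset; apply/subsetP => -[[i j] b].
by rewrite !inE /inL /= => /andP[->].
Qed.

Lemma K_disj a : [disjoint @blockK Tt N lv a & layer1 lv].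
Proof.
rewrite disjoints_subset; apply/subsetP => -[[i j] b]; rewrite in_setC in_layer1.
by rewrite !inE /inL /= => /and3P[-> /eqP ->].
Qed.

Lemma Th_disj b : [disjoint @blockTh Tt N lv b & layer2 lv].
Proof.
rewrite disjoints_subset; apply/subsetP => -[[i j] c]; rewrite in_setC in_layer2.
rewrite !inE /inL /= => /and3P[-> hi /eqP ->] /=; rewrite !andbF /=.
by [].
Qed.

Lemma Z_disj ab : [disjoint @blockZ Tt N ab & layer3 lv].
Proof.
rewrite disjoints_subset; apply/subsetP => -[[i j] c]; rewrite in_setC in_layer3.
by rewrite !inE /inL /= => /eqP[-> -> ->].
Qed.

(** Blocks are removed in the reverse of the order of generation: each conditioning set lies in the
    layer below, and each block is disjoint from that layer. *)
Lemma sum_cond_prod (g : V -> R) : depends_on (blockX lv) g ->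
  \sum_w g w * cond_prod lv w = \sum_w g w.
Proof.
move=> dg.
have s1 : @blockX Tt N lv \subset layer1 lv by apply: subsetUl.
have s2 : @layer1 Tt N lv \subset layer2 lv by apply: subsetUl.
have s3 : @layer2 Tt N lv \subset layer3 lv by apply: subsetUl.
have dL : depends_on (layer1 lv) (fun w => g w * cd (blockL lv) (blockXp lv) w).
  apply: depends_onM; first exact: depends_onS dg.
  apply: depends_onS (@cdens_depends_on _ _ _ _ _).
  by rewrite subUset subsetUr (subset_trans Xp_sub_X).
have dK : depends_on (layer2 lv) (fun w => g w * cd (blockL lv) (blockXp lv) w *
    \prod_(a : Tt) cd (blockK lv a) (condK lv a) w).
  apply: depends_onM; first exact: depends_onS dL.
  apply: depends_on_prod => a _; apply: depends_onS (@cdens_depends_on _ _ _ _ _).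
  rewrite subUset (subset_trans (condK_sub a)) //=.
  by apply: subset_trans (subsetUr _ _); apply: bigcup_sup.
have dTh : depends_on (layer3 lv) (fun w => g w * cd (blockL lv) (blockXp lv) w *
    \prod_(a : Tt) cd (blockK lv a) (condK lv a) w *
    \prod_(b : Tt) cd (blockTh lv b) (condTh lv b) w).
  apply: depends_onM; first exact: depends_onS dK.
  apply: depends_on_prod => a _; apply: depends_onS (@cdens_depends_on _ _ _ _ _).
  rewrite subUset (subset_trans (condTh_sub a)) //=.
  by apply: subset_trans (subsetUr _ _); apply: bigcup_sup.
rewrite /cond_prod; under eq_bigr do rewrite !mulrA.
rewrite (sum_prod_cdens p (index_enum_uniq _) dTh); last 2 first.
- by move=> ab _; split; [exact: condZ_sub|exact: Z_disj].
- move=> ab ab' _ _ ne; rewrite disjoints_subset sub1set !inE.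
  apply: contraNneq ne => -[e1 e2].
  by rewrite (surjective_pairing ab) (surjective_pairing ab') e1 e2.
rewrite (sum_prod_cdens p (index_enum_uniq _) dK); last 2 first.
- by move=> b _; split; [exact: condTh_sub|exact: Th_disj].
- move=> b b' _ _ ne; rewrite disjoints_subset; apply/subsetP => -[[i j] c].
  rewrite !inE /= => /and3P[-> -> /eqP ->] /=; by apply: contraNneq ne => -[->].
rewrite (sum_prod_cdens p (index_enum_uniq _) dL); last 2 first.
- by move=> b _; split; [exact: condK_sub|exact: K_disj].
- move=> b b' _ _ ne; rewrite disjoints_subset; apply/subsetP => -[[i j] c].
  rewrite !inE /= => /and3P[-> /eqP -> ->] /=; rewrite andbT.
  by apply: contraNneq ne => -[->].
have := @sum_prod_cdens _ _ p unit [:: tt] (fun=> blockL lv) (fun=> blockXp lv)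
   (blockX lv) g isT dg.
under eq_bigr do rewrite big_seq1.
apply=> [_ _|[] []] //; split; [exact: Xp_sub_X|exact: L_disj].
Qed.

Lemma cond_prod_ge0 w : 0 <= cond_prod lv w.
Proof. by rewrite !mulr_ge0 ?cdens_ge0 ?prodr_ge0 // => *; apply: cdens_ge0. Qed.

Lemma cond_prod_gt0 w : 0 < p w -> 0 < cond_prod lv w.
Proof. by move=> pw; rewrite !mulr_gt0 ?cdens_gt0 ?prodr_gt0 // => *; apply: cdens_gt0. Qed.

Lemma cond_prod_depends_on : depends_on (layer4 lv) (cond_prod lv).
Proof.
have s2 : @layer1 Tt N lv \subset layer2 lv by apply: subsetUl.
have s3 : @layer2 Tt N lv \subset layer3 lv by apply: subsetUl.
have s4 : @layer3 Tt N lv \subset layer4 lv by apply: subsetUl.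
have s24 := subset_trans s3 s4; have s14 := subset_trans s2 s24.
repeat apply: depends_onM.
- apply: depends_onS (@cdens_depends_on _ _ _ _ _).
  apply: subset_trans s14; rewrite subUset subsetUr (subset_trans Xp_sub_X) //.
  exact: subsetUl.
- apply: depends_on_prod => a _; apply: depends_onS (@cdens_depends_on _ _ _ _ _).
  rewrite subUset (subset_trans (condK_sub a)) //=.
  by apply: subset_trans s24; apply: subset_trans (subsetUr _ _); apply: bigcup_sup.
- apply: depends_on_prod => a _; apply: depends_onS (@cdens_depends_on _ _ _ _ _).
  rewrite subUset (subset_trans (condTh_sub a)) //=.
  by apply: subset_trans s4; apply: subset_trans (subsetUr _ _); apply: bigcup_sup.
- apply: depends_on_prod => a _; apply: depends_onS (@cdens_depends_on _ _ _ _ _).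
  rewrite subUset (subset_trans (condZ_sub a)) //=.
  by apply: subset_trans (subsetUr _ _); apply: bigcup_sup.
Qed.

Lemma regen_dist : pdist (regen lv).
Proof.
split=> [w|]; first by rewrite mulr_ge0 ?cond_prod_ge0 ?forget_ge0.
rewrite sum_cond_prod; last exact: forget_depends_on.
by rewrite sum_forget; have [] := p_dist.
Qed.

Lemma ln_prod (T : finType) (F : T -> R) : (forall t, 0 < F t) ->
  ln (\prod_t F t) = \sum_t ln (F t).
Proof.
move=> F0; suff [] : 0 < \prod_t F t /\ ln (\prod_t F t) = \sum_t ln (F t) by [].
elim/big_ind2: _ => [|x u y v [x0 <-] [y0 <-]|t _]; first by rewrite ln1.
  by rewrite mulr_gt0 // lnM.
by split=> //; apply: F0.
Qed.

(** The logarithm splits over the factors, and the mean log-density of a factor is minus its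
    conditional entropy. What remains is the excess over the chain rule, which the four drops
    control. *)
Lemma regen_kl : \sum_w forget (layer4 lv) p w * ln (forget (layer4 lv) p w / regen lv w)
  = entL p lv + entK p lv + entTh p lv + entZ p lv - (H (layer4 lv) - H (blockX lv)).
Proof.
have s4 : @blockX Tt N lv \subset layer4 lv by rewrite /layer4 /layer3 /layer2 /layer1 -!setUA subsetUl.
rewrite sum_forgetM; last first.
  move=> w v h; rewrite /regen (cond_prod_depends_on h) (forget_depends_on _ h).
  rewrite (forget_depends_on _ (_ : {in blockX lv, w =1 v})) //.
  by move=> e eX; apply: h; apply: (subsetP s4).
transitivity (\sum_w (p w * ln (forget (layer4 lv) p w) - p w * ln (forget (blockX lv) p w)
  - p w * ln (cd (blockL lv) (blockXp lv) w)
  - \sum_(a : Tt) p w * ln (cd (blockK lv a) (condK lv a) w)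
  - \sum_(b : Tt) p w * ln (cd (blockTh lv b) (condTh lv b) w)
  - \sum_(ab : Tt * Tt) p w * ln (cd (blockZ ab) (condZ lv ab) w))).
  apply: eq_bigr => w _; have := p_ge0 w; rewrite le_eqVlt => /predU1P[<-|pw].
    by rewrite !mul0r !big1 ?subr0 // => *; rewrite mul0r.
  have c0 U W : 0 < cd U W w by apply: cdens_gt0.
  have cp := cond_prod_gt0 pw.
  have f0 A : 0 < forget A p w by apply: forget_gt0.
  have r0 : 0 < regen lv w by apply: mulr_gt0.
  rewrite ln_div ?posrE // /regen lnM ?posrE // /cond_prod.
  have P0 (T : finType) (U W : T -> {set E}) : 0 < \prod_t cd (U t) (W t) w by apply: prodr_gt0.
  rewrite !lnM ?posrE ?mulr_gt0 // !ln_prod //.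
  by rewrite -!big_distrr /=; ring.
rewrite !sumrB.
rewrite (exchange_big _ _ _ _ _ (fun w (a : Tt) => p w * ln (cd (blockK lv a) (condK lv a) w))).
rewrite (exchange_big _ _ _ _ _ (fun w (a : Tt) => p w * ln (cd (blockTh lv a) (condTh lv a) w))).
rewrite (exchange_big _ _ _ _ _ (fun w (a : Tt * Tt) => p w * ln (cd (blockZ a) (condZ lv a) w))).
rewrite /= sum_ln_cdens // /entL /entK /entTh /entZ.
under [X in _ - X - _ - _ = _]eq_bigr do rewrite sum_ln_cdens //.
under [X in _ - X - _ = _]eq_bigr do rewrite sum_ln_cdens //.
under [X in _ - X = _]eq_bigr do rewrite sum_ln_cdens //.
rewrite !sumrN /entropy; ring.
Qed.

End Regenerated.

(** * Choice of a good triple of levels *)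

Section Pigeonhole.
Variable R : realType.

Lemma telescope_le (f : nat -> R) n (B : R) : f 0%N <= 0 -> - B <= f n ->
  \sum_(l < n) (f l - f l.+1) <= B.
Proof.
move=> f0 fn; rewrite -(big_mkord xpredT (fun l => f l - f l.+1)).
rewrite (eq_bigr (fun l => - (f l.+1 - f l))); last by move=> *; rewrite opprB.
by rewrite sumrN telescope_sumr // opprB; lra.
Qed.

(** Averaging over the whole box of triples lets each difference telescope along its own axis with
    the other two coordinates fixed. *)
Lemma pigeonhole3 (f1 f2 f3 : nat -> nat -> nat -> R) (n1 n2 n3 : nat) (B1 B2 B3 : R) :
  (0 < n1)%N -> (0 < n2)%N -> (0 < n3)%N ->
  (forall l1 l2 l3, (l1 <= n1)%N -> (l2 <= n2)%N -> (l3 <= n3)%N ->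
    [/\ - B1 <= f1 l1 l2 l3 <= 0, - B2 <= f2 l1 l2 l3 <= 0
      & - B3 <= f3 l1 l2 l3 <= 0]) ->
  exists l1 l2 l3, [/\ (l1 < n1)%N, (l2 < n2)%N, (l3 < n3)%N &
    (f1 l1 l2 l3 - f1 l1.+1 l2 l3) + (f2 l1 l2 l3 - f2 l1 l2.+1 l3)
    + (f3 l1 l2 l3 - f3 l1 l2 l3.+1) <= B1 / n1%:R + B2 / n2%:R + B3 / n3%:R].
Proof.
move=> n10 n20 n30 fB.
pose T := ('I_n1 * 'I_n2 * 'I_n3)%type.
pose w : T -> R := fun=> (n1 * n2 * n3)%:R^-1.
have w0 : (n1 * n2 * n3)%:R != 0 :> R by rewrite pnatr_eq0 -lt0n !muln_gt0 n10 n20.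
have wd : pdist w.
  split=> [x|]; first by rewrite invr_ge0.
  by rewrite sumr_const !card_prod !card_ord -[_ *+ _]mulr_natl mulfV.
pose F (x : T) := (f1 x.1.1 x.1.2 x.2 - f1 x.1.1.+1 x.1.2 x.2)
    + (f2 x.1.1 x.1.2 x.2 - f2 x.1.1 x.1.2.+1 x.2)
    + (f3 x.1.1 x.1.2 x.2 - f3 x.1.1 x.1.2 x.2.+1).
have [] := @weighted_sum_exists_le _ _ w F (B1 / n1%:R + B2 / n2%:R + B3 / n3%:R) wd.
  rewrite -big_distrr /= big_split /= big_split /= -/T.
  have S1 : \sum_(x : T) (f1 x.1.1 x.1.2 x.2 - f1 x.1.1.+1 x.1.2 x.2) <= B1 * (n2 * n3)%:R.
    rewrite -(pair_big xpredT xpredT (fun (y : 'I_n1 * 'I_n2) (k : 'I_n3) =>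
       f1 y.1 y.2 k - f1 y.1.+1 y.2 k)) /=.
    rewrite -(pair_big xpredT xpredT (fun (i : 'I_n1) (j : 'I_n2) =>
       \sum_(k < n3) (f1 i j k - f1 i.+1 j k))) /= exchange_big /=.
    apply: (@le_trans _ _ (\sum_(j < n2) \sum_(k < n3) B1)).
      apply: ler_sum => j _; rewrite exchange_big /=; apply: ler_sum => k _.
      apply: (@telescope_le (fun i => f1 i j k)).
        by have [/andP[_]] := fB 0 j k (leq0n _) (ltnW (ltn_ord j)) (ltnW (ltn_ord k)).
      by have [/andP[]] := fB n1 j k (leqnn _) (ltnW (ltn_ord j)) (ltnW (ltn_ord k)).
    by rewrite !sumr_const !card_ord -mulrnA mulnC mulr_natr.
  have S2 : \sum_(x : T) (f2 x.1.1 x.1.2 x.2 - f2 x.1.1 x.1.2.+1 x.2) <= B2 * (n1 * n3)%:R.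
    rewrite -(pair_big xpredT xpredT (fun (y : 'I_n1 * 'I_n2) (k : 'I_n3) =>
       f2 y.1 y.2 k - f2 y.1 y.2.+1 k)) /=.
    rewrite -(pair_big xpredT xpredT (fun (i : 'I_n1) (j : 'I_n2) =>
       \sum_(k < n3) (f2 i j k - f2 i j.+1 k))) /=.
    apply: (@le_trans _ _ (\sum_(j < n1) \sum_(k < n3) B2)).
      apply: ler_sum => i _; rewrite exchange_big /=; apply: ler_sum => k _.
      apply: (@telescope_le (fun j => f2 i j k)).
        by have [_ /andP[_]] := fB i 0 k (ltnW (ltn_ord i)) (leq0n _) (ltnW (ltn_ord k)).
      by have [_ /andP[]] := fB i n2 k (ltnW (ltn_ord i)) (leqnn _) (ltnW (ltn_ord k)).
    by rewrite !sumr_const !card_ord -mulrnA mulnC mulr_natr.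
  have S3 : \sum_(x : T) (f3 x.1.1 x.1.2 x.2 - f3 x.1.1 x.1.2 x.2.+1) <= B3 * (n1 * n2)%:R.
    rewrite -(pair_big xpredT xpredT (fun (y : 'I_n1 * 'I_n2) (k : 'I_n3) =>
       f3 y.1 y.2 k - f3 y.1 y.2 k.+1)) /=.
    apply: (@le_trans _ _ (\sum_(y : 'I_n1 * 'I_n2) B3)); last first.
      by rewrite sumr_const card_prod !card_ord mulr_natr.
    apply: ler_sum => -[i j] _ /=; apply: (@telescope_le (fun k => f3 i j k)).
      by have [_ _ /andP[_]] := fB i j 0 (ltnW (ltn_ord i)) (ltnW (ltn_ord j)) (leq0n _).
    by have [_ _ /andP[]] := fB i j n3 (ltnW (ltn_ord i)) (ltnW (ltn_ord j)) (leqnn _).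
  have n1R : n1%:R != 0 :> R by rewrite pnatr_eq0 -lt0n.
  have n2R : n2%:R != 0 :> R by rewrite pnatr_eq0 -lt0n.
  have n3R : n3%:R != 0 :> R by rewrite pnatr_eq0 -lt0n.
  have -> : B1 / n1%:R + B2 / n2%:R + B3 / n3%:R = (n1 * n2 * n3)%:R^-1 *
     (B1 * (n2 * n3)%:R + B2 * (n1 * n3)%:R + B3 * (n1 * n2)%:R).
    by rewrite !natrM; field; rewrite ?n1R ?n2R ?n3R.
  rewrite ler_wpM2l ?invr_ge0 //; apply: lerD => //; exact: lerD.
move=> [[i j] k]; rewrite /F /= => h.
by exists i, j, k; split.
Qed.

End Pigeonhole.

(** With n1, n2 the first two values, the three values are 3 D times the entropy bounds t^2 for Z, 2
    n1 t^2 for K and Th together, and 2 n1 (n1 + n2) t^2 for L. Each level thus contributes 1 / (3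
    D) to the divergence. *)
Definition level_bound1 (t D : nat) : nat := 3 * t ^ 2 * D.
Definition level_bound2 (t D : nat) : nat := 6 * level_bound1 t D * t ^ 2 * D.
Definition level_bound (t D : nat) : nat :=
  6 * level_bound1 t D * (level_bound1 t D + level_bound2 t D) * t ^ 2 * D.

Section RegularLevel.
Variables (R : realType) (Tt : finType) (D : nat).
Hypotheses (t_gt0 : (0 < #|Tt|)%N) (D_gt0 : (0 < D)%N).
Let t := #|Tt|.
Let n1 := level_bound1 t D.
Let n2 := level_bound2 t D.
Let N := level_bound t D.
Local Notation V := {ffun entry Tt N -> bool}.
Variable p : V -> R.
Hypotheses (p_dist : pdist p) (p_exch : exchangeable p).

Definition mk_level (l1 l2 l3 : nat) : 'I_3 -> nat :=
  fun k => match val k with 0%N => l1 | 1%N => l2 | _ => l3 end.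

Let o0 : 'I_3 := @Ordinal 3 0 isT.
Let o1 : 'I_3 := @Ordinal 3 1 isT.
Let o2 : 'I_3 := @Ordinal 3 2 isT.

Let incr0 l1 l2 l3 : incr (mk_level l1 l2 l3) o0 = mk_level l1.+1 l2 l3.
Proof. by apply: funext => -[[|[|[|]]] i]. Qed.
Let incr1 l1 l2 l3 : incr (mk_level l1 l2 l3) o1 = mk_level l1 l2.+1 l3.
Proof. by apply: funext => -[[|[|[|]]] i]. Qed.
Let incr2 l1 l2 l3 : incr (mk_level l1 l2 l3) o2 = mk_level l1 l2 l3.+1.
Proof. by apply: funext => -[[|[|[|]]] i]. Qed.

Let n1_gt0 : (0 < n1)%N. Proof. by rewrite !muln_gt0 ?expn_gt0 ?t_gt0 ?D_gt0. Qed.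
Let n2_gt0 : (0 < n2)%N. Proof. by rewrite !muln_gt0 ?n1_gt0 ?expn_gt0 ?t_gt0 ?D_gt0. Qed.
Let n12_le : (n1 + n2 <= N)%N.
Proof.
rewrite /N /level_bound -/n1 -/n2.
have -> : (6 * n1 * (n1 + n2) * t ^ 2 * D = (6 * n1 * t ^ 2 * D) * (n1 + n2))%N by nia.
by rewrite leq_pmull // !muln_gt0 ?n1_gt0 ?expn_gt0 ?t_gt0 ?D_gt0.
Qed.

Lemma sum_cond_entropy_bounds (T : finType) (U W : T -> {set entry Tt N}) (B : nat) :
  (forall x, #|U x| <= B)%N ->
  - (#|T| * B)%:R <= \sum_x cond_entropy p (U x) (W x) <= 0.
Proof.
move=> UB; apply/andP; split; last by apply: sumr_le0 => x _; apply: cond_entropy_le0.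
apply: (@le_trans _ _ (\sum_(x : T) - (B%:R : R))).
  by rewrite sumr_const mulNrn natrM mulr_natl.
apply: ler_sum => x _; apply: le_trans (cond_entropy_ge p_dist _ _).
by rewrite lerN2 ler_nat.
Qed.

Lemma regular_level : exists lv : 'I_3 -> nat, (forall k, lv k < N)%N /\
  \sum_w forget (layer4 lv) p w * ln (forget (layer4 lv) p w / regen p lv w) <= D%:R^-1.
Proof.
pose f1 l1 l2 l3 := entZ p (mk_level l1 l2 l3).
pose f2 l1 l2 l3 := entK p (mk_level l1 l2 l3) + entTh p (mk_level l1 l2 l3).
pose f3 l1 l2 l3 := entL p (mk_level l1 l2 l3).
pose B1 : R := (t ^ 2)%:R.
pose B2 : R := (2 * n1 * t ^ 2)%:R.
pose B3 : R := (2 * n1 * (n1 + n2) * t ^ 2)%:R.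
have N_gt0 : (0 < N)%N by apply: leq_trans n12_le; rewrite addn_gt0 n1_gt0.
have [|l1 [l2 [l3 [h1 h2 h3 hB]]]] :=
   @pigeonhole3 R f1 f2 f3 n1 n2 N B1 B2 B3 n1_gt0 n2_gt0 N_gt0.
  move=> l1 l2 l3 h1 h2 h3.
  set lv := mk_level l1 l2 l3.
  have lvN k : (lv k <= N)%N.
    case: k => -[|[|[|]]] // i; rewrite /lv /mk_level /=; lia.
  have c0 : (#|[set i : idx Tt N | pinned 0 lv i]| <= n1 * t)%N.
    apply: (leq_trans (@card_pinned Tt N 0 lv isT lvN)).
    by rewrite big_mkcond !big_ord_recl big_ord0 /= leq_mul2r; apply/orP; right; rewrite /lv /mk_level /=; lia.
  have c1 : (#|[set i : idx Tt N | pinned 1 lv i]| <= (n1 + n2) * t)%N.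
    apply: (leq_trans (@card_pinned Tt N 1 lv isT lvN)).
    by rewrite big_mkcond !big_ord_recl big_ord0 /= leq_mul2r; apply/orP; right; rewrite /lv /mk_level /=; lia.
  have cK a : (#|@blockK Tt N lv a| <= n1 * t)%N.
    apply: leq_trans c0.
    apply: (@leq_trans #|[set (inl a : idx Tt N, i, true) | i in [set i : idx Tt N | pinned 0 lv i]]|).
      apply: subset_leq_card; apply/subsetP => -[[i j] b]; rewrite inE /= => /and3P[]; case: b => // _ /eqP -> h.
      by apply/imsetP; exists j; rewrite ?inE.
    exact: leq_imset_card.
  have cTh a : (#|@blockTh Tt N lv a| <= n1 * t)%N.
    apply: leq_trans c0.
    apply: (@leq_trans #|[set (i, inl a : idx Tt N, true) | i in [set i : idx Tt N | pinned 0 lv i]]|).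
      apply: subset_leq_card; apply/subsetP => -[[i j] b]; rewrite inE /= => /and3P[]; case: b => // _ h /eqP ->.
      by apply/imsetP; exists i; rewrite ?inE.
    exact: leq_imset_card.
  have cL : (#|@blockL Tt N lv| <= 2 * n1 * (n1 + n2) * t ^ 2)%N.
    set P0 := [set i : idx Tt N | pinned 0 lv i] in c0.
    set P1 := [set i : idx Tt N | pinned 1 lv i] in c1.
    apply: (@leq_trans #|[set (x, true) | x in finset.setX P1 P0] :|: [set (x, true) | x in finset.setX P0 P1]|).
      apply: subset_leq_card; apply/subsetP => -[[i j] b]; rewrite !inE /inL /=.
      by case/andP; case: b => // _ /orP[] /andP[hi hj]; apply/orP; [left|right];
        apply/imsetP; exists (i, j); rewrite ?inE /= ?hi ?hj.
    apply: (leq_trans (leq_card_setU _ _)).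
    apply: (leq_trans (leq_add (leq_imset_card _ _) (leq_imset_card _ _))).
    rewrite !cardsX; have := leq_mul c1 c0; nia.
  have iZ : - B1 <= f1 l1 l2 l3 <= 0.
    have := @sum_cond_entropy_bounds (Tt * Tt)%type (fun ab => blockZ ab) (condZ lv) 1 _.
    by rewrite card_prod muln1 mulnn; apply=> x; rewrite cards1.
  have iK := sum_cond_entropy_bounds (condK lv) cK.
  have iTh := sum_cond_entropy_bounds (condTh lv) cTh.
  have iL : - B3 <= f3 l1 l2 l3 <= 0.
    apply/andP; split; last exact: cond_entropy_le0.
    by apply: le_trans (cond_entropy_ge p_dist _ _); rewrite lerN2 ler_nat.
  have iKT : - B2 <= f2 l1 l2 l3 <= 0.
    have e : B2 = (t * (n1 * t))%:R + (t * (n1 * t))%:R by rewrite -natrD /B2; congr (_%:R); nia.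
    rewrite e /f2 -/lv /entK /entTh; move/andP: iK => [k1 k2]; move/andP: iTh => [u1 u2].
    by rewrite opprD; apply/andP; split; [exact: lerD | by rewrite -[leRHS]addr0; exact: lerD].
  by split.
exists (mk_level l1 l2 l3).
have lvN k : (mk_level l1 l2 l3 k < N)%N.
  by case: k => -[|[|[|]]] // i; rewrite /mk_level /=; lia.
split=> //; rewrite regen_kl //.
have d1 := entZ_drop p_dist p_exch lvN.
have d2 := entK_drop p_dist p_exch lvN.
have d2' := entTh_drop p_dist p_exch lvN.
have d3 := entL_drop p_dist p_exch lvN.
rewrite incr0 in d1; rewrite incr1 in d2; rewrite incr1 in d2'; rewrite incr2 in d3.
(* Added up, the right sides of the four drops telescope to [H (layer4 lv) - H (blockX lv)], so the
   divergence is at most the sum of differences in [hB]. *)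
apply: (@le_trans _ _ (B1 / n1%:R + B2 / n2%:R + B3 / N%:R)).
  apply: le_trans hB; rewrite /f1 /f2 /f3; lra.
have DR : D%:R != 0 :> R by rewrite pnatr_eq0 -lt0n.
have ratio (c x : nat) : (0 < c)%N -> (0 < x)%N ->
    (c * x)%:R / (3 * c * x * D)%:R = (3 * D%:R)^-1 :> R.
  rewrite -(ltr0n R) -(ltr0n R x) => c0 x0.
  by rewrite !natrM; field; rewrite DR !gt_eqF.
have t20 : (0 < t ^ 2)%N by rewrite expn_gt0 t_gt0.
have -> : B1 / n1%:R = (3 * D%:R)^-1.
  by rewrite -(ratio 1%N (t ^ 2)%N) // mul1n muln1.
have -> : B2 / n2%:R = (3 * D%:R)^-1.
  rewrite -(ratio 2%N (n1 * t ^ 2)%N) //; last by rewrite muln_gt0 t20 andbT.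
  by rewrite /B2 /n2 /level_bound2 -/n1 !mulnA.
have -> : B3 / N%:R = (3 * D%:R)^-1.
  rewrite -(ratio 2%N (n1 * (n1 + n2) * t ^ 2)%N) //; last first.
    by rewrite muln_gt0 t20 andbT muln_gt0 addn_gt0 n1_gt0.
  by rewrite /B3 /N /level_bound -/n1 -/n2 !mulnA.
by rewrite le_eqVlt; apply/orP; left; apply/eqP; field.
Qed.

End RegularLevel.

Lemma regularity (R : realType) (Tt : finType) (m : nat)
    (p : {ffun entry Tt (level_bound #|Tt| (m ^ 2)) -> bool} -> R) :
  (0 < #|Tt|)%N -> (0 < m)%N -> pdist p -> exchangeable p ->
  exists lv : 'I_3 -> nat,
    \sum_w `|forget (layer4 lv) p w - regen p lv w| <= 2 / m%:R.
Proof.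
move=> t0 m0 pd pe.
have D0 : (0 < m ^ 2)%N by rewrite expn_gt0 m0.
have [lv [_ h]] := regular_level t0 D0 pd pe.
exists lv.
have m0R : 0 < m%:R :> R by rewrite ltr0n.
(* For divergence at most 1 / m^2 the parameter 2 m makes both terms of [l1_le_kl] equal to 1 /
   m. *)
have s0 : 0 < 2 * m%:R :> R by rewrite mulr_gt0.
have p0 w : 0 <= p w by have [] := pd.
apply: (le_trans (l1_le_kl _ (regen_dist pd lv) _ s0)) => [|w|].
- by split=> [w|]; rewrite ?forget_ge0 // sum_forget; have [] := pd.
(* Absolute continuity: [w] agrees on [layer4] with a point [v] of positive mass, and both factors
   of [regen] depend on [layer4] only. *)
- move=> fw; have [v pv kv] : exists2 v, 0 < p v & 0 < forget_kernel R (layer4 lv) w v.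
    apply: contrapT => nv; move: fw; rewrite /forget big1 ?ltxx // => v _.
    apply/eqP; rewrite mulf_eq0; apply/negPn/negP; rewrite negb_or => /andP[k1 k2].
    by apply: nv; exists v; rewrite lt_neqAle eq_sym ?k1 ?k2 ?kernel_ge0 ?p0.
  have agree : {in layer4 lv, w =1 v}.
    move=> e el; apply/eqP; apply: contraTT kv => ne; rewrite -leNgt.
    by rewrite /forget_kernel (bigD1 e) //= /kloc el (negbTE ne) mul0r.
  rewrite /regen (cond_prod_depends_on p agree).
  rewrite (forget_depends_on _ (_ : {in blockX lv, w =1 v})).
    by rewrite mulr_gt0 ?forget_gt0 ?cond_prod_gt0.
  move=> e eX; apply: agree; apply: (subsetP _ _ eX).
  by rewrite /layer4 /layer3 /layer2 /layer1 -!setUA subsetUl.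
have hh : 2 * m%:R / 2 * (\sum_w forget (layer4 lv) p w *
    ln (forget (layer4 lv) p w / regen p lv w)) <= 2 * m%:R / 2 * (m ^ 2)%:R^-1.
  by rewrite ler_wpM2l // divr_ge0 // ltW.
apply: (le_trans (lerD hh (lexx _))).
by rewrite natrX le_eqVlt; apply/orP; left; apply/eqP; field; rewrite gt_eqF.
Qed.

(** * Transplanting a coupling *)

Section Transplant.
Variables (R : realType) (Om Ka Ga Th Tt : finType).
Variables (w : Om -> R) (u : Ga -> R) (x : Om -> Ga -> bool).
Variables (KK : Om -> Ka -> R) (KT : Ga -> Th -> R)
  (KZ : Om -> Ka -> Ga -> Th -> bool -> R).
Hypotheses (w_dist : pdist w) (u_dist : pdist u)
  (KK_dist : forall o, pdist (KK o)) (KT_dist : forall j, pdist (KT j))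
  (KZ_dist : forall o k j t, pdist (KZ o k j t)).
Variables (g : {ffun Tt * Tt -> bool} -> {ffun Tt * Tt -> bool} -> R) (B : R).
Hypothesis gB : forall v y, `|g v y| <= B.

Definition xtests (Om' : Type) (x' : Om' -> Ga -> bool) (r : {ffun Tt -> Om'})
    (j : {ffun Tt -> Ga}) : {ffun Tt * Tt -> bool} :=
  [ffun ab => x' (r ab.1) (j ab.2)].

Definition test_value (J : Om * {ffun Ga -> bool} -> R) : R :=
  \sum_(j : {ffun Tt -> Ga}) (\prod_b u (j b)) *
    \sum_(r : {ffun Tt -> Om * {ffun Ga -> bool}}) (\prod_a J (r a)) *
      g (xtests (fun o : Om * {ffun Ga -> bool} => x o.1) r j)
        (xtests (fun (o : Om * {ffun Ga -> bool}) c => o.2 c) r j).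

(** The idealised test: each test column has its own hidden variable and each test cell its own bit,
    even when two of the sampled columns coincide. Genuine rows share these data on equal
    columns. *)
Definition regen_value_at (j : {ffun Tt -> Ga}) : R :=
  \sum_(r : {ffun Tt -> Om}) (\prod_a w (r a)) *
  \sum_(k : {ffun Tt -> Ka}) (\prod_a KK (r a) (k a)) *
  \sum_(t : {ffun Tt -> Th}) (\prod_b KT (j b) (t b)) *
  \sum_(y : {ffun Tt * Tt -> bool})
    (\prod_ab KZ (r ab.1) (k ab.1) (j ab.2) (t ab.2) (y ab)) * g (xtests x r j) y.

Definition regen_value : R :=
  \sum_(j : {ffun Tt -> Ga}) (\prod_b u (j b)) * regen_value_at j.

(** The hidden column variables [t] are a parameter because all rows share them; the row variable is
    summed out because rows are drawn independently. *)
Definition regen_row (t : {ffun Ga -> Th}) (xy : Om * {ffun Ga -> bool}) : R :=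
  w xy.1 * \sum_k KK xy.1 k * \prod_c KZ xy.1 k c (t c) (xy.2 c).

Lemma regen_row_marginal t o : \sum_y regen_row t (o, y) = w o.
Proof.
rewrite /regen_row /= -big_distrr /= exchange_big /= -[RHS]mulr1; congr (_ * _).
have [_ K1] := KK_dist o; rewrite -[RHS]K1; apply: eq_bigr => k _; rewrite -big_distrr /=.
rewrite (@sum_prod1 R Ga _ (fun c b => KZ o k c (t c) b)) ?mulr1 // => c.
by have [] := KZ_dist o k c (t c).
Qed.

Lemma regen_row_dist t : pdist (regen_row t).
Proof.
split=> [[o y]|].
  apply: mulr_ge0; first by have [] := w_dist.
  apply: sumr_ge0 => k _; apply: mulr_ge0; first by have [] := KK_dist o.
  by apply: prodr_ge0 => c _; have [] := KZ_dist o k c (t c).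
rewrite -(pair_big xpredT xpredT (fun o y => regen_row t (o, y))) /=.
by under eq_bigr do rewrite regen_row_marginal; have [] := w_dist.
Qed.

Lemma weighted_abs_le (T : finType) (v F : T -> R) (b : R) :
  pdist v -> (forall z, `|F z| <= b) -> `|\sum_z v z * F z| <= b.
Proof.
move=> vd Fb; apply: (le_trans (ler_norm_sum _ _ _)).
apply: (le_trans _ (weighted_sum_le vd Fb)); apply: ler_sum => z _.
by rewrite normrM ger0_norm //; have [] := vd.
Qed.

Lemma pdist_prodI (T S : finType) (v : T -> S -> R) : (forall i, pdist (v i)) ->
  pdist (fun f : {ffun T -> S} => \prod_i v i (f i)).
Proof.
move=> vd; split; first by move=> f; apply: prodr_ge0 => i _; have [] := vd i.
by apply: sum_prod1 => i; have [] := vd i.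
Qed.

Lemma sum_rows_split (F : {ffun Tt -> Om} -> {ffun Tt * Ga -> bool} -> R) :
  \sum_(r : {ffun Tt -> Om * {ffun Ga -> bool}})
     F [ffun a => (r a).1] [ffun ac => (r ac.1).2 ac.2] =
  \sum_r \sum_y F r y.
Proof.
rewrite pair_big /=.
rewrite (reindex (fun r : {ffun Tt -> Om * {ffun Ga -> bool}} =>
   ([ffun a => (r a).1] : {ffun Tt -> Om}, [ffun ac : Tt * Ga => (r ac.1).2 ac.2]))) //=.
exists (fun p : {ffun Tt -> Om} * {ffun Tt * Ga -> bool} =>
   [ffun a => (p.1 a, [ffun c => p.2 (a, c)])]).
  move=> r _; apply/ffunP => a; rewrite !ffunE /=.
  rewrite [RHS](surjective_pairing (r a)); congr pair.
  by apply/ffunP => c; rewrite !ffunE.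
move=> [r y] _ /=; congr pair; first by apply/ffunP => a; rewrite !ffunE.
by apply/ffunP => -[a c]; rewrite !ffunE /= ?ffunE.
Qed.

(** For distinct columns the cells [(a, j b)] are distinct, so they are independent given the hidden
    variables and all unread cells integrate out. *)
Lemma rows_value (t : {ffun Ga -> Th}) (j : {ffun Tt -> Ga}) : injective j ->
  \sum_(r : {ffun Tt -> Om * {ffun Ga -> bool}}) (\prod_a regen_row t (r a)) *
      g (xtests (fun o : Om * {ffun Ga -> bool} => x o.1) r j)
        (xtests (fun (o : Om * {ffun Ga -> bool}) c => o.2 c) r j) =
  \sum_(r : {ffun Tt -> Om}) (\prod_a w (r a)) *
  \sum_(k : {ffun Tt -> Ka}) (\prod_a KK (r a) (k a)) *
  \sum_(y : {ffun Tt * Tt -> bool})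
    (\prod_ab KZ (r ab.1) (k ab.1) (j ab.2) (t (j ab.2)) (y ab)) * g (xtests x r j) y.
Proof.
move=> jI.
pose F (r : {ffun Tt -> Om}) (y : {ffun Tt * Ga -> bool}) : R :=
  (\prod_a w (r a)) * (\sum_(k : {ffun Tt -> Ka}) (\prod_a KK (r a) (k a)) *
    (\prod_ac KZ (r ac.1) (k ac.1) ac.2 (t ac.2) (y ac))) *
    g (xtests x r j) [ffun ab => y (ab.1, j ab.2)].
transitivity (\sum_r \sum_y F r y).
  rewrite -sum_rows_split; apply: eq_bigr => r _; rewrite /F; congr (_ * _); last first.
    by congr (g _ _); apply/ffunP => ab; rewrite !ffunE /= ?ffunE.
  rewrite big_split /=; congr (_ * _); first by apply: eq_bigr => a _; rewrite ffunE.
  rewrite bigA_distr_bigA; apply: eq_bigr => k _.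
  rewrite big_split /=; congr (_ * _); first by apply: eq_bigr => a _; rewrite ffunE.
  rewrite pair_big /=; apply: eq_bigr => -[a c] _ /=.
  by rewrite !ffunE.
apply: eq_bigr => r _; rewrite /F.
under [LHS]eq_bigr => y _ do rewrite -mulrA.
rewrite -big_distrr /=; congr (_ * _).
under [LHS]eq_bigr => y _ do rewrite big_distrl /=.
rewrite exchange_big /=; apply: eq_bigr => k _.
under [LHS]eq_bigr => y _ do rewrite -mulrA.
rewrite -big_distrr /=; congr (_ * _).
pose c (ab : Tt * Tt) := (ab.1, j ab.2).
rewrite (@sum_prod_inj R _ _ _ c (fun ac b => KZ (r ac.1) (k ac.1) ac.2 (t ac.2) b)
  (fun y => g (xtests x r j) y)) //.
  by move=> [a b] [a' b'] [-> /jI ->].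
by move=> [a b] /=; have [] := KZ_dist (r a) (k a) b (t b).
Qed.

Lemma cols_value (j : {ffun Tt -> Ga}) : injective j ->
  \sum_(t : {ffun Ga -> Th}) (\prod_c KT c (t c)) *
   (\sum_(r : {ffun Tt -> Om * {ffun Ga -> bool}}) (\prod_a regen_row t (r a)) *
      g (xtests (fun o : Om * {ffun Ga -> bool} => x o.1) r j)
        (xtests (fun (o : Om * {ffun Ga -> bool}) c => o.2 c) r j)) = regen_value_at j.
Proof.
move=> jI; under eq_bigr do rewrite rows_value //.
pose G (t : {ffun Tt -> Th}) : R := \sum_(r : {ffun Tt -> Om}) (\prod_a w (r a)) *
  \sum_(k : {ffun Tt -> Ka}) (\prod_a KK (r a) (k a)) *
  \sum_(y : {ffun Tt * Tt -> bool})
    (\prod_ab KZ (r ab.1) (k ab.1) (j ab.2) (t ab.2) (y ab)) * g (xtests x r j) y.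
transitivity (\sum_(t : {ffun Ga -> Th}) (\prod_c KT c (t c)) * G [ffun b => t (j b)]).
  apply: eq_bigr => t _; congr (_ * _); apply: eq_bigr => r _; congr (_ * _).
  apply: eq_bigr => k _; congr (_ * _); apply: eq_bigr => y _; congr (_ * _).
  by apply: eq_bigr => ab _; rewrite ffunE.
rewrite (@sum_prod_inj R _ _ _ j KT G) //; last by move=> c; have [] := KT_dist c.
rewrite /G /regen_value_at; under eq_bigr do rewrite big_distrr /=.
rewrite exchange_big /=; apply: eq_bigr => r _.
under eq_bigr do rewrite mulrCA; rewrite -big_distrr /=; congr (_ * _).
under eq_bigr do rewrite big_distrr /=.
rewrite exchange_big /=; apply: eq_bigr => k _.
by under eq_bigr do rewrite mulrCA; rewrite -big_distrr /=.
Qed.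

(** The two values agree exactly on injective column tuples; on the other tuples each is bounded by
    [B]. *)
Lemma transplant_value :
  `|\sum_(t : {ffun Ga -> Th}) (\prod_c KT c (t c)) * test_value (regen_row t) - regen_value|
  <= 2 * B * \sum_(j : {ffun Tt -> Ga}) (\prod_b u (j b)) * (~~ injectiveb j)%:R.
Proof.
rewrite /test_value /regen_value; under eq_bigr do rewrite big_distrr /=.
rewrite exchange_big /= -sumrB big_distrr /=.
apply: (le_trans (ler_norm_sum _ _ _)); apply: ler_sum => j _.
under eq_bigr do rewrite mulrCA; rewrite -big_distrr /= -mulrBr.
have [U0 U1] : pdist (fun j : {ffun Tt -> Ga} => \prod_b u (j b)) by apply: pdist_prod.
rewrite normrM ger0_norm // [leRHS]mulrCA ler_wpM2l //.
case: (boolP (injectiveb j)) => [/injectiveP jI|_] /=.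
  by rewrite cols_value // subrr normr0 mulr0.
rewrite mulr1 mulr_natl mulr2n; apply: (le_trans (ler_normB _ _)); apply: lerD.
  apply: (@weighted_abs_le _ _ _ _ (pdist_prodI KT_dist)) => t.
  exact: (@weighted_abs_le _ _ _ _ (pdist_prod _ (regen_row_dist t))).
apply: (@weighted_abs_le _ _ _ _ (pdist_prod _ w_dist)) => r.
apply: (@weighted_abs_le _ _ _ _ (pdist_prodI (fun a => KK_dist (r a)))) => k.
apply: (@weighted_abs_le _ _ _ _ (pdist_prodI (fun b => KT_dist (j b)))) => t.
exact: (@weighted_abs_le _ _ _ _
  (pdist_prodI (fun ab : Tt * Tt => KZ_dist (r ab.1) (k ab.1) (j ab.2) (t ab.2)))).
Qed.

End Transplant.

(** * Laws of sampled arrays *)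

Section Arrays.
Variables (R : realType) (I Om Ga : finType) (w : Om -> R) (u : Ga -> R).
Hypotheses (w_dist : pdist w) (u_dist : pdist u).

Definition xarray (x : Om -> Ga -> bool) (r : {ffun I -> Om}) (c : {ffun I -> Ga}) :
  {ffun I * I -> bool} := [ffun ij => x (r ij.1) (c ij.2)].

Definition array_law (T : finType) (F : {ffun I -> Om} -> {ffun I -> Ga} -> T) (a : T) : R :=
  \sum_(r : {ffun I -> Om}) (\prod_i w (r i)) *
  \sum_(c : {ffun I -> Ga}) (\prod_i u (c i)) * (F r c == a)%:R.

Lemma sum_array_law (T : finType) (F : {ffun I -> Om} -> {ffun I -> Ga} -> T) (G : T -> R) :
  \sum_a array_law F a * G a =
  \sum_(r : {ffun I -> Om}) (\prod_i w (r i)) *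
  \sum_(c : {ffun I -> Ga}) (\prod_i u (c i)) * G (F r c).
Proof.
rewrite /array_law; under [LHS]eq_bigr => a _ do rewrite big_distrl /=.
rewrite exchange_big /=; apply: eq_bigr => r _.
under [LHS]eq_bigr => a _ do rewrite -mulrA big_distrl /=.
rewrite -big_distrr /=; congr (_ * _); rewrite exchange_big /=; apply: eq_bigr => c _.
under [LHS]eq_bigr => a _ do rewrite -mulrA.
by rewrite -big_distrr /= sum_indic.
Qed.

Lemma array_law_dist (T : finType) (F : {ffun I -> Om} -> {ffun I -> Ga} -> T) :
  pdist (array_law F).
Proof.
have [W0 W1] := pdist_prod I w_dist; have [U0 U1] := pdist_prod I u_dist.
split=> [a|].
  apply: sumr_ge0 => r _; rewrite mulr_ge0 //; apply: sumr_ge0 => c _.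
  by rewrite mulr_ge0 // ler0n.
transitivity (\sum_a array_law F a * 1); first by apply: eq_bigr => a _; rewrite mulr1.
rewrite (sum_array_law F (fun=> 1)) -[RHS]W1; apply: eq_bigr => r _; rewrite -[RHS]mulr1.
by congr (_ * _); rewrite -[RHS]U1; apply: eq_bigr => c _; rewrite mulr1.
Qed.

Definition xlaw (x : Om -> Ga -> bool) : {ffun I * I -> bool} -> R := array_law (xarray x).

End Arrays.

Section PairArrays.
Variables (R : realType) (Tt : finType) (N : nat).
Local Notation I := (idx Tt N).
Local Notation E := (entry Tt N).
Local Notation P := (pin_index Tt N).
Local Notation V := {ffun E -> bool}.

Definition mk_array (a z : {ffun I * I -> bool}) : V :=
  [ffun e => if e.2 then z e.1 else a e.1].
Definition xpart (v : V) : {ffun I * I -> bool} := [ffun ij => v (ij, false)].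

Lemma xpart_mk a z : xpart (mk_array a z) = a.
Proof. by apply/ffunP => ij; rewrite !ffunE. Qed.
Section Law.
Variables (Om Ga : finType) (w : Om -> R) (u : Ga -> R) (x z : Om -> Ga -> bool).
Hypotheses (w_dist : pdist w) (u_dist : pdist u).

Definition pair_law : V -> R :=
  array_law w u (fun r c => mk_array (xarray x r c) (xarray z r c)).

Lemma reindex_perm_ffun (T S : finType) (s : {perm T}) (F : {ffun T -> S} -> R) :
  \sum_f F f = \sum_(f : {ffun T -> S}) F [ffun i => f (s i)].
Proof.
apply: reindex_inj => f f' /ffunP h; apply/ffunP => i.
by have := h (s^-1%g i); rewrite !ffunE permKV.
Qed.

(** Rows and columns are sampled independently with identical weights, so permuting indices only
    relabels the samples. *)
Lemma pair_law_exch : exchangeable pair_law.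
Proof.
move=> s s' v; rewrite /pair_law /array_law (reindex_perm_ffun s); apply: eq_bigr => r _.
rewrite (reindex_perm_ffun s'); congr (_ * _).
  rewrite [RHS](reindex_inj (h := s)) /=; last exact: perm_inj.
  by apply: eq_bigr => i _; rewrite ffunE.
apply: eq_bigr => c _; congr (_ * _).
  rewrite [RHS](reindex_inj (h := s')) /=; last exact: perm_inj.
  by apply: eq_bigr => i _; rewrite ffunE.
congr ((nat_of_bool _)%:R); apply/eqP/eqP => [h|<-]; last first.
  by apply/ffunP => -[[i j] b]; rewrite !ffunE permE /= ?ffunE.
apply/ffunP => e; have /ffunP := h; move/(_ ((entry_perm s s')^-1%g e)).
rewrite [RHS]ffunE permKV => <-.
case: e => -[i j] b.
have -> : (entry_perm s s')^-1%g (i, j, b) = (s^-1%g i, s'^-1%g j, b).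
  by apply: (canLR (permK _)); rewrite permE /= !permKV.
by rewrite !ffunE /= ?ffunE /= !permKV.
Qed.

Lemma sum_pair_law_xpart (F : {ffun I * I -> bool} -> R) :
  \sum_v pair_law v * F (xpart v) = \sum_a xlaw w u x a * F a.
Proof.
rewrite (sum_array_law _ _ _ (fun v : V => F (xpart v))) sum_array_law.
by apply: eq_bigr => r _; congr (_ * _); apply: eq_bigr => c _; rewrite xpart_mk.
Qed.

Lemma sum_pair_law_tests (G : {ffun Tt * Tt -> bool} -> {ffun Tt * Tt -> bool} -> R) :
  \sum_v pair_law v * G [ffun ab => v (inl ab.1, inl ab.2, false)]
                        [ffun ab => v (inl ab.1, inl ab.2, true)] =
  \sum_(r : {ffun Tt -> Om}) (\prod_a w (r a)) *
  \sum_(c : {ffun Tt -> Ga}) (\prod_b u (c b)) * G (xtests x r c) (xtests z r c).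
Proof.
rewrite (sum_array_law _ _ _ (fun v : V => G [ffun ab => v (inl ab.1, inl ab.2, false)]
                        [ffun ab => v (inl ab.1, inl ab.2, true)])).
pose c0 (a : Tt) : I := inl a.
have c0I : injective c0 by move=> a b [].
pose F (r : {ffun Tt -> Om}) (c : {ffun Tt -> Ga}) := G (xtests x r c) (xtests z r c).
transitivity (\sum_(r : {ffun I -> Om}) (\prod_i w (r i)) *
   (fun r' : {ffun Tt -> Om} => \sum_(c : {ffun Tt -> Ga}) (\prod_b u (c b)) * F r' c)
     [ffun a => r (c0 a)]); last first.
  exact: (@sum_prod_weight_inj R _ _ _ c0 w (fun r' : {ffun Tt -> Om} =>
    \sum_(c : {ffun Tt -> Ga}) (\prod_b u (c b)) * F r' c) c0I w_dist).
apply: eq_bigr => r _; congr (_ * _).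
rewrite -(@sum_prod_weight_inj R _ _ _ c0 u (F [ffun a => r (c0 a)]) c0I u_dist).
apply: eq_bigr => c _; congr (_ * _).
by congr (G _ _); apply/ffunP => ab; rewrite !ffunE /= ?ffunE /= ?ffunE.
Qed.

End Law.

(** A function of [layer4] reads x-entries only in [blockX], exactly where the kernel keeps them.
    Smoothing therefore amounts to keeping x and drawing z uniformly. *)
Lemma sum_kernel_X lv (v : V) (h : V -> R) : depends_on (layer4 lv) h ->
  \sum_v' forget_kernel R (blockX lv) v v' * h v' =
  \sum_(z : {ffun I * I -> bool}) 2^-1 ^+ #|{: I * I}| * h (mk_array (xpart v) z).
Proof.
move=> hd.
pose c (ij : I * I) : E := (ij, true).
transitivity (\sum_(v' : V) (\prod_e kloc R (e \in blockX lv) (v e) (v' e)) *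
   (fun z => h (mk_array (xpart v) z)) [ffun ij => v' (c ij)]).
  apply: eq_bigr => v' _; rewrite -/(forget_kernel R (blockX lv) v v').
  have [->|ne] := eqVneq (forget_kernel R (blockX lv) v v') 0; first by rewrite !mul0r.
  congr (_ * _); apply: hd => -[[i j] b] he; rewrite ffunE /=.
  case: b he => he; first by rewrite ffunE.
  rewrite ffunE; apply/eqP; rewrite eq_sym; apply: contraNT ne => ne.
  rewrite /forget_kernel (bigD1 (i, j, false)) //= /kloc.
  suff -> : ((i, j, false) \in blockX lv) by rewrite (negbTE ne) mul0r.
  move: he; rewrite in_setU in_layer3 => /orP[|/bigcupP[ab _]]; last by rewrite inE => /eqP.
  by rewrite /inL /= !orbF.
rewrite (@sum_prod_inj R _ _ _ c (fun e b => kloc R (e \in blockX lv) (v e) b)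
  (fun z => h (mk_array (xpart v) z))); first last.
- by move=> e; apply: kloc_sum1.
- by move=> ij ij' [].
apply: eq_bigr => z _; congr (_ * _).
rewrite (eq_bigr (fun=> 2^-1)) ?prodr_const // => ij _.
by rewrite /kloc inE.
Qed.

End PairArrays.

Section WeightedSums.
Variable R : realType.

Lemma weighted_exchange (S T : finType) (A : S -> R) (B : T -> R) (H : S -> T -> R) :
  \sum_s A s * (\sum_t B t * H s t) = \sum_t B t * (\sum_s A s * H s t).
Proof.
under [LHS]eq_bigr => s _ do rewrite big_distrr /=.
rewrite exchange_big /=; apply: eq_bigr => t _; rewrite big_distrr /=.
by apply: eq_bigr => s _; rewrite mulrCA.
Qed.

Lemma sum_join_weighted (A B T : finType) (w : T -> R) (F : {ffun A + B -> T} -> R) :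
  \sum_(f : {ffun A + B -> T}) (\prod_i w (f i)) * F f =
  \sum_(h : {ffun B -> T}) (\prod_b w (h b)) *
    \sum_(g : {ffun A -> T}) (\prod_a w (g a)) * F (join g h).
Proof.
rewrite sum_join exchange_big /=; apply: eq_bigr => h _; rewrite big_distrr /=.
by apply: eq_bigr => g _; rewrite prod_join mulrCA mulrA.
Qed.

End WeightedSums.

Section AverageDensity.
Variables (R : realType) (E : finType) (p : {ffun E -> bool} -> R).
Local Notation V := {ffun E -> bool}.

Lemma cdens_perm (s : {perm E}) (U W : {set E}) (v : V) :
  (forall v : V, p [ffun e => v (s e)] = p v) ->
  cdens p U W v = cdens p (s @^-1: U) (s @^-1: W) [ffun e => v (s e)].
Proof. by move=> ps; rewrite /cdens -preimsetU (forget_perm W v ps) (forget_perm (W :|: U) v ps). Qed.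

(** [forget_cdens] with the average written over explicit bit strings; it normalises the four
    regeneration rules. The cells reached by [c] may exceed [U], since the surplus bits do not
    affect the density. *)
Lemma average_cdens (Q : finType) (c : Q -> E) (U W : {set E}) (v0 : V)
    (phi : {ffun Q -> bool} -> V) :
  injective c -> U \subset codom c -> (forall q, c q \notin W) ->
  (forall k q, c q \in U -> phi k (c q) = k q) ->
  (forall k e, e \in W -> phi k e = v0 e) ->
  \sum_(k : {ffun Q -> bool}) 2^-1 ^+ #|Q| * cdens p U W (phi k) = 1.
Proof.
move=> cI sU dW phiU phiW.
pose C := [set e in codom c].
have UC : U \subset C by apply/subsetP => e /(subsetP sU); rewrite inE.
have CW : [disjoint C & W].
  rewrite disjoints_subset; apply/subsetP => e; rewrite !inE => /codomP[q ->].
  exact: dW.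
rewrite -[RHS](forget_cdens p v0 UC CW) /forget.
transitivity (\sum_(v : V) (\prod_e kloc R (e \in ~: C) (v0 e) (v e)) *
   (fun k => cdens p U W (phi k)) [ffun q => v (c q)]).
  rewrite (@sum_prod_inj R _ _ _ c (fun e b => kloc R (e \in ~: C) (v0 e) b)
    (fun k => cdens p U W (phi k))) //; last by move=> e; apply: kloc_sum1.
  apply: eq_bigr => k _; congr (_ * _).
  rewrite (eq_bigr (fun=> 2^-1)) ?prodr_const // => q _.
  by rewrite /kloc !inE codom_f.
apply: eq_bigr => v _; rewrite -/(forget_kernel R (~: C) v0 v).
have [->|ne] := eqVneq (forget_kernel R (~: C) v0 v) 0; first by rewrite !mul0r.
congr (_ * _); apply: cdens_depends_on => e; rewrite inE => /orP[eW|eU].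
  rewrite phiW //; apply/eqP; apply: contraNT ne => ne.
  rewrite /forget_kernel (bigD1 e) //= /kloc.
  have -> : e \in ~: C by rewrite in_setC; apply/negP => eC; have := disjointFr CW eC; rewrite eW.
  by rewrite (negbTE ne) mul0r.
have /codomP[q qe] := subsetP sU _ eU.
by rewrite qe phiU -?qe // ffunE qe.
Qed.

End AverageDensity.

(** * Regeneration rules as probability kernels *)

Section Kernels.
Variables (R : realType) (Tt : finType) (N : nat).
Local Notation I := (idx Tt N).
Local Notation E := (entry Tt N).
Local Notation P := (pin_index Tt N).
Local Notation V := {ffun E -> bool}.
Local Notation bits := {ffun P -> bool}.
Variables (p : V -> R) (lv : 'I_3 -> nat).
Hypotheses (p_dist : pdist p) (p_exch : exchangeable p).
Variables (Om Ga : finType) (x : Om -> Ga -> bool).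
Variables (a0 : Tt) (x0 : Om) (j0 : Ga).

Definition mk_z (l : {ffun P * P -> bool}) (k t : {ffun Tt -> bits})
    (y : {ffun Tt * Tt -> bool}) : {ffun I * I -> bool} :=
  [ffun ij => match ij.1, ij.2 with
     | inl a, inl b => y (a, b) | inl a, inr j => k a j
     | inr i, inl b => t b i | inr i, inr j => l (i, j) end].

Lemma sum_mk_z (F : {ffun I * I -> bool} -> R) :
  \sum_z F z = \sum_l \sum_k \sum_t \sum_y F (mk_z l k t y).
Proof.
transitivity (\sum_(q : {ffun P * P -> bool} * ({ffun Tt -> bits} *
   ({ffun Tt -> bits} * {ffun Tt * Tt -> bool}))) F (mk_z q.1 q.2.1 q.2.2.1 q.2.2.2)).
  rewrite (reindex (fun q : {ffun P * P -> bool} * ({ffun Tt -> bits} *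
   ({ffun Tt -> bits} * {ffun Tt * Tt -> bool})) => mk_z q.1 q.2.1 q.2.2.1 q.2.2.2)) //=.
  exists (fun z : {ffun I * I -> bool} => ([ffun ij => z (inr ij.1, inr ij.2)],
    ([ffun a => [ffun j => z (inl a, inr j)]], ([ffun b => [ffun i => z (inr i, inl b)]],
     [ffun ab => z (inl ab.1, inl ab.2)])))).
    move=> [l [k [t y]]] _ /=; congr (_, (_, (_, _))).
    - by apply/ffunP => -[i j]; rewrite !ffunE.
    - by apply/ffunP => a; apply/ffunP => j; rewrite !ffunE.
    - by apply/ffunP => a; apply/ffunP => j; rewrite !ffunE.
    - by apply/ffunP => -[i j]; rewrite !ffunE.
  by move=> z _; apply/ffunP => -[[a|i] [b|j]]; rewrite !ffunE /= ?ffunE.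
rewrite -(pair_big xpredT xpredT (fun l (q : {ffun Tt -> bits} *
   ({ffun Tt -> bits} * {ffun Tt * Tt -> bool})) => F (mk_z l q.1 q.2.1 q.2.2))) /=.
apply: eq_bigr => l _.
rewrite -(pair_big xpredT xpredT (fun k (q : {ffun Tt -> bits} * {ffun Tt * Tt -> bool}) =>
   F (mk_z l k q.1 q.2))) /=.
apply: eq_bigr => k _.
by rewrite -(pair_big xpredT xpredT (fun t y => F (mk_z l k t y))).
Qed.

Section Pins.
Variables (o : {ffun P -> Om}) (c : {ffun P -> Ga}) (l : {ffun P * P -> bool}).

Definition full_array (r : {ffun Tt -> Om}) (j : {ffun Tt -> Ga})
    (k t : {ffun Tt -> bits}) (y : {ffun Tt * Tt -> bool}) : V :=
  mk_array (xarray x (join r o) (join j c)) (mk_z l k t y).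

Definition const_array (xx : Om) (k : bits) (j : Ga) (t : bits) (b : bool) : V :=
  full_array [ffun=> xx] [ffun=> j] [ffun=> k] [ffun=> t] [ffun=> b].

Let nobits : bits := [ffun=> false].
Definition kerL : R := 2^-1 ^+ #|{: P * P}| *
  cdens p (blockL lv) (blockXp lv) (const_array x0 nobits j0 nobits false).
(** The hidden variable of a row is the string of its z-bits at the pinned columns. The power of 1/2
    turns the density into a probability; bits away from the pinned level-0 columns are uniform. *)
Definition kerK (xx : Om) (k : bits) : R := 2^-1 ^+ #|P| *
  cdens p (blockK lv a0) (condK lv a0) (const_array xx k j0 nobits false).
Definition kerT (j : Ga) (t : bits) : R := 2^-1 ^+ #|P| *
  cdens p (blockTh lv a0) (condTh lv a0) (const_array x0 nobits j t false).
Definition kerZ (xx : Om) (k : bits) (j : Ga) (t : bits) (b : bool) : R := 2^-1 *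
  cdens p (blockZ (a0, a0)) (condZ lv (a0, a0)) (const_array xx k j t b).

Lemma tperm_inl_eq (a : Tt) (i : I) : (tperm (inl a0) (inl a) i == inl a) = (i == inl a0).
Proof. by rewrite -{2}(tpermL (inl a0 : I) (inl a)) (inj_eq perm_inj). Qed.

Lemma pinned_tperm q (a : Tt) (i : I) :
  pinned q lv (tperm (inl a0) (inl a) i) = pinned q lv i.
Proof. by case: tpermP => [->|->|]. Qed.

Lemma cdensL_full r j k t y :
  2^-1 ^+ #|{: P * P}| * cdens p (blockL lv) (blockXp lv) (full_array r j k t y) = kerL.
Proof.
congr (_ * _); apply: cdens_depends_on => -[[i i'] b]; rewrite !inE /inL /=.
case: i => [a|i]; case: i' => [a'|i'] /=; rewrite ?andbF //= => _.
by rewrite !ffunE /= ?ffunE.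
Qed.

(** Exchangeability carries the test [a] to the reference test [a0], so every test row obeys the
    same rule; this is what allows the rule to be applied to independent rows. *)
Lemma cdensK_full r j k t y a :
  2^-1 ^+ #|P| * cdens p (blockK lv a) (condK lv a) (full_array r j k t y) = kerK (r a) (k a).
Proof.
congr (_ * _); rewrite (cdens_perm _ _ _ (p_exch (tperm (inl a0) (inl a)) 1%g)).
set s := entry_perm _ _.
have sE i i' b : s (i, i', b) = (tperm (inl a0) (inl a) i, i', b) by rewrite permE /= perm1.
have -> : s @^-1: blockK lv a = blockK lv a0.
  by apply/setP => -[[i i'] b]; rewrite !inE sE /= tperm_inl_eq.
have -> : s @^-1: condK lv a = condK lv a0.
  by apply/setP => -[[i i'] b]; rewrite !inE /inL sE /= tperm_inl_eq !pinned_tperm.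
apply: cdens_depends_on => -[[i i'] b]; rewrite !inE /inL /= ffunE sE.
case: i' => [a'|i'] /=; rewrite ?andbF //=.
case: i => [a1|i] /= h; last by rewrite tpermD // !ffunE /= ?ffunE.
have -> : a1 = a0.
  by move: h; rewrite ?andbF ?orbF /=; case: b => /=; rewrite ?orbF => /andP[/eqP[]].
by rewrite tpermL !ffunE /= ?ffunE.
Qed.

Lemma cdensT_full r j k t y b :
  2^-1 ^+ #|P| * cdens p (blockTh lv b) (condTh lv b) (full_array r j k t y) = kerT (j b) (t b).
Proof.
congr (_ * _); rewrite (cdens_perm _ _ _ (p_exch 1%g (tperm (inl a0) (inl b)))).
set s := entry_perm _ _.
have sE i i' q : s (i, i', q) = (i, tperm (inl a0) (inl b) i', q) by rewrite permE /= perm1.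
have -> : s @^-1: blockTh lv b = blockTh lv a0.
  by apply/setP => -[[i i'] q]; rewrite !inE sE /= tperm_inl_eq.
have -> : s @^-1: condTh lv b = condTh lv a0.
  by apply/setP => -[[i i'] q]; rewrite !inE /inL sE /= tperm_inl_eq !pinned_tperm.
apply: cdens_depends_on => -[[i i'] q]; rewrite !inE /inL /= ffunE sE.
case: i => [a'|i] /=; rewrite ?andbF //=.
case: i' => [a1|i'] /= h; last by rewrite tpermD // !ffunE /= ?ffunE.
have -> : a1 = a0.
  by move: h; rewrite ?andbF ?orbF /=; case: q => /=; rewrite ?andbF ?orbF => /andP[_ /eqP[]].
by rewrite tpermL !ffunE /= ?ffunE.
Qed.

Lemma cdensZ_full r j k t y ab :
  2^-1 * cdens p (blockZ ab) (condZ lv ab) (full_array r j k t y) =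
  kerZ (r ab.1) (k ab.1) (j ab.2) (t ab.2) (y ab).
Proof.
case: ab => a b /=.
congr (_ * _); rewrite (cdens_perm _ _ _
  (p_exch (tperm (inl a0) (inl a)) (tperm (inl a0) (inl b)))).
set s := entry_perm _ _.
have sE i i' q : s (i, i', q) = (tperm (inl a0) (inl a) i, tperm (inl a0) (inl b) i', q).
  by rewrite permE.
have -> : s @^-1: blockZ (a, b) = blockZ (a0, a0).
  by apply/setP => -[[i i'] q]; rewrite !inE sE !xpair_eqE /= !tperm_inl_eq.
have -> : s @^-1: condZ lv (a, b) = condZ lv (a0, a0).
  by apply/setP => -[[i i'] q]; rewrite !inE /inL sE /= !tperm_inl_eq !pinned_tperm.
apply: cdens_depends_on => -[[i i'] q] h.
have {h} : ((i == inl a0) || ~~ is_test i) && ((i' == inl a0) || ~~ is_test i').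
  move: h; rewrite !inE /inL !xpair_eqE /=.
  case: i => [a1|i]; case: i' => [a2|i'] //=; rewrite ?andbF ?andbT ?orbF ?orbT //=;
  by case: q => /=; rewrite ?andbT ?andbF ?orbF /=; (try by case: eqP); case/andP.
rewrite ffunE sE /=; case/andP=> hi hi'.
case: i hi => [a1|i] /=; rewrite ?orbF; last move=> _; last rewrite tpermD //.
  move=> /eqP[->]; rewrite tpermL.
  case: i' hi' => [a2|i'] /=; rewrite ?orbF; last by move=> _; rewrite tpermD // !ffunE /= ?ffunE.
  by move=> /eqP[->]; rewrite tpermL !ffunE /= ?ffunE.
case: i' hi' => [a2|i'] /=; rewrite ?orbF; last by move=> _; rewrite tpermD // !ffunE /= ?ffunE.
by move=> /eqP[->]; rewrite tpermL !ffunE /= ?ffunE.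
Qed.

Lemma half_ge0 q : 0 <= 2^-1 ^+ q :> R.
Proof. by rewrite exprn_ge0 // invr_ge0. Qed.

Lemma kerK_dist xx : pdist (kerK xx).
Proof.
split=> [k|]; first by rewrite mulr_ge0 ?half_ge0 ?cdens_ge0.
apply: (@average_cdens R E p P (fun i => (inl a0, inr i, true)) _ _
  (const_array xx nobits j0 nobits false)).
- by move=> i i' [].
- apply/subsetP => -[[i i'] b]; rewrite inE /=; case: b => //= /andP[/eqP ->].
  by case: i' => // i' _; apply/codomP; exists i'.
- by move=> q; rewrite inE /inL /=.
- by move=> k q _; rewrite !ffunE /= ?ffunE.
- move=> k [[i i'] b]; rewrite inE /inL /=.
  by case: i' => [a'|i']; case: i => [a1|i] //=; rewrite ?andbF //=; case: b => //=;
     rewrite ?andbF ?orbF // => _; rewrite !ffunE /= ?ffunE.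
Qed.

Lemma kerT_dist j : pdist (kerT j).
Proof.
split=> [k|]; first by rewrite mulr_ge0 ?half_ge0 ?cdens_ge0.
apply: (@average_cdens R E p P (fun i => (inr i, inl a0, true)) _ _
  (const_array x0 nobits j nobits false)).
- by move=> i i' [].
- apply/subsetP => -[[i i'] b]; rewrite inE /=; case: b => //= /andP[+ /eqP ->].
  by case: i => // i _; apply/codomP; exists i.
- by move=> q; rewrite inE /inL /= !andbF.
- by move=> k q _; rewrite !ffunE /= ?ffunE.
- move=> k [[i i'] b]; rewrite inE /inL /=.
  by case: i' => [a'|i']; case: i => [a1|i] //=; rewrite ?andbF //=; case: b => //=;
     rewrite ?andbF ?orbF // => _; rewrite !ffunE /= ?ffunE.
Qed.

Lemma kerZ_dist xx k j t : pdist (kerZ xx k j t).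
Proof.
split=> [b|]; first by rewrite mulr_ge0 ?cdens_ge0 // invr_ge0.
have := @average_cdens R E p unit (fun=> (inl a0, inl a0, true)) (blockZ (a0, a0))
  (condZ lv (a0, a0)) (const_array xx k j t false)
  (fun f => const_array xx k j t (f tt)).
rewrite card_unit expr1 => <-.
- rewrite (reindex (fun b : bool => [ffun=> b] : {ffun unit -> bool})) /=.
    by apply: eq_bigr => b _; rewrite ffunE.
  exists (fun f => f tt); first by move=> b _; rewrite ffunE.
  by move=> f _; apply/ffunP => -[]; rewrite ffunE.
- by move=> [] [].
- by apply/subsetP => e; rewrite inE => /eqP ->; apply/codomP; exists tt.
- by move=> q; rewrite !inE /inL /= !andbF.
- by move=> f [] _; rewrite !ffunE /= ?ffunE.
- move=> f [[i i'] b]; rewrite !inE /inL /=.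
  by case: i' => [a'|i']; case: i => [a1|i] //=; rewrite ?andbF //=; case: b => //=;
     rewrite ?andbF ?orbF // => _; rewrite !ffunE /= ?ffunE.
Qed.
End Pins.

Lemma kerL_dist o c : pdist (fun l => kerL o c l).
Proof.
split=> [l|]; first by rewrite mulr_ge0 ?half_ge0 ?cdens_ge0.
apply: (@average_cdens R E p (P * P)%type (fun i => (inr i.1, inr i.2, true)) _ _
  (const_array o c [ffun=> false] x0 [ffun=> false] j0 [ffun=> false] false)).
- by move=> [i i'] [k k'] [-> ->].
- apply/subsetP => -[[i i'] b]; rewrite inE /inL /=; case: b => //=.
  by case: i => [a|i]; case: i' => [a'|i'] //=; rewrite ?andbF // => _; apply/codomP; exists (i, i').
- by move=> q; rewrite inE.
- by move=> k [q q'] _; rewrite !ffunE.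
- move=> k [[i i'] b]; rewrite inE /=; case: b => //= _.
  by rewrite !ffunE.
Qed.

End Kernels.

(** * From equal sketches to a transplanted coupling *)

Section Regenerate.
Variables (R : realType) (Tt : finType) (m : nat).
Let N := level_bound #|Tt| (m ^ 2).
Local Notation I := (idx Tt N).
Local Notation E := (entry Tt N).
Local Notation P := (pin_index Tt N).
Local Notation V := {ffun E -> bool}.
Local Notation bits := {ffun P -> bool}.
Variables (Om Om' Ga : finType) (w : Om -> R) (w' : Om' -> R) (u : Ga -> R).
Variables (x z : Om -> Ga -> bool) (x' : Om' -> Ga -> bool).
Hypotheses (w_dist : pdist w) (w'_dist : pdist w') (u_dist : pdist u).
Variables (g : {ffun Tt * Tt -> bool} -> {ffun Tt * Tt -> bool} -> R) (B : R).
Hypothesis gB : forall v y, `|g v y| <= B.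
Hypotheses (t_gt0 : (0 < #|Tt|)%N) (m_gt0 : (0 < m)%N).
Variables (x0 : Om') (j0 : Ga).

Let p : V -> R := pair_law w u x z.
Let p_dist : pdist p. Proof. exact: array_law_dist. Qed.
Let p_exch : exchangeable p. Proof. exact: pair_law_exch. Qed.
Let B_ge0 : 0 <= B. Proof. exact: le_trans (normr_ge0 _) (gB [ffun=> false] [ffun=> false]). Qed.

Definition tests_value (v : V) : R :=
  g [ffun ab => v (inl ab.1, inl ab.2, false)] [ffun ab => v (inl ab.1, inl ab.2, true)].

Lemma tests_value_depends_on lv : depends_on (layer4 lv) tests_value.
Proof.
move=> v v' h; congr (g _ _); apply/ffunP => ab; rewrite !ffunE; apply: h.
  by rewrite in_setU in_layer3 !inE.
by rewrite in_setU; apply/orP; right; apply/bigcupP; exists ab; rewrite ?inE.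
Qed.

Definition coupling_value : R :=
  \sum_(r : {ffun Tt -> Om}) (\prod_a w (r a)) *
  \sum_(c : {ffun Tt -> Ga}) (\prod_b u (c b)) * g (xtests x r c) (xtests z r c).

Section Level.
Variable lv : 'I_3 -> nat.

(** It depends on the x-array alone. The regenerated value is thus linear in the law of that array,
    and the sketch of another distribution may be substituted. *)
Definition fill (a : {ffun I * I -> bool}) : R :=
  \sum_(y : {ffun I * I -> bool}) 2^-1 ^+ #|{: I * I}| *
    (cond_prod p lv (mk_array a y) * tests_value (mk_array a y)).

Lemma sum_regen_fill : \sum_v regen p lv v * tests_value v = \sum_a xlaw w u x a * fill a.
Proof.
rewrite -(@sum_pair_law_xpart R Tt N _ _ w u x z) -/p.
pose h v := cond_prod p lv v * tests_value v.
have hd : depends_on (layer4 lv) h.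
  by apply: depends_onM; [exact: cond_prod_depends_on | exact: tests_value_depends_on].
transitivity (\sum_v \sum_v' p v' * (forget_kernel R (blockX lv) v' v * h v)).
  apply: eq_bigr => v _; rewrite /regen /forget -mulrA big_distrl /=.
  by apply: eq_bigr => v' _; rewrite kernelC -mulrA mulrCA.
rewrite exchange_big /=; apply: eq_bigr => v _; rewrite -big_distrr /=; congr (_ * _).
exact: sum_kernel_X.
Qed.

Lemma fill_le a : `|fill a| <= B.
Proof.
(* For a fixed x-array the regeneration weights form a probability, so [fill] inherits the bound on
   [g]. *)
have one : \sum_(y : {ffun I * I -> bool}) 2^-1 ^+ #|{: I * I}| *
    cond_prod p lv (mk_array a y) = 1.
  pose v0 := mk_array a [ffun=> false].
  have := @sum_kernel_X R Tt N lv v0 _ (cond_prod_depends_on p (lv := lv)).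
  rewrite xpart_mk => <-; rewrite sum_cond_prod //; last exact: kernel_depends_on.
  exact: kernel_sum1.
apply: (le_trans (ler_norm_sum _ _ _)); rewrite -[leRHS]mul1r -[X in _ <= X * _]one big_distrl /=.
have nn y : 0 <= 2^-1 ^+ #|{: I * I}| * cond_prod p lv (mk_array a y).
  by apply: mulr_ge0; [exact: half_ge0 | exact: cond_prod_ge0].
apply: ler_sum => y _; rewrite mulrA normrM ger0_norm ?nn //.
by rewrite ler_wpM2l ?nn //; apply: gB.
Qed.

Variable a0 : Tt.
Local Notation kL := (kerL p lv x' x0 j0).
Local Notation kK := (kerK p lv x' a0 j0).
Local Notation kT := (kerT p lv x' a0 x0).
Local Notation kZ := (kerZ p lv x' a0).

Lemma fill_full o c (r : {ffun Tt -> Om'}) (j : {ffun Tt -> Ga}) :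
  fill (xarray x' (join r o) (join j c)) =
  \sum_l kL o c l *
  \sum_(k : {ffun Tt -> bits}) (\prod_a kK o c l (r a) (k a)) *
  \sum_(t : {ffun Tt -> bits}) (\prod_b kT o c l (j b) (t b)) *
  \sum_(y : {ffun Tt * Tt -> bool})
    (\prod_ab kZ o c l (r ab.1) (k ab.1) (j ab.2) (t ab.2) (y ab)) * g (xtests x' r j) y.
Proof.
rewrite /fill sum_mk_z; apply: eq_bigr => l _; rewrite big_distrr /=.
apply: eq_bigr => k _; rewrite mulrA big_distrr /=.
apply: eq_bigr => t _; rewrite mulrA big_distrr /=.
apply: eq_bigr => y _; rewrite !mulrA -/(full_array x' o c l r j k t y).
have -> : tests_value (full_array x' o c l r j k t y) = g (xtests x' r j) y.
  by congr (g _ _); apply/ffunP => -[a b]; rewrite !ffunE /= ?ffunE.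
congr (_ * _).
rewrite -(cdensL_full p lv x' x0 j0 o c l r j k t y).
rewrite [X in _ = _ * X * _ * _](eq_bigr (fun a => 2^-1 ^+ #|P| *
  cdens p (blockK lv a) (condK lv a) (full_array x' o c l r j k t y))); last first.
  by move=> a _; rewrite -(cdensK_full lv p_exch x' a0 j0 o c l r j k t y).
rewrite [X in _ = _ * _ * X * _](eq_bigr (fun b => 2^-1 ^+ #|P| *
  cdens p (blockTh lv b) (condTh lv b) (full_array x' o c l r j k t y))); last first.
  by move=> b _; rewrite -(cdensT_full lv p_exch x' a0 x0 o c l r j k t y).
rewrite [X in _ = _ * _ * _ * X](eq_bigr (fun ab => 2^-1 *
  cdens p (blockZ ab) (condZ lv ab) (full_array x' o c l r j k t y))); last first.
  by move=> ab _; rewrite -(cdensZ_full lv p_exch x' a0 o c l r j k t y).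
rewrite !big_split /= !prodr_const /cond_prod.
(* The cells of the square array split into pin-pin, test-pin, pin-test and test-test cells, one
   power of 1/2 for each rule. *)
have -> : 2^-1 ^+ #|{: I * I}| = 2^-1 ^+ #|{: P * P}| * (2^-1 ^+ #|P|) ^+ #|Tt| *
   (2^-1 ^+ #|P|) ^+ #|Tt| * 2^-1 ^+ #|{: Tt * Tt}| :> R.
  rewrite -!exprM -!exprD; congr (_ ^+ _).
  have -> : #|{: I * I}| = ((#|Tt| + #|P|) * (#|Tt| + #|P|))%N.
    have cI : #|I| = (#|Tt| + #|P|)%N := card_sum Tt P.
    by rewrite (card_prod I I) cI.
  have -> : #|{: P * P}| = (#|P| * #|P|)%N := card_prod P P.
  have -> : #|{: Tt * Tt}| = (#|Tt| * #|Tt|)%N := card_prod Tt Tt.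
  by generalize #|Tt| #|P| => t1 p1; nia.
set c1 := cdens _ _ _ _; set c2 := \prod_a _; set c3 := \prod_b _; set c4 := \prod_ab _.
move: c1 c2 c3 c4 => c1 c2 c3 c4.
move: (2^-1 ^+ #|{: P * P}|) ((2^-1 ^+ #|P|) ^+ #|Tt|) (2^-1 ^+ #|{: Tt * Tt}|) => q1 q2 q3.
ring.
Qed.

(** The sums are reordered with the pins and their bits outermost, ready to be frozen one after the
    other. *)
Lemma sum_xlaw_fill : \sum_a xlaw w' u x' a * fill a =
  \sum_(o : {ffun P -> Om'}) (\prod_i w' (o i)) *
  \sum_(c : {ffun P -> Ga}) (\prod_i u (c i)) *
  \sum_l kL o c l * regen_value w' u x' (kK o c l) (kT o c l) (kZ o c l) g.
Proof.
rewrite sum_array_law sum_join_weighted; apply: eq_bigr => o _; congr (_ * _).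
under [LHS]eq_bigr => r _ do rewrite sum_join_weighted.
rewrite weighted_exchange; apply: eq_bigr => c _; congr (_ * _).
transitivity (\sum_(r : {ffun Tt -> Om'}) (\prod_a w' (r a)) *
   \sum_(j : {ffun Tt -> Ga}) (\prod_b u (j b)) *
  \sum_l kL o c l *
  \sum_(k : {ffun Tt -> bits}) (\prod_a kK o c l (r a) (k a)) *
  \sum_(t : {ffun Tt -> bits}) (\prod_b kT o c l (j b) (t b)) *
  \sum_(y : {ffun Tt * Tt -> bool})
    (\prod_ab kZ o c l (r ab.1) (k ab.1) (j ab.2) (t ab.2) (y ab)) * g (xtests x' r j) y).
  apply: eq_bigr => r _; congr (_ * _); apply: eq_bigr => j _; congr (_ * _).
  exact: fill_full.
rewrite weighted_exchange /=.
under [LHS]eq_bigr => j _ do rewrite weighted_exchange.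
by rewrite weighted_exchange.
Qed.

End Level.

(** Three errors are paid: regularity, the change of sketch, and column collisions. Since freezing
    by averaging keeps upper bounds only, the conclusion is one-sided. *)
Lemma regenerate eta coll :
  \sum_a `|xlaw (I := I) w u x a - xlaw w' u x' a| <= eta ->
  \sum_(j : {ffun Tt -> Ga}) (\prod_b u (j b)) * (~~ injectiveb j)%:R <= coll ->
  exists J : Om' * {ffun Ga -> bool} -> R,
    [/\ pdist J, forall o, \sum_y J (o, y) = w' o
      & test_value u x' g J <= coupling_value + B * (2 / m%:R + eta) + 2 * B * coll].
Proof.
move=> L1 hcoll; have [lv reg] := regularity t_gt0 m_gt0 p_dist p_exch.
have [a0 _] := card_gt0P t_gt0.
have e1 : coupling_value = \sum_v forget (layer4 lv) p v * tests_value v.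
  rewrite sum_forgetM; last exact: tests_value_depends_on.
  by rewrite (sum_pair_law_tests _ x z w_dist u_dist g).
(* Price of replacing the true z-entries by regenerated ones. *)
have d1 : `|\sum_v regen p lv v * tests_value v - coupling_value| <= B * (2 / m%:R).
  rewrite e1 -sumrB; apply: (le_trans (ler_norm_sum _ _ _)).
  apply: (@le_trans _ _ (B * \sum_v `|forget (layer4 lv) p v - regen p lv v|)).
    rewrite big_distrr /=; apply: ler_sum => v _; rewrite -mulrBl normrM mulrC distrC.
    by rewrite ler_wpM2r //; apply: gB.
  by rewrite ler_wpM2l.
(* Price of running the same rules on the rows of [w']. *)
have d2 : `|\sum_a xlaw w' u x' a * fill lv a - \sum_v regen p lv v * tests_value v| <= B * eta.
  rewrite sum_regen_fill -sumrB; apply: (le_trans (ler_norm_sum _ _ _)).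
  apply: (@le_trans _ _ (B * \sum_a `|xlaw (I := I) w u x a - xlaw w' u x' a|)).
    rewrite big_distrr /=; apply: ler_sum => v _; rewrite -mulrBl normrM mulrC distrC.
    by rewrite ler_wpM2r //; apply: fill_le.
  by rewrite ler_wpM2l.
move: d2; rewrite (sum_xlaw_fill lv a0) => d2.
set K := (X in `|X - _| <= B * eta) in d2.
have K_le : K <= coupling_value + B * (2 / m%:R + eta).
  by move: d1 d2; rewrite !ler_norml mulrDr => /andP[_ h1] /andP[_ h2]; lra.
(* Pinned rows, pinned columns and their z-bits are frozen in turn at values not above the mean; the
   hidden column variables follow once collisions are accounted for. *)
have [o ho] := weighted_sum_exists_le (pdist_prod P w'_dist) K_le.
have [c hc] := weighted_sum_exists_le (pdist_prod P u_dist) ho.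
have [l hl] := weighted_sum_exists_le (kerL_dist lv p_dist x' x0 j0 o c) hc.
have := @transplant_value R _ _ Ga _ Tt w' u x' _ _ _ w'_dist u_dist
  (kerK_dist lv p_dist x' a0 j0 o c l) (kerT_dist lv p_dist x' a0 x0 o c l)
  (kerZ_dist lv p_dist x' a0 o c l) g B gB.
set A := \sum_t _ => hA.
have A_le : A <= coupling_value + B * (2 / m%:R + eta) + 2 * B * coll.
  have : 2 * B * \sum_(j : {ffun Tt -> Ga}) (\prod_b u (j b)) * (~~ injectiveb j)%:R
     <= 2 * B * coll by rewrite ler_wpM2l // mulr_ge0.
  by move: hA; rewrite ler_norml => /andP[_]; lra.
have [t ht] := weighted_sum_exists_le (pdist_prodI (kerT_dist lv p_dist x' a0 x0 o c l)) A_le.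
exists (regen_row w' (kerK p lv x' a0 j0 o c l) (kerZ p lv x' a0 o c l) t); split=> //.
- by apply: regen_row_dist => // *; [apply: kerK_dist | apply: kerZ_dist].
- by move=> y; apply: regen_row_marginal => // *; [apply: kerK_dist | apply: kerZ_dist].
Qed.

End Regenerate.

(** * Earth mover distance *)

Section EarthMover.
Variables (R : realType) (n : nat).
Local Notation dist := {ffun bvec n -> R}.
Implicit Types (mu tau : dist) (T : {ffun bvec n * bvec n -> R}).

Definition transfer_cost T : R := \sum_p T p * dH R p.1 p.2.

Lemma dHE (x y : bvec n) : dH R x y = n%:R^-1 * \sum_j (x j != y j)%:R.
Proof.
rewrite /dH mulrC; congr (_ * _); rewrite -natr_sum; congr (_%:R).
rewrite -sum1_card big_mkcond /=; apply: eq_bigr => j _.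
by case: (boolP (x j != y j)) => h; [rewrite mem_set | rewrite memNset //; apply/negP].
Qed.

Lemma dH_ge0 (x y : bvec n) : 0 <= dH R x y.
Proof. by rewrite /dH divr_ge0. Qed.

Lemma dH_le1 (x y : bvec n) : dH R x y <= 1.
Proof.
rewrite /dH; case: n x y => [|m] x y; first by rewrite invr0 mulr0.
by rewrite ler_pdivrMr ?ltr0n // mul1r ler_nat -[leqRHS]card_ord; apply: max_card.
Qed.

Lemma dH_triangle (x y z : bvec n) : dH R x z <= dH R x y + dH R y z.
Proof.
rewrite !dHE -mulrDr ler_wpM2l ?invr_ge0 // -big_split /=; apply: ler_sum => j _.
by case: (x j); case: (y j); case: (z j); rewrite /=; lra.
Qed.

Lemma transfer_cost_ge0 T : is_dist T -> 0 <= transfer_cost T.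
Proof. by move=> [T0 _]; apply: sumr_ge0 => p _; rewrite mulr_ge0 ?dH_ge0. Qed.

Lemma transfer_cost_le1 T : is_dist T -> transfer_cost T <= 1.
Proof. by move=> Td; apply: (@weighted_sum_le R _ T) => // p; apply: dH_le1. Qed.

Local Open Scope classical_set_scope.
Definition costs mu tau := [set r : R | exists T, transfer T mu tau /\
                     r = \sum_p T p * dH R p.1 p.2].

Lemma costs_has_lbound mu tau : has_lbound (costs mu tau).
Proof. by exists 0 => r [T [[Td _] ->]]; apply: transfer_cost_ge0. Qed.

Lemma dEM_le_cost T mu tau : transfer T mu tau -> dEM mu tau <= transfer_cost T.
Proof. by move=> Tt; apply: (ge_inf (costs_has_lbound mu tau)); exists T. Qed.

Lemma product_transfer mu tau : is_dist mu -> is_dist tau ->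
  transfer [ffun p => mu p.1 * tau p.2] mu tau.
Proof.
move=> [m0 m1] [t0 t1].
have e1 x : \sum_y [ffun p : bvec n * bvec n => mu p.1 * tau p.2] (x, y) = mu x.
  by under eq_bigr do rewrite ffunE /=; rewrite -big_distrr /= t1 mulr1.
have e2 y : \sum_x [ffun p : bvec n * bvec n => mu p.1 * tau p.2] (x, y) = tau y.
  by under eq_bigr do rewrite ffunE /=; rewrite -big_distrl /= m1 mul1r.
split; [split|split] => //.
  by move=> p; rewrite ffunE mulr_ge0.
by rewrite sum_pair (eq_bigr mu).
Qed.

Lemma costs_nonempty mu tau : is_dist mu -> is_dist tau -> costs mu tau !=set0.
Proof.
move=> md td; eexists; exists [ffun p => mu p.1 * tau p.2]; split; last reflexivity.
exact: product_transfer.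
Qed.

Lemma dEM_ge0 mu tau : is_dist mu -> is_dist tau -> 0 <= dEM mu tau.
Proof.
move=> md td; apply: lb_le_inf; first exact: costs_nonempty.
by move=> r [T [[Td _] ->]]; apply: transfer_cost_ge0.
Qed.

Lemma dEM_approx mu tau e : is_dist mu -> is_dist tau -> 0 < e ->
  exists2 T, transfer T mu tau & transfer_cost T < dEM mu tau + e.
Proof.
move=> md td e0; have hi : has_inf (costs mu tau).
  by split; [exact: costs_nonempty | exact: costs_has_lbound].
by have [r [T [Tt ->]] h] := inf_adherent e0 hi; exists T.
Qed.

Section Glue.
Variables (T1 T2 : {ffun bvec n * bvec n -> R}) (mu tau nu : dist).
Hypotheses (h1 : transfer T1 mu tau) (h2 : transfer T2 tau nu).

Let T1_ge0 p : 0 <= T1 p. Proof. by have [[]] := h1. Qed.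
Let T2_ge0 p : 0 <= T2 p. Proof. by have [[]] := h2. Qed.
Let m1 x : \sum_y T1 (x, y) = mu x. Proof. by have [_ []] := h1. Qed.
Let m2 y : \sum_x T1 (x, y) = tau y. Proof. by have [_ []] := h1. Qed.
Let m3 y : \sum_z T2 (y, z) = tau y. Proof. by have [_ []] := h2. Qed.
Let m4 z : \sum_y T2 (y, z) = nu z. Proof. by have [_ []] := h2. Qed.

Let T1_null x y : tau y = 0 -> T1 (x, y) = 0.
Proof.
move=> ty; apply/eqP; have /eqP := m2 y; rewrite ty psumr_eq0 => [/allP h|*]; last exact: T1_ge0.
exact: (h x (mem_index_enum _)).
Qed.
Let T2_null y z : tau y = 0 -> T2 (y, z) = 0.
Proof.
move=> ty; apply/eqP; have /eqP := m3 y; rewrite ty psumr_eq0 => [/allP h|*]; last exact: T2_ge0.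
exact: (h z (mem_index_enum _)).
Qed.

(** The gluing construction: the two outer points are independent given the middle one. Where
    [tau y = 0] both couplings vanish, so division by zero does no harm. *)
Definition glue : {ffun bvec n * bvec n -> R} :=
  [ffun p => \sum_y T1 (p.1, y) * T2 (y, p.2) / tau y].

Let sumz x y : \sum_z T1 (x, y) * T2 (y, z) / tau y = T1 (x, y).
Proof.
rewrite -big_distrl -big_distrr /= m3.
have [ty|ty] := eqVneq (tau y) 0; last by rewrite mulfK.
by rewrite T1_null // !mul0r.
Qed.
Let sumx y z : \sum_x T1 (x, y) * T2 (y, z) / tau y = T2 (y, z).
Proof.
under eq_bigr do rewrite -mulrA; rewrite -big_distrl /= m2.
have [ty|ty] := eqVneq (tau y) 0; last by rewrite mulrC mulfVK.
by rewrite T2_null // !mul0r mulr0.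
Qed.

Let g1 x : \sum_z glue (x, z) = mu x.
Proof.
under eq_bigr do rewrite ffunE /=; rewrite exchange_big /=.
by under eq_bigr do rewrite sumz.
Qed.
Let g2 z : \sum_x glue (x, z) = nu z.
Proof.
under eq_bigr do rewrite ffunE /=; rewrite exchange_big /=.
by under eq_bigr do rewrite sumx.
Qed.

Let tau_ge0 y : 0 <= tau y. Proof. by rewrite -m2 sumr_ge0. Qed.

Lemma glue_transfer : is_dist mu -> transfer glue mu nu.
Proof.
move=> md; split; last by split.
split=> [p|]; first by rewrite ffunE; apply: sumr_ge0 => y _; rewrite divr_ge0 ?mulr_ge0.
rewrite sum_pair.
by under eq_bigr do rewrite g1; have [] := md.
Qed.

Lemma glue_cost : transfer_cost glue <= transfer_cost T1 + transfer_cost T2.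
Proof.
pose W x y z := T1 (x, y) * T2 (y, z) / tau y.
have W0 x y z : 0 <= W x y z by rewrite divr_ge0 ?mulr_ge0.
have -> : transfer_cost glue = \sum_x \sum_z \sum_y W x y z * dH R x z.
  rewrite pair_big /=; apply: eq_bigr => -[x z] _.
  by rewrite ffunE big_distrl.
apply: (@le_trans _ _ (\sum_x \sum_z \sum_y (W x y z * dH R x y + W x y z * dH R y z))).
  apply: ler_sum => x _; apply: ler_sum => z _; apply: ler_sum => y _.
  by rewrite -mulrDr ler_wpM2l // dH_triangle.
have -> : transfer_cost T1 = \sum_x \sum_z \sum_y W x y z * dH R x y.
  rewrite /transfer_cost sum_pair /=.
  apply: eq_bigr => x _; rewrite exchange_big /=; apply: eq_bigr => y _.
  by rewrite -big_distrl /= sumz.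
have -> : transfer_cost T2 = \sum_x \sum_z \sum_y W x y z * dH R y z.
  rewrite /transfer_cost sum_pair /=.
  rewrite [RHS]exchange_big /= [LHS]exchange_big /=; apply: eq_bigr => z _.
  rewrite exchange_big /=; apply: eq_bigr => y _.
  by rewrite -big_distrl /= sumx.
rewrite -big_split /=; apply: ler_sum => x _; rewrite -big_split /=; apply: ler_sum => z _.
by rewrite -big_split.
Qed.
End Glue.

Variable P : dprop R.
Hypothesis P_prop : is_dprop P.

Definition prop_dists mu := [set d : R | exists tau, P tau /\ d = dEM mu tau].

Lemma P_dist tau : P tau -> is_dist tau.
Proof. by have [h _] := P_prop n; apply: h. Qed.

Lemma prop_dists_has_inf mu : is_dist mu -> has_inf (prop_dists mu).
Proof.
move=> md; split.
  by have [_ [[tau Pt] _]] := P_prop n; exists (dEM mu tau), tau.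
by exists 0 => r [tau [Pt ->]]; apply: dEM_ge0 => //; apply: P_dist.
Qed.

Lemma dEMP_le mu tau : is_dist mu -> P tau -> dEMP P mu <= dEM mu tau.
Proof.
move=> md Pt; apply: (@ge_inf _ (prop_dists mu)); last by exists tau.
by have [] := prop_dists_has_inf md.
Qed.

Lemma dEMP_approx mu e : is_dist mu -> 0 < e ->
  exists tau T, [/\ P tau, transfer T mu tau & transfer_cost T < dEMP P mu + e].
Proof.
move=> md e0; have e2 : 0 < e / 2 by rewrite divr_gt0.
have [d [tau [Pt ->]] h] := inf_adherent e2 (prop_dists_has_inf md).
have [T Tt hT] := dEM_approx md (P_dist Pt) e2.
exists tau, T; split=> //; apply: (lt_trans hT).
have -> : dEMP P mu + e = dEMP P mu + e / 2 + e / 2 by lra.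
by rewrite ltrD2r.
Qed.

Lemma dEMP_le1 mu : is_dist mu -> dEMP P mu <= 1.
Proof.
move=> md; have [_ [[tau Pt] _]] := P_prop n; have td := P_dist Pt.
apply: (le_trans (dEMP_le md Pt)).
apply: (le_trans (dEM_le_cost (product_transfer md td))).
by apply: transfer_cost_le1; have [] := product_transfer md td.
Qed.

Lemma dEMP_triangle T mu tau : is_dist mu -> is_dist tau -> transfer T mu tau ->
  dEMP P mu <= transfer_cost T + dEMP P tau.
Proof.
move=> md td Tt; apply/ler_addgt0Pr => e e0.
have [nu [T2 [Pn h2 c2]]] := dEMP_approx td e0.
apply: (le_trans (dEMP_le md Pn)).
apply: (le_trans (dEM_le_cost (glue_transfer Tt h2 md))).
apply: (le_trans (glue_cost Tt h2)); rewrite -addrA lerD2l; exact: ltW.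
Qed.

Hypothesis P_inv : index_invariant P.

Lemma dperm_in pi mu : P mu -> P (dperm pi mu).
Proof. by move=> Pm; rewrite -(P_inv pi); exists mu. Qed.

Definition permute (pi : {perm 'I_n}) (x : bvec n) : bvec n := [ffun j => x (pi j)].

Lemma permuteK pi : cancel (permute pi) (permute pi^-1%g).
Proof. by move=> x; apply/ffunP => j; rewrite !ffunE permKV. Qed.

Lemma permute_inj pi : injective (permute pi).
Proof. exact: can_inj (permuteK pi). Qed.

Lemma dpermE pi mu x : dperm pi mu x = mu (permute pi^-1%g x).
Proof. by rewrite ffunE. Qed.

Lemma dperm_permute pi mu x : dperm pi mu (permute pi x) = mu x.
Proof. by rewrite dpermE permuteK. Qed.

Lemma dperm_dist pi mu : is_dist mu -> is_dist (dperm pi mu).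
Proof.
move=> [m0 m1]; split=> [x|]; first by rewrite dpermE.
rewrite -m1 (reindex_inj (@permute_inj pi)) /=.
by apply: eq_bigr => x _; rewrite dperm_permute.
Qed.

Lemma dH_permute pi x y : dH R (permute pi x) (permute pi y) = dH R x y.
Proof.
rewrite !dHE; congr (_ * _); rewrite [RHS](reindex_inj (@perm_inj _ pi)) /=.
by apply: eq_bigr => j _; rewrite !ffunE.
Qed.

(** A coupling of the permuted distribution is pulled back along [permute pi], which preserves [dH];
    index-invariance keeps the pulled-back second marginal in [P]. *)
Lemma dEMP_dperm pi mu : is_dist mu -> dEMP P mu <= dEMP P (dperm pi mu).
Proof.
move=> md; apply/ler_addgt0Pr => e e0.
have [nu [T [Pn [[T0 T1] [h1 h2]] c]]] := dEMP_approx (dperm_dist pi md) e0.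
pose T' : {ffun bvec n * bvec n -> R} := [ffun p => T (permute pi p.1, permute pi p.2)].
have s1 x : \sum_y T' (x, y) = mu x.
  rewrite -(dperm_permute pi) -h1 [RHS](reindex_inj (@permute_inj pi)) /=.
  by apply: eq_bigr => y _; rewrite ffunE.
have s2 y : \sum_x T' (x, y) = dperm pi^-1%g nu y.
  rewrite dpermE invgK -h2 [RHS](reindex_inj (@permute_inj pi)) /=.
  by apply: eq_bigr => x _; rewrite ffunE.
have tr : transfer T' mu (dperm pi^-1%g nu).
  split; last by split.
  split=> [p|]; first by rewrite ffunE.
  rewrite sum_pair.
  by under eq_bigr do rewrite s1; have [] := md.
apply: (le_trans (dEMP_le md (dperm_in _ Pn))); apply: (le_trans (dEM_le_cost tr)).
suff -> : transfer_cost T' = transfer_cost T by apply: ltW.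
rewrite /transfer_cost.
rewrite !sum_pair /=.
rewrite [RHS](reindex_inj (@permute_inj pi)) /=; apply: eq_bigr => x _.
rewrite [RHS](reindex_inj (@permute_inj pi)) /=; apply: eq_bigr => y _.
by rewrite ffunE dH_permute.
Qed.

End EarthMover.

(** * Continuity of the distance to a property *)

Section ArrayExpectation.
Variables (R : realType) (Om Ga : finType) (w : Om -> R) (u : Ga -> R).
Hypotheses (w_dist : pdist w) (u_dist : pdist u).

Definition array_mean (I : finType) (F : {ffun I -> Om} -> {ffun I -> Ga} -> R) : R :=
  \sum_(r : {ffun I -> Om}) (\prod_i w (r i)) *
  \sum_(c : {ffun I -> Ga}) (\prod_i u (c i)) * F r c.

Lemma eq_array_mean (I : finType) (F G : {ffun I -> Om} -> {ffun I -> Ga} -> R) :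
  (forall r c, F r c = G r c) -> array_mean F = array_mean G.
Proof.
move=> h; apply: eq_bigr => r _; congr (_ * _); apply: eq_bigr => c _.
by rewrite h.
Qed.

Lemma array_meanD (I : finType) (F G : {ffun I -> Om} -> {ffun I -> Ga} -> R) :
  array_mean (fun r c => F r c + G r c) = array_mean F + array_mean G.
Proof.
rewrite /array_mean -big_split /=; apply: eq_bigr => r _; rewrite -mulrDr; congr (_ * _).
by rewrite -big_split /=; apply: eq_bigr => c _; rewrite mulrDr.
Qed.

Lemma array_meanZ (I : finType) (a : R) (F : {ffun I -> Om} -> {ffun I -> Ga} -> R) :
  array_mean (fun r c => a * F r c) = a * array_mean F.
Proof.
rewrite /array_mean big_distrr /=; apply: eq_bigr => r _; rewrite mulrCA; congr (_ * _).
by rewrite big_distrr /=; apply: eq_bigr => c _; rewrite mulrCA.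
Qed.

Lemma array_mean_cst (I : finType) (a : R) :
  array_mean (fun (_ : {ffun I -> Om}) (_ : {ffun I -> Ga}) => a) = a.
Proof.
have [_ W1] := pdist_prod I w_dist; have [_ U1] := pdist_prod I u_dist.
by rewrite /array_mean -!big_distrl /= W1 U1 !mul1r.
Qed.

Lemma array_mean_ge (I : finType) (b : R) (F : {ffun I -> Om} -> {ffun I -> Ga} -> R) :
  (forall r c, b <= F r c) -> b <= array_mean F.
Proof.
move=> h; apply: weighted_sum_ge; first exact: pdist_prod.
by move=> r; apply: weighted_sum_ge => //; apply: pdist_prod.
Qed.

Lemma array_mean_le (I : finType) (b : R) (F : {ffun I -> Om} -> {ffun I -> Ga} -> R) :
  (forall r c, F r c <= b) -> array_mean F <= b.
Proof.
move=> h; apply: weighted_sum_le; first exact: pdist_prod.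
by move=> r; apply: weighted_sum_le => //; apply: pdist_prod.
Qed.

Lemma array_mean_inj (I J : finType) (e : J -> I)
    (F : {ffun J -> Om} -> {ffun J -> Ga} -> R) : injective e ->
  array_mean (fun r c => F [ffun j => r (e j)] [ffun j => c (e j)]) = array_mean F.
Proof.
move=> eI; rewrite /array_mean.
rewrite -(@sum_prod_weight_inj R _ _ _ e w (fun r =>
   \sum_(c : {ffun J -> Ga}) (\prod_i u (c i)) * F r c) eI w_dist).
apply: eq_bigr => r _; congr (_ * _).
exact: (@sum_prod_weight_inj R _ _ _ e u (F [ffun j => r (e j)]) eI u_dist).
Qed.

Lemma array_mean_single (I : finType) (e : I) (F : Om -> Ga -> R) :
  array_mean (fun r c => F (r e) (c e)) = \sum_o w o * \sum_c u c * F o c.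
Proof.
have e1 : injective (fun _ : unit => e) by move=> [] [].
have red (T : finType) (v : T -> R) (H : T -> R) :
    \sum_(f : {ffun unit -> T}) (\prod_i v (f i)) * H (f tt) = \sum_t v t * H t.
  rewrite (reindex (fun t : T => [ffun=> t] : {ffun unit -> T})) /=; last first.
    exists (fun f => f tt); first by move=> b _; rewrite ffunE.
    by move=> f _; apply/ffunP => -[]; rewrite ffunE.
  by apply: eq_bigr => t _; rewrite (big_pred1 tt) ?ffunE // => -[].
transitivity (array_mean (fun (r : {ffun unit -> Om}) (c : {ffun unit -> Ga}) => F (r tt) (c tt))).
  rewrite -(array_mean_inj (fun (r : {ffun unit -> Om}) (c : {ffun unit -> Ga}) => F (r tt) (c tt)) e1).
  by apply: eq_array_mean => r c; rewrite !ffunE.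
rewrite /array_mean (red _ w (fun o => \sum_(c : {ffun unit -> Ga})
   (\prod_i u (c i)) * F o (c tt))).
by apply: eq_bigr => o _; congr (_ * _); rewrite (red _ u (F o)).
Qed.

(** Disjoint blocks have separate rows and separate columns, hence are independent; this produces
    the square in [deviation_mean]. *)
Lemma array_mean_indep (I J : finType) (F : {ffun I -> Om} -> {ffun I -> Ga} -> R)
    (G : {ffun J -> Om} -> {ffun J -> Ga} -> R) :
  array_mean (fun (r : {ffun I + J -> Om}) (c : {ffun I + J -> Ga}) =>
    F [ffun i => r (inl i)] [ffun i => c (inl i)] *
    G [ffun j => r (inr j)] [ffun j => c (inr j)]) = array_mean F * array_mean G.
Proof.
have joinl (A B T : finType) (g : {ffun A -> T}) (h : {ffun B -> T}) :
    [ffun i => join g h (inl i)] = g by apply/ffunP => i; rewrite !ffunE.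
have joinr (A B T : finType) (g : {ffun A -> T}) (h : {ffun B -> T}) :
    [ffun i => join g h (inr i)] = h by apply/ffunP => i; rewrite !ffunE.
rewrite /array_mean sum_join_weighted mulrC big_distrl /=; apply: eq_bigr => h _.
rewrite -mulrA; congr (_ * _).
under eq_bigr => g _ do rewrite sum_join_weighted.
rewrite mulrC big_distrl /=; apply: eq_bigr => g _; rewrite -mulrA; congr (_ * _).
rewrite mulrC big_distrl /=; apply: eq_bigr => d _; rewrite -mulrA; congr (_ * _).
rewrite mulrC big_distrl /=; apply: eq_bigr => c _; rewrite !joinl !joinr; ring.
Qed.

End ArrayExpectation.

Section TestFunctional.
Variables (R : realType) (k : nat) (f : {ffun 'I_k.+1 * 'I_k.+1 -> bool} -> R).
Hypothesis f01 : forall y, 0 <= f y <= 1.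
Let Tt : finType := ('I_k.+1 + 'I_k.+1)%type.

Definition block1 (y : {ffun Tt * Tt -> bool}) : {ffun 'I_k.+1 * 'I_k.+1 -> bool} :=
  [ffun ij => y (inl ij.1, inl ij.2)].
Definition block2 (y : {ffun Tt * Tt -> bool}) : {ffun 'I_k.+1 * 'I_k.+1 -> bool} :=
  [ffun ij => y (inr ij.1, inr ij.2)].

(* Its mean is the transfer cost plus lam times the squared deviation of the
   acceptance probability from a, the square coming from two disjoint blocks. *)
Definition deviation (lam a : R) (v y : {ffun Tt * Tt -> bool}) : R :=
  (v (inl ord0, inl ord0) != y (inl ord0, inl ord0))%:R +
  lam * (f (block1 y) * f (block2 y) + (- 2 * a * f (block1 y) + a ^+ 2)).

Lemma deviation_le lam a v y : 0 <= lam -> 0 <= a <= 1 ->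
  `|deviation lam a v y| <= 1 + 2 * lam.
Proof.
move=> l0 /andP[a0 a1].
have /andP[p0 p1] := f01 (block1 y); have /andP[q0 q1] := f01 (block2 y).
rewrite /deviation; apply: (le_trans (ler_normD _ _)); apply: lerD.
  by rewrite ger0_norm ?ler0n // lern1; case: (_ != _).
rewrite normrM (ger0_norm l0) mulrC ler_wpM2r // ler_norml.
move: (f _) (f _) p0 p1 q0 q1 => p q p0 p1 q0 q1; rewrite expr2.
apply/andP; split; nra.
Qed.

Section Mean.
Variables (Om Ga : finType) (w : Om -> R) (u : Ga -> R) (x z : Om -> Ga -> bool).
Hypotheses (w_dist : pdist w) (u_dist : pdist u).

Definition acceptance : R :=
  array_mean w u (fun (r : {ffun 'I_k.+1 -> Om}) (c : {ffun 'I_k.+1 -> Ga}) =>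
    f (xtests z r c)).

Definition entry_cost : R := \sum_o w o * \sum_c u c * (x o c != z o c)%:R.

Lemma deviation_mean lam a :
  array_mean w u (fun (r : {ffun Tt -> Om}) (c : {ffun Tt -> Ga}) =>
     deviation lam a (xtests x r c) (xtests z r c)) =
  entry_cost + lam * (acceptance - a) ^+ 2.
Proof.
rewrite /deviation !array_meanD array_meanZ !array_meanD array_meanZ array_mean_cst //.
congr (_ + _ * _).
  rewrite /entry_cost -(array_mean_single w_dist u_dist (inl ord0 : Tt) (fun o c => (x o c != z o c)%:R)).
  by apply: eq_array_mean => r c; rewrite !ffunE.
have -> : array_mean w u (fun (r : {ffun Tt -> Om}) (c : {ffun Tt -> Ga}) =>
    f (block1 (xtests z r c)) * f (block2 (xtests z r c))) = acceptance * acceptance.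
  rewrite -array_mean_indep; apply: eq_array_mean => r c.
  by congr (f _ * f _); apply/ffunP => ij; rewrite !ffunE.
have -> : array_mean w u (fun (r : {ffun Tt -> Om}) (c : {ffun Tt -> Ga}) =>
    f (block1 (xtests z r c))) = acceptance.
  have inlI : injective (inl : 'I_k.+1 -> Tt) by move=> ? ? [].
  rewrite /acceptance -(array_mean_inj w_dist u_dist _ inlI).
  by apply: eq_array_mean => r c; congr (f _); apply/ffunP => ij; rewrite !ffunE.
ring.
Qed.

Lemma acceptance01 : 0 <= acceptance <= 1.
Proof.
apply/andP; split.
  by apply: array_mean_ge => // r c; have /andP[] := f01 (xtests z r c).
by apply: array_mean_le => // r c; have /andP[] := f01 (xtests z r c).
Qed.

End Mean.
End TestFunctional.

Section Pushforward.
Variable R : realType.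

Lemma sum_prod_pushforward (I A B : finType) (h : A -> B) (w : A -> R) (w' : B -> R)
    (F : {ffun I -> B} -> R) :
  (forall b, \sum_(a | h a == b) w a = w' b) ->
  \sum_(r : {ffun I -> A}) (\prod_i w (r i)) * F [ffun i => h (r i)] =
  \sum_(s : {ffun I -> B}) (\prod_i w' (s i)) * F s.
Proof.
move=> hw.
transitivity (\sum_(s : {ffun I -> B}) \sum_(r : {ffun I -> A})
   (\prod_i w (r i)) * ([ffun i => h (r i)] == s)%:R * F s).
  rewrite exchange_big /=; apply: eq_bigr => r _.
  under [RHS]eq_bigr => s _ do rewrite -mulrA.
  by rewrite -big_distrr /= sum_indic.
apply: eq_bigr => s _; rewrite -big_distrl /=; congr (_ * _).
transitivity (\prod_i \sum_a w a * (h a == s i)%:R); last first.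
  apply: eq_bigr => i _; rewrite -hw [RHS]big_mkcond /=; apply: eq_bigr => a _.
  by case: ifP; rewrite ?mulr1 ?mulr0.
rewrite bigA_distr_bigA /=; apply: eq_bigr => r _; rewrite big_split /=; congr (_ * _).
rewrite -indic_prod; congr (nat_of_bool _)%:R.
apply/eqP/forallP => [<- i|e]; first by rewrite ffunE.
by apply/ffunP => i; rewrite ffunE; apply/eqP.
Qed.

(** A union bound over ordered pairs of distinct tests, each of which collides with probability 1 /
    n. *)
Lemma collision_le (Tt : finType) (n : nat) : (0 < n)%N ->
  \sum_(j : {ffun Tt -> 'I_n}) (\prod_(b : Tt) n%:R^-1) * (~~ injectiveb j)%:R
  <= (#|Tt| ^ 2)%:R / n%:R :> R.
Proof.
move=> n0; have nR : n%:R != 0 :> R by rewrite pnatr_eq0 -lt0n.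
have ud := pdist_uniform R n0.
have [U0 _] := pdist_prod Tt ud.
apply: (@le_trans _ _ (\sum_(j : {ffun Tt -> 'I_n}) (\prod_(b : Tt) n%:R^-1) *
   \sum_(bb : Tt * Tt | bb.1 != bb.2) (j bb.1 == j bb.2)%:R)).
  apply: ler_sum => j _; apply: ler_wpM2l; first exact: (U0 j).
  case: (boolP (injectiveb j)) => [_|] /=; first by apply: sumr_ge0.
  case/injectivePn => b [b' ne e].
  rewrite (bigD1 (b, b')) //= e eqxx lerDl; exact: sumr_ge0.
under [leLHS]eq_bigr => j _ do rewrite big_distrr /=.
rewrite exchange_big /=.
apply: (@le_trans _ _ (\sum_(bb : Tt * Tt | bb.1 != bb.2) n%:R^-1)); last first.
  rewrite sumr_const -[_ *+ _]mulr_natl ler_wpM2r ?invr_ge0 // ler_nat -mulnn -card_prod.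
  exact: max_card.
apply: ler_sum => -[b b'] /= ne.
pose e (q : bool) := if q then b else b'.
have eI : injective e by case=> [] [] //= h; rewrite h eqxx in ne.
rewrite le_eqVlt; apply/orP; left; apply/eqP.
transitivity (\sum_(g : {ffun bool -> 'I_n}) (\prod_(i : bool) n%:R^-1) * (g true == g false)%:R : R).
  rewrite -(@sum_prod_weight_inj R _ _ _ e (fun=> n%:R^-1) (fun g => (g true == g false)%:R) eI ud).
  by apply: eq_bigr => j _; rewrite !ffunE.
rewrite (reindex (fun pq : 'I_n * 'I_n => [ffun q : bool => if q then pq.1 else pq.2])) /=; last first.
  exists (fun g : {ffun bool -> 'I_n} => (g true, g false)).
    by move=> [p q] _; rewrite !ffunE.
  by move=> g _; apply/ffunP => -[]; rewrite !ffunE.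
rewrite sum_pair /=.
transitivity (\sum_(p < n) n%:R^-1 * n%:R^-1 : R).
  apply: eq_bigr => p _; rewrite big_bool -big_distrr /= (bigD1 p) //= !ffunE eqxx big1 ?addr0 ?mulr1 //.
  by move=> q qp; rewrite !ffunE eq_sym (negbTE qp).
by rewrite sumr_const card_ord -[_ *+ _]mulr_natl mulVKf.
Qed.

End Pushforward.

Section Continuity.
Variables (R : realType) (n k m : nat).
Hypotheses (n_gt0 : (0 < n)%N) (m_gt0 : (0 < m)%N).
Variables (P : dprop R).
Hypothesis P_prop : is_dprop P.
Variable f : {ffun 'I_k.+1 * 'I_k.+1 -> bool} -> R.
Hypothesis f01 : forall y, 0 <= f y <= 1.

Definition col_weight (_ : 'I_n) : R := n%:R^-1.
Definition bit (x : bvec n) (j : 'I_n) : bool := x j.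
Definition accept (tau : {ffun bvec n -> R}) : R := acceptance f tau col_weight bit.
Definition test_idx : finType := ('I_k.+1 + 'I_k.+1)%type.
Definition sketch_idx : finType := idx test_idx (level_bound #|test_idx| (m ^ 2)).
Definition sketch (mu : {ffun bvec n -> R}) : {ffun sketch_idx * sketch_idx -> bool} -> R :=
  xlaw mu col_weight bit.

Lemma col_weight_dist : pdist col_weight.
Proof. exact: pdist_uniform. Qed.
Let u_dist := col_weight_dist.

Variables (eps' gamma : R).
Hypotheses (gamma_small : gamma <= 1 / 100)
  (accept_P : forall tau, P tau -> 2 / 3 - gamma <= accept tau)
  (accept_far : forall tau, is_dist tau -> eps' < dEMP P tau -> accept tau <= 1 / 3 + gamma).

Lemma sum_fst (T : finType) (J : bvec n * T -> R) b :
  \sum_(a | a.1 == b) J a = \sum_y J (b, y).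
Proof.
rewrite big_mkcond sum_pair /= (bigD1 b) //= [X in _ + X]big1 ?addr0; last first.
  by move=> a ab; rewrite (negbTE ab) big1.
by apply: eq_bigr => y _; rewrite eqxx.
Qed.

Lemma sum_snd (T : finType) (J : T * bvec n -> R) b :
  \sum_(a | a.2 == b) J a = \sum_x J (x, b).
Proof.
rewrite big_mkcond sum_pair /=; apply: eq_bigr => x _.
rewrite (bigD1 b) //= eqxx big1 ?addr0 // => y yb; by rewrite (negbTE yb).
Qed.

Lemma accept_snd (J : bvec n * bvec n -> R) (tau : {ffun bvec n -> R}) :
  (forall y, \sum_x J (x, y) = tau y) ->
  acceptance f J col_weight (fun o j => o.2 j) = accept tau.
Proof.
move=> hJ; rewrite /accept /acceptance /array_mean.
rewrite -(@sum_prod_pushforward R _ _ _ (fun o : bvec n * bvec n => o.2) J tau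
  (fun r => \sum_(c : {ffun 'I_k.+1 -> 'I_n}) (\prod_i col_weight (c i)) * f (xtests bit r c))).
  apply: eq_bigr => r _; congr (_ * _); apply: eq_bigr => c _; congr (_ * f _).
  by apply/ffunP => ij; rewrite !ffunE.
by move=> b; rewrite sum_snd.
Qed.

Lemma sketch_fst (T : {ffun bvec n * bvec n -> R}) (mu : {ffun bvec n -> R}) a :
  (forall x, \sum_y T (x, y) = mu x) ->
  xlaw T col_weight (fun o j => o.1 j) a = sketch mu a.
Proof.
move=> hT; rewrite /sketch /xlaw /array_law.
rewrite -(@sum_prod_pushforward R _ _ _ (fun o : bvec n * bvec n => o.1) T mu
  (fun r => \sum_(c : {ffun sketch_idx -> 'I_n}) (\prod_i col_weight (c i)) *
    (xarray bit r c == a)%:R)).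
  apply: eq_bigr => r _; congr (_ * _); apply: eq_bigr => c _; congr (_ * (_ == _)%:R).
  by apply/ffunP => ij; rewrite !ffunE.
by move=> b; rewrite sum_fst.
Qed.

Lemma entry_cost_transfer (T : {ffun bvec n * bvec n -> R}) :
  entry_cost T col_weight (fun o j => o.1 j) (fun o j => o.2 j) = transfer_cost T.
Proof.
apply: eq_bigr => o _; congr (_ * _); rewrite dHE big_distrr /=.
by apply: eq_bigr.
Qed.

(** A nearly optimal coupling of [mu] with a member of [P] is transplanted to [mu']. The new second
    marginal is accepted too often to be far from [P], and the triangle inequality concludes. *)
Lemma continuity (mu mu' : {ffun bvec n -> R}) (eta e : R) :
  is_dist mu -> is_dist mu' -> 0 < e ->
  \sum_a `|sketch mu a - sketch mu' a| <= eta ->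
  e + 101 * (2 / m%:R + eta) + 202 * ((#|test_idx| ^ 2)%:R / n%:R) <= 1 ->
  dEMP P mu' <= dEMP P mu + eps' +
    (e + 101 * (2 / m%:R + eta) + 202 * ((#|test_idx| ^ 2)%:R / n%:R)).
Proof.
move=> md md' e0 L1 small.
have [tau [T [Pt Tt cT]]] := dEMP_approx P_prop md e0.
have [Td [T1 T2]] := Tt.
set a := accept tau.
have T_dist : pdist T by [].
have aT : acceptance f T col_weight (fun o j => o.2 j) = a by apply: accept_snd.
have a01 : 0 <= a <= 1 by rewrite -aT; apply: acceptance01.
(* The weight 50 brings the deviation of acceptance below 1/5 later on; it yields the bound 101 = 1
   + 2 * 50 on [g]. *)
pose g := deviation f 50 a.
have gB v y : `|g v y| <= 101.
  have -> : 101 = 1 + 2 * 50 :> R by lra.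
  by apply: deviation_le.
have tt0 : (0 < #|test_idx|)%N by rewrite card_sum card_ord addSn.
have L1' : \sum_c `|xlaw (I := sketch_idx) T col_weight (fun o j => o.1 j) c
   - xlaw mu' col_weight bit c| <= eta.
  by apply: le_trans L1; apply: ler_sum => c _; rewrite (sketch_fst _ T1).
have j0 : 'I_n by exact: (Ordinal n_gt0).
have [J [Jd J1 hJ]] := @regenerate R test_idx m _ _ _ T mu' col_weight
  (fun o j => o.1 j) (fun o j => o.2 j) bit T_dist md' u_dist g 101 gB tt0 m_gt0
  [ffun=> false] j0 eta _ L1' (collision_le R test_idx n_gt0).
(* On the original coupling the squared term vanishes, [a] being the acceptance probability of [tau]
   itself. *)
have cv : coupling_value T col_weight (fun o j => o.1 j) (fun o j => o.2 j) g = transfer_cost T.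
  have := @deviation_mean R k f _ _ T col_weight (fun o j => o.1 j) (fun o j => o.2 j) T_dist u_dist 50 a.
  by rewrite aT subrr expr0n /= mulr0 addr0 entry_cost_transfer => <-.
pose Jf : {ffun bvec n * bvec n -> R} := [ffun p => J p].
pose tau' : {ffun bvec n -> R} := [ffun y => \sum_x J (x, y)].
have td' : is_dist tau'.
  have [J0 Js] := Jd; split=> [y|]; first by rewrite ffunE sumr_ge0.
  by under eq_bigr do rewrite ffunE; rewrite exchange_big /= -Js sum_pair.
have tr : transfer Jf mu' tau'.
  have [J0 Js] := Jd; split; [split|split].
  - by move=> p; rewrite ffunE.
  - by rewrite -Js; apply: eq_bigr => p _; rewrite ffunE.
  - by move=> x; rewrite -J1; apply: eq_bigr => y _; rewrite ffunE.
  - by move=> y; rewrite [RHS]ffunE; apply: eq_bigr => x _; rewrite ffunE.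
have tv : test_value col_weight bit g J = transfer_cost Jf + 50 * (accept tau' - a) ^+ 2.
  rewrite -entry_cost_transfer -(@accept_snd J tau'); last by move=> y; rewrite ffunE.
  have -> : entry_cost Jf col_weight (fun o j => o.1 j) (fun o j => o.2 j) =
     entry_cost J col_weight (fun o j => o.1 j) (fun o j => o.2 j).
    by apply: eq_bigr => o _; rewrite ffunE.
  rewrite -(deviation_mean f (fun (o : bvec n * bvec n) (j : 'I_n) => o.1 j)
    (fun (o : bvec n * bvec n) (j : 'I_n) => o.2 j) Jd u_dist 50 a).
  by rewrite /test_value weighted_exchange.
rewrite tv cv in hJ.
have c0 : 0 <= transfer_cost Jf by apply: transfer_cost_ge0; have [] := tr.
have D1 := dEMP_le1 P_prop md.
(* By [dEMP_le1] and [small] the right side of [hJ] is at most 2, and the weight of the square is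
   50. *)
have sq : (accept tau' - a) ^+ 2 <= 1 / 25 by lra.
(* Acceptance changes by at most 1/5, which is less than the gap 1/3 - 2 * gamma. *)
have close : 1 / 3 + gamma < accept tau'.
  have aux (b c gm : R) : gm <= 1 / 100 -> 2 / 3 - gm <= b -> (c - b) ^+ 2 <= 1 / 25 ->
      1 / 3 + gm < c.
    move=> h1 h2; rewrite expr2 => h3; rewrite ltNge; apply/negP => bad; nra.
  exact: aux gamma_small (accept_P Pt) sq.
have dt : dEMP P tau' <= eps'.
  rewrite leNgt; apply/negP => far; have := accept_far td' far; lra.
have := dEMP_triangle P_prop md' td' tr.
have sq0 : 0 <= (accept tau' - a) ^+ 2 by apply: sqr_ge0.
lra.
Qed.

End Continuity.

(** * Symmetrized testers *)

Section SeqMean.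
Variables (R : realType) (T : finType) (w : T -> R).

Fixpoint seq_mean (m : nat) (phi : seq T -> R) : R :=
  if m is m'.+1 then \sum_x w x * seq_mean m' (fun l => phi (x :: l)) else phi [::].

Lemma eq_seq_mean m (phi psi : seq T -> R) :
  (forall l, phi l = psi l) -> seq_mean m phi = seq_mean m psi.
Proof.
elim: m phi psi => [|m IH] phi psi h /=; first exact: h.
by apply: eq_bigr => x _; congr (_ * _); apply: IH => l; apply: h.
Qed.

Lemma seq_meanD m (phi psi : seq T -> R) :
  seq_mean m (fun l => phi l + psi l) = seq_mean m phi + seq_mean m psi.
Proof.
elim: m phi psi => [|m IH] phi psi //=; rewrite -big_split /=.
by apply: eq_bigr => x _; rewrite -mulrDr -IH.
Qed.

Lemma seq_meanZ m (a : R) (phi : seq T -> R) :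
  seq_mean m (fun l => a * phi l) = a * seq_mean m phi.
Proof.
elim: m phi => [|m IH] phi //=; rewrite big_distrr /=.
by apply: eq_bigr => x _; rewrite mulrCA -IH.
Qed.

Lemma seq_mean_sum m (I : finType) (phi : I -> seq T -> R) :
  seq_mean m (fun l => \sum_i phi i l) = \sum_i seq_mean m (phi i).
Proof.
elim: m phi => [|m IH] phi //=; rewrite exchange_big /=.
by apply: eq_bigr => x _; rewrite IH big_distrr.
Qed.

Lemma seq_mean_ffun m (phi : seq T -> R) :
  seq_mean m phi = \sum_(r : {ffun 'I_m -> T}) (\prod_i w (r i)) * phi (codom r).
Proof.
elim: m phi => [|m IH] phi /=.
  rewrite (big_pred1 [ffun i => match (i : 'I_0) with Ordinal k h => False_rect _ (notF h) end]).
    rewrite big_ord0 mul1r; congr phi; apply/esym/nilP.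
    by rewrite /nilp size_codom card_ord.
  by move=> r; apply/esym/eqP/ffunP => -[].
under eq_bigr do rewrite IH big_distrr /=.
pose h (xr : T * {ffun 'I_m -> T}) : {ffun 'I_m.+1 -> T} :=
  [ffun i => if unlift ord0 i is Some i' then xr.2 i' else xr.1].
rewrite pair_big (reindex h) /=; last first.
  exists (fun r : {ffun 'I_m.+1 -> T} => (r ord0, [ffun i => r (lift ord0 i)])).
    move=> [x r] _; congr pair; first by rewrite ffunE unlift_none.
    by apply/ffunP => i; rewrite !ffunE liftK.
  move=> r _; apply/ffunP => i; rewrite ffunE.
  by case: unliftP => [j ->|->] /=; rewrite ?ffunE.
apply: eq_bigr => -[x r] _ /=.
rewrite mulrA big_ord_recl /= ffunE unlift_none /=; congr (_ * _ * _).
  by apply: eq_bigr => i _; rewrite ffunE liftK.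
congr phi; rewrite /codom /image_mem enum_ordSl /= ffunE unlift_none /= -map_comp.
by congr (_ :: _); apply: eq_map => i /=; rewrite ffunE liftK.
Qed.

Hypothesis w_dist : pdist w.

Lemma seq_mean_ge m (b : R) (phi : seq T -> R) :
  (forall l, b <= phi l) -> b <= seq_mean m phi.
Proof.
elim: m phi => [|m IH] phi h /=; first exact: h.
by apply: weighted_sum_ge => // x; apply: IH.
Qed.

Lemma seq_mean_le m (b : R) (phi : seq T -> R) :
  (forall l, phi l <= b) -> seq_mean m phi <= b.
Proof.
elim: m phi => [|m IH] phi h /=; first exact: h.
by apply: weighted_sum_le => // x; apply: IH.
Qed.

Lemma le_seq_mean m (phi psi : seq T -> R) :
  (forall l, phi l <= psi l) -> seq_mean m phi <= seq_mean m psi.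
Proof.
elim: m phi psi => [|m IH] phi psi h /=; first exact: h.
by apply: le_weighted_sum => x; [have [] := w_dist | apply: IH].
Qed.

Lemma seq_mean_cst m (a : R) : seq_mean m (fun=> a) = a.
Proof. by apply/le_anti; rewrite seq_mean_le // seq_mean_ge. Qed.

End SeqMean.

Section Runs.
Variables (R : realType) (n : nat) (S : bool -> bool).
Local Notation alg := (halg R n bool).

(** [HSample] is transparent because all rows are drawn in advance, row [i] being the [i]-th
    sample. *)
Fixpoint run (c : nat) (A : alg c) (rows : nat -> bvec n) : R :=
  match A with
  | HRet _ v => if S v then 1 else 0
  | HSample _ A' => run A' rows
  | HQuery _ i j k => run (k (rows i j)) rows
  | HCoin _ p k => clamp01 p * run (k true) rows + (1 - clamp01 p) * run (k false) rows
  end.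

(* L lists the coordinates queried so far; the t-th new one reads column t of B. *)
Fixpoint lazy_run (c : nat) (A : alg c) (L : seq 'I_n) (B : nat -> nat -> bool) : R :=
  match A with
  | HRet _ v => if S v then 1 else 0
  | HSample _ A' => lazy_run A' L B
  | HQuery _ i j k =>
      let L' := if j \in L then L else rcons L j in
      lazy_run (k (B i (index j L'))) L' B
  | HCoin _ p k => clamp01 p * lazy_run (k true) L B +
                   (1 - clamp01 p) * lazy_run (k false) L B
  end.

Lemma clamp01_bounds (p : R) : 0 <= clamp01 p <= 1.
Proof. by rewrite /clamp01 le_min ge_min lexx le_max lexx ler01. Qed.

Lemma convex_bounds (p x y : R) : 0 <= x <= 1 -> 0 <= y <= 1 ->
  0 <= clamp01 p * x + (1 - clamp01 p) * y <= 1.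
Proof.
move=> /andP[x0 x1] /andP[y0 y1]; have /andP[p0 p1] := clamp01_bounds p.
by apply/andP; split; nra.
Qed.

Lemma lazy_run_bounds c (A : alg c) L B : 0 <= lazy_run A L B <= 1.
Proof.
elim: A L => [c0 v|c0 A IH|c0 i j k IH|c0 p k IH] L //=.
  by case: (S v); rewrite ?lexx ?ler01.
exact: convex_bounds.
Qed.

Definition zero_row : bvec n := [ffun=> false].
Definition rows_of (l : seq (bvec n)) : nat -> bvec n := nth zero_row l.

(** Samples are independent of the execution, so [m] of them can be drawn beforehand; those that are
    never requested integrate out. *)
Lemma hprob_seq_mean (mu : {ffun bvec n -> R}) c (A : alg c) (xs : 'I_c -> bvec n) m :
  pdist mu -> (nsamples A <= m)%N ->
  hprob mu S A xs = seq_mean mu m (fun l => run A (rows_of ([seq xs i | i <- enum 'I_c] ++ l))).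
Proof.
move=> md; elim: A xs m => [c0 v|c0 A IH|c0 i j k IH|c0 p k IH] xs m /= hm.
- by rewrite seq_mean_cst.
- case: m hm => // m hm /=; apply: eq_bigr => x _; congr (_ * _).
  rewrite (IH _ m hm); apply: eq_seq_mean => l.
  suff -> : [seq ext_samples xs x i | i <- enum 'I_c0.+1] = rcons [seq xs i | i <- enum 'I_c0] x.
    by rewrite cat_rcons.
  rewrite enum_ordSr map_rcons; congr rcons; last by rewrite /ext_samples unlift_none.
  rewrite -map_comp; apply: eq_map => i /=; rewrite /ext_samples.
  have -> : widen_ord (leqnSn c0) i = lift ord_max i by apply: val_inj; rewrite /= /bump leqNgt ltn_ord.
  by rewrite liftK.
- have hm' b : (nsamples (k b) <= m)%N.
    by apply: leq_trans hm; case: b; rewrite ?leq_maxl ?leq_maxr.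
  rewrite (IH _ _ m (hm' _)); apply: eq_seq_mean => l.
  suff -> : rows_of ([seq xs i | i <- enum 'I_c0] ++ l) i = xs i by [].
  rewrite /rows_of nth_cat size_map size_enum_ord ltn_ord (nth_map i) ?size_enum_ord //.
  by rewrite nth_ord_enum.
- have hm' b : (nsamples (k b) <= m)%N.
    by apply: leq_trans hm; case: b; rewrite ?leq_maxl ?leq_maxr.
  by rewrite seq_meanD !seq_meanZ -!IH.
Qed.

Lemma seq_mean_dperm (pi : {perm 'I_n}) (mu : {ffun bvec n -> R}) m phi :
  seq_mean (dperm pi mu) m phi = seq_mean mu m (fun l => phi [seq permute pi x | x <- l]).
Proof.
elim: m phi => [|m IH] phi //=.
rewrite (reindex_inj (@permute_inj n pi)) /=; apply: eq_bigr => x _.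
by rewrite dperm_permute IH.
Qed.

Lemma rows_of_permute (pi : {perm 'I_n}) l i :
  rows_of [seq permute pi x | x <- l] i = permute pi (rows_of l i).
Proof.
rewrite /rows_of; case: (ltnP i (size l)) => h; first by rewrite (nth_map zero_row).
rewrite !nth_default ?size_map //; by apply/ffunP => j; rewrite !ffunE.
Qed.

Lemma Pr_dperm (pi : {perm 'I_n}) (mu : {ffun bvec n -> R}) (A : alg 0) m :
  is_dist mu -> (nsamples A <= m)%N ->
  Pr (dperm pi mu) A S =
  seq_mean mu m (fun l => run A (fun i => permute pi (rows_of l i))).
Proof.
move=> md hm; have dd : pdist (dperm pi mu) by apply: dperm_dist.
rewrite /Pr (hprob_seq_mean _ dd hm) seq_mean_dperm; apply: eq_seq_mean => l.
rewrite enum_ord0 /=.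
have e : forall c (B : alg c) (r r' : nat -> bvec n), (forall i, r i = r' i) -> run B r = run B r'.
  move=> c; elim=> [c0 v|c0 B IH|c0 i j k IH|c0 p k IH] r r' h //=; first exact: IH.
    by rewrite h; apply: IH.
  by rewrite (IH true _ _ h) (IH false _ _ h).
by apply: e => i; apply: rows_of_permute.
Qed.
End Runs.

Section Symmetrize.
Variables (R : realType) (n : nat).
Hypothesis n_gt0 : (0 < n)%N.
Local Notation alg := (halg R n bool).
Local Notation colw := (fun _ : 'I_n => n%:R^-1 : R).

Definition read_cols (rows : nat -> bvec n) (C : seq 'I_n) (i j : nat) : bool :=
  nth false [seq rows i c | c <- C] j.

Definition extends (L C : seq 'I_n) (pi : {perm 'I_n}) : bool := [seq pi j | j <- L] == C.

Lemma extends_rcons L C j c pi :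
  extends (rcons L j) (rcons C c) pi = extends L C pi && (pi j == c).
Proof. by rewrite /extends map_rcons eqseq_rcons. Qed.

Definition num_ext L C : R := \sum_(pi | extends L C pi) 1.

Lemma num_ext_const L C j c c' : c \notin C -> c' \notin C ->
  num_ext (rcons L j) (rcons C c) = num_ext (rcons L j) (rcons C c').
Proof.
move=> cC c'C; rewrite /num_ext (reindex_inj (mulIg (tperm c c'))) /=.
apply: eq_bigl => pi; rewrite !extends_rcons permM.
have -> : (tperm c c' (pi j) == c) = (pi j == c').
  by rewrite -{2}(tpermR c c') (inj_eq perm_inj).
have t_id (D : seq 'I_n) : c \notin D -> c' \notin D -> [seq tperm c c' d | d <- D] = D.
  move=> h h'; rewrite -[RHS]map_id; apply/eq_in_map => d dD.
  by rewrite tpermD //; apply: contraTneq dD => <-.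
congr (_ && _); rewrite /extends; apply/eqP/eqP => h.
  have h2 : [seq pi x | x <- L] = [seq tperm c c' d | d <- C].
    by rewrite -h -map_comp; apply: eq_map => x /=; rewrite permM tpermK.
  by rewrite h2 t_id.
have -> : [seq (pi * tperm c c')%g x | x <- L] = [seq tperm c c' d | d <- C].
  by rewrite -h -map_comp; apply: eq_map => x /=; rewrite permM.
by rewrite t_id.
Qed.

Lemma sum_extends L C j (F : {perm 'I_n} -> R) : j \notin L ->
  \sum_(pi | extends L C pi) F pi =
  \sum_(c | c \notin C) \sum_(pi | extends (rcons L j) (rcons C c) pi) F pi.
Proof.
move=> jL; rewrite (partition_big (fun pi : {perm 'I_n} => pi j) (fun c => c \notin C)) /=.
  by apply: eq_bigr => c _; apply: eq_bigl => pi; rewrite extends_rcons.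
move=> pi /eqP <-; apply: contra jL => /mapP[x xL /perm_inj ->] //.
Qed.

Lemma card_notin (C : seq 'I_n) : uniq C -> #|[pred c | c \notin C]| = (n - size C)%N.
Proof.
move=> uC; have := cardC (mem C); rewrite card_ord (card_uniqP uC) => e.
have -> : (n - size C)%N = (size C + #|[predC C]| - size C)%N by rewrite e.
by rewrite addKn; apply: eq_card.
Qed.

Lemma num_ext_ge0 L C : 0 <= num_ext L C. Proof. exact: sumr_ge0. Qed.

(* Averaging over permutations, new coordinates are sent to uniform fresh
   columns; allowing repetitions costs at most Q / n for each query. *)
Lemma perm_average S (Q cs : nat) (A : alg cs) (rows : nat -> bvec n) (L C : seq 'I_n) k :
  (nqueries A <= k)%N -> (size C + k <= Q)%N -> uniq L -> uniq C -> size L = size C ->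
  \sum_(pi | extends L C pi) run S A (fun i => permute pi (rows i)) <=
  num_ext L C * (seq_mean colw k (fun l => lazy_run S A L (read_cols rows (C ++ l)))
    + k%:R * (Q%:R / n%:R)).
Proof.
have nR : 0 < n%:R :> R by rewrite ltr0n.
have ud := pdist_uniform R n_gt0.
have q0 : 0 <= Q%:R / n%:R :> R by rewrite divr_ge0.
elim: A L C k => [c v|c A IH|c i j kk IH|c p kk IH] L C k /= hk hQ uL uC sLC.
- rewrite seq_mean_cst //; set b := if S v then 1 else 0.
  have -> : \sum_(pi | extends L C pi) b = num_ext L C * b.
    by rewrite /num_ext big_distrl /=; apply: eq_bigr => pi _; rewrite mul1r.
  by rewrite ler_wpM2l ?num_ext_ge0 // lerDl mulr_ge0.
- exact: IH.
- have hk' b : (nqueries (kk b) < k)%N.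
    by apply: leq_trans hk; rewrite ltnS; case: b; rewrite ?leq_maxl ?leq_maxr.
  case: (boolP (j \in L)) => jL.
    pose b := rows i (nth j C (index j L)).
    have iC : (index j L < size C)%N by rewrite -sLC index_mem.
    rewrite (eq_bigr (fun pi => run S (kk b) (fun i => permute pi (rows i)))); last first.
      move=> pi /eqP e; congr (run S (kk _)); rewrite ffunE /b -e (nth_map j) ?index_mem //.
      by rewrite nth_index.
    apply: (le_trans (IH b L C k (ltnW (hk' b)) hQ uL uC sLC)).
    rewrite le_eqVlt; apply/orP; left; apply/eqP; congr (_ * (_ + _)).
    apply: eq_seq_mean => l; congr (lazy_run S (kk _)).
    by rewrite /read_cols (nth_map j) ?size_cat ?ltn_addr // nth_cat iC.
  case: k hk hQ hk' => // k _ hQ hk' /=.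
  rewrite (sum_extends C _ jL).
  have idx c0 l : read_cols rows (C ++ c0 :: l) i (index j (rcons L j)) = rows i c0.
    rewrite /read_cols -cats1 index_cat (negbTE jL) /= eqxx addn0 sLC.
    by rewrite (nth_map j) ?size_cat /= ?addnS ?ltnS ?leq_addr // nth_cat ltnn subnn.
  pose e (c0 : 'I_n) : R := seq_mean colw k (fun l =>
     lazy_run S (kk (rows i c0)) (rcons L j) (read_cols rows (rcons C c0 ++ l))).
  have e01 c0 : 0 <= e c0 <= 1.
    apply/andP; split; [apply: seq_mean_ge => // l | apply: seq_mean_le => // l].
      by have /andP[] := lazy_run_bounds S (kk (rows i c0)) (rcons L j) (read_cols rows (rcons C c0 ++ l)).
    by have /andP[] := lazy_run_bounds S (kk (rows i c0)) (rcons L j) (read_cols rows (rcons C c0 ++ l)).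
  have -> : \sum_x n%:R^-1 * seq_mean colw k (fun l =>
       lazy_run S (kk (read_cols rows (C ++ x :: l) i (index j (rcons L j)))) (rcons L j)
         (read_cols rows (C ++ x :: l))) = n%:R^-1 * \sum_x e x.
    rewrite big_distrr /=; apply: eq_bigr => x _; congr (_ * _).
    by apply: eq_seq_mean => l; rewrite idx cat_rcons.
  pose er : R := k%:R * (Q%:R / n%:R).
  have step c0 : c0 \notin C ->
      \sum_(pi | extends (rcons L j) (rcons C c0) pi) run S (kk (permute pi (rows i) j))
         (fun i => permute pi (rows i)) <= num_ext (rcons L j) (rcons C c0) * (e c0 + er).
    move=> cC.
    rewrite (eq_bigr (fun pi => run S (kk (rows i c0)) (fun i => permute pi (rows i)))); last first.
      by move=> pi; rewrite extends_rcons => /andP[_ /eqP <-]; rewrite ffunE.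
    apply: IH; rewrite ?rcons_uniq ?jL ?cC ?size_rcons ?sLC //.
      by rewrite -ltnS; apply: hk'.
    by rewrite addSn -addnS.
  apply: (le_trans (ler_sum _ step)).
  have sz : (size C <= n)%N.
    by rewrite -[n in (_ <= n)%N]card_ord cardE; apply: uniq_leq_size => // x _; rewrite mem_enum.
  have [[c1 c1C]|noc] := pselect (exists c1, c1 \notin C); last first.
    (* If [C] already contains every column, the left side is an empty sum. *)
    rewrite big1 => [|c0 cC]; last by case: noc; exists c0.
    rewrite mulr_ge0 ?num_ext_ge0 // addr_ge0 ?mulr_ge0 ?invr_ge0 //.
    by apply: sumr_ge0 => c0 _; have /andP[] := e01 c0.
  pose g : R := num_ext (rcons L j) (rcons C c1).
  have g0 : 0 <= g by apply: num_ext_ge0.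
  have -> : \sum_(c0 | c0 \notin C) num_ext (rcons L j) (rcons C c0) * (e c0 + er) =
     g * \sum_(c0 | c0 \notin C) (e c0 + er).
    by rewrite big_distrr /=; apply: eq_bigr => c0 cC; rewrite (num_ext_const L j cC c1C).
  have cnt (a : R) : \sum_(c0 | c0 \notin C) a = (n%:R - (size C)%:R) * a.
    by rewrite sumr_const card_notin // -[_ *+ _]mulr_natl natrB.
  have -> : num_ext L C = g * (n%:R - (size C)%:R).
    rewrite /num_ext (sum_extends C _ jL) -/(num_ext _ _).
    rewrite (eq_bigr (fun=> g)) => [|c0 cC]; last exact: num_ext_const.
    by rewrite cnt mulrC.
  rewrite -mulrA ler_wpM2l // big_split /= cnt.
  set s0 := \sum_(c0 | c0 \notin C) e c0.
  set s1 := \sum_x e x.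
  have s01 : s0 <= s1.
    rewrite /s1 (bigID (fun c0 => c0 \notin C)) /= lerDl; apply: sumr_ge0 => c0 _.
    by have /andP[] := e01 c0.
  have s0n : s0 <= n%:R - (size C)%:R.
    rewrite -[leRHS]mulr1 -cnt; apply: ler_sum => c0 _; by have /andP[] := e01 c0.
  have sQ : (size C)%:R <= Q%:R :> R by rewrite ler_nat (leq_trans _ hQ) // leq_addr.
  have szR : (size C)%:R <= n%:R :> R by rewrite ler_nat.
  have c0R : 0 <= (size C)%:R :> R by [].
  have -> : k.+1%:R * (Q%:R / n%:R) = k%:R * (Q%:R / n%:R) + Q%:R / n%:R :> R.
    by rewrite -natr1 mulrDl mul1r.
  rewrite /er.
  move: (k%:R * (Q%:R / n%:R)) => er'.
  (* After multiplication by n, write n s0 = (n - |C|) s0 + |C| s0, and use s0 <= s1 in the first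
     term and s0 <= n - |C| in the second. *)
  have key : s0 <= (n%:R - (size C)%:R) * (n%:R^-1 * s1 + (size C)%:R / n%:R).
    have -> : (n%:R - (size C)%:R) * (n%:R^-1 * s1 + (size C)%:R / n%:R) =
      n%:R^-1 * ((n%:R - (size C)%:R) * (s1 + (size C)%:R)) by ring.
    rewrite -ler_pdivrMl ?invr_gt0 // invrK.
    move: (n%:R) (size C)%:R s0 s1 s01 s0n szR c0R => N' D x y; nra.
  have k2 : (n%:R - (size C)%:R) * ((size C)%:R / n%:R) <= (n%:R - (size C)%:R) * (Q%:R / n%:R) :> R.
    by rewrite ler_wpM2l ?subr_ge0 // ler_wpM2r ?invr_ge0.
  rewrite !mulrDr in key *; lra.
- have hk' b : (nqueries (kk b) <= k)%N.
    by apply: leq_trans hk; case: b; rewrite ?leq_maxl ?leq_maxr.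
  rewrite big_split /= -!big_distrr /= seq_meanD !seq_meanZ.
  have h1 := IH true L C k (hk' true) hQ uL uC sLC.
  have h2 := IH false L C k (hk' false) hQ uL uC sLC.
  have /andP[p0 p1] := clamp01_bounds p.
  have l1 := ler_wpM2l p0 h1.
  have l2 := ler_wpM2l (_ : 0 <= 1 - clamp01 p) h2.
  rewrite subr_ge0 in l2; apply: (le_trans (lerD l1 (l2 p1))).
  by rewrite le_eqVlt; apply/orP; left; apply/eqP; ring.
Qed.

End Symmetrize.

Section TesterAcceptance.
Variables (R : realType) (n k : nat).
Hypothesis n_gt0 : (0 < n)%N.
Variable A : halg R n bool 0.
Hypotheses (nsA : (nsamples A <= k.+1)%N) (nqA : (nqueries A <= k.+1)%N).
Let K := k.+1.

(** The value [false] out of range agrees with the defaults of [read_cols] and [rows_of], so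
    [accept_lazy] compares the two arrays at all indices. *)
Definition padded (y : {ffun 'I_k.+1 * 'I_k.+1 -> bool}) (i j : nat) : bool :=
  if (insub i : option 'I_k.+1) is Some i' then
    if (insub j : option 'I_k.+1) is Some j' then y (i', j') else false
  else false.

Definition test_fun (y : {ffun 'I_k.+1 * 'I_k.+1 -> bool}) : R :=
  lazy_run id A [::] (padded y).

Definition lazy_accept (S : bool -> bool) (tau : {ffun bvec n -> R}) : R :=
  seq_mean tau K (fun r => seq_mean (col_weight R (n:=n)) K
    (fun c => lazy_run S A [::] (read_cols (rows_of r) c))).

Lemma test_fun01 y : 0 <= test_fun y <= 1. Proof. exact: lazy_run_bounds. Qed.

Lemma eq_lazy_run S c (B : halg R n bool c) L f g : (forall i j, f i j = g i j) ->
  lazy_run S B L f = lazy_run S B L g :> R.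
Proof.
move=> fg; elim: B L => [c0 v|c0 B IH|c0 i j h IH|c0 p h IH] L //=.
  by rewrite fg; apply: IH.
by rewrite !IH.
Qed.

Lemma nth_codom (T : Type) (x0 : T) m (r : {ffun 'I_m -> T}) i :
  nth x0 (codom r) i = if (insub i : option 'I_m) is Some i' then r i' else x0.
Proof.
case: insubP => [i' lt e|]; last by rewrite -leqNgt => h; rewrite nth_default ?size_codom ?card_ord.
rewrite (nth_map i') ?size_enum_ord //; congr (r _); apply: val_inj.
by rewrite /= nth_enum_ord.
Qed.

Lemma accept_lazy tau : accept (n := n) test_fun tau = lazy_accept id tau.
Proof.
rewrite /lazy_accept seq_mean_ffun; apply: eq_bigr => r _; congr (_ * _).
rewrite seq_mean_ffun; apply: eq_bigr => c _; congr (_ * _).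
apply: eq_lazy_run => i j; rewrite /padded /read_cols /rows_of.
have -> : [seq nth (zero_row n) (codom r) i c0 | c0 <- codom c] =
   codom [ffun j' => nth (zero_row n) (codom r) i (c j')].
  by rewrite /codom /image_mem -map_comp; apply: eq_map => j' /=; rewrite ffunE.
rewrite !nth_codom; case: insubP => [i' _ _|_].
  by case: insubP => // j1 _ _; rewrite !ffunE.
by case: insub => // j1; rewrite !ffunE.
Qed.

Lemma lazy_run_compl c (B : halg R n bool c) L f :
  lazy_run id B L f + lazy_run negb B L f = 1 :> R.
Proof.
elim: B L => [c0 v|c0 B IH|c0 i j h IH|c0 p h IH] L //=.
  by case: v; rewrite /= ?addr0 ?add0r.
by rewrite addrACA -!mulrDr !IH; ring.
Qed.

Lemma lazy_accept_compl tau : is_dist tau -> lazy_accept id tau + lazy_accept negb tau = 1.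
Proof.
move=> td; rewrite /lazy_accept -seq_meanD.
rewrite (eq_seq_mean _ _ (psi := fun=> 1)) ?seq_mean_cst // => r.
rewrite -seq_meanD (eq_seq_mean _ _ (psi := fun=> 1)) ?seq_mean_cst //.
  exact: col_weight_dist.
by move=> c; apply: lazy_run_compl.
Qed.

(** A one-sided estimate suffices: it is used with [id] on [P] and with [negb] far from [P], and
    [lazy_accept_compl] turns the latter into an upper bound on acceptance. *)
Lemma lazy_accept_ge S tau (b : R) : is_dist tau ->
  (forall pi, b <= Pr (dperm pi tau) A S) ->
  b - K%:R * (K%:R / n%:R) <= lazy_accept S tau.
Proof.
move=> td h.
set M : R := \sum_(pi : {perm 'I_n}) 1.
have M0 : 0 < M by rewrite /M (bigD1 1%g) //=; apply: ltr_pwDl => //; apply: sumr_ge0.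
have avg : M * b <= M * (lazy_accept S tau + K%:R * (K%:R / n%:R)).
  rewrite {1}/M big_distrl /=.
  apply: (@le_trans _ _ (\sum_(pi : {perm 'I_n}) Pr (dperm pi tau) A S)).
    by apply: ler_sum => pi _; rewrite mul1r.
  under eq_bigr => pi _ do rewrite (Pr_dperm S pi td nsA).
  rewrite -seq_mean_sum.
  have -> : M * (lazy_accept S tau + K%:R * (K%:R / n%:R)) =
    seq_mean tau K (fun r => M * (seq_mean (col_weight R (n:=n)) K
      (fun c => lazy_run S A [::] (read_cols (rows_of r) c)) + K%:R * (K%:R / n%:R))).
    by rewrite seq_meanZ seq_meanD seq_mean_cst.
  apply: le_seq_mean => // r.
  have := @perm_average R n n_gt0 S K 0 A (rows_of r) [::] [::] K nqA (leqnn _) isT isT erefl.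
  rewrite /num_ext /= => pa; apply: le_trans pa.
  by rewrite le_eqVlt; apply/orP; left; apply/eqP; apply: eq_bigl.
rewrite ler_pM2l // in avg; lra.
Qed.

Variables (P : dprop R) (eps' : R).
Hypotheses (P_prop : is_dprop P) (P_inv : index_invariant P) (tA : is_tester P eps' A).
Let gamma : R := K%:R * (K%:R / n%:R).

Lemma tester_accept_P tau : P tau -> 2 / 3 - gamma <= accept (n := n) test_fun tau.
Proof.
move=> Pt; rewrite accept_lazy; apply: lazy_accept_ge; first exact: (P_dist P_prop).
by move=> pi; have [h _] := tA; apply: h; apply: dperm_in.
Qed.

Lemma tester_accept_far tau : is_dist tau -> eps' < dEMP P tau ->
  accept (n := n) test_fun tau <= 1 / 3 + gamma.
Proof.
move=> td far; rewrite accept_lazy.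
have h : 2 / 3 - gamma <= lazy_accept negb tau.
  apply: lazy_accept_ge => // pi; have [_ h] := tA; apply: h; first exact: dperm_dist.
  by apply: (lt_le_trans far); apply: dEMP_dperm.
have := lazy_accept_compl td; rewrite /gamma in h *; lra.
Qed.

End TesterAcceptance.

(** * Sampling the sketch *)

Section Sampler.
Variables (R : realType) (n : nat) (O : Type).
Hypothesis n_gt0 : (0 < n)%N.
Local Notation alg := (halg R n O).

Fixpoint query_row (c : nat) (i : 'I_c) (cols : seq 'I_n) (k : seq bool -> alg c) : alg c :=
  if cols is j :: cols' then
    HQuery i j (fun b => query_row i cols' (fun l => k (b :: l)))
  else k [::].

(** The number of samples is an index of the type of algorithms and grows with every row, so the
    continuation is polymorphic in [c]. *)
Fixpoint sample_rows (m : nat) (cols : seq 'I_n)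
    (k : seq (seq bool) -> forall c, alg c) (c : nat) : alg c :=
  if m is m'.+1 then
    HSample (query_row ord_max cols
      (fun b => sample_rows m' cols (fun l => k (b :: l)) c.+1))
  else k [::] c.

(** A sequential uniform choice: the head is taken with probability one over the length of the
    remaining list, so the last coin is certain. [d] only serves the empty list. *)
Fixpoint pick_from (c : nat) (s : seq 'I_n) (d : 'I_n) (k : 'I_n -> alg c) : alg c :=
  if s is j :: s' then
    HCoin (size s)%:R^-1 (fun b => if b then k j else pick_from s' d k)
  else k d.

Fixpoint pick_cols (c m : nat) (k : seq 'I_n -> alg c) : alg c :=
  if m is m'.+1 then
    pick_from (enum 'I_n) (Ordinal n_gt0) (fun j => pick_cols m' (fun l => k (j :: l)))
  else k [::].

Section Semantics.
Variables (mu : {ffun bvec n -> R}) (S : O -> bool).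
Local Notation colw := (fun _ : 'I_n => n%:R^-1 : R).

Lemma hprob_query_row c i cols (k : seq bool -> alg c) xs :
  hprob mu S (query_row i cols k) xs = hprob mu S (k [seq xs i j | j <- cols]) xs.
Proof. by elim: cols k => [|j cols IH] k //=; rewrite IH. Qed.

Lemma hprob_sample_rows m cols k (phi : seq (seq bool) -> R) c xs :
  (forall l c xs, hprob mu S (k l c) xs = phi l) ->
  hprob mu S (sample_rows m cols k c) xs =
  seq_mean mu m (fun rows : seq (bvec n) => phi [seq [seq x j | j <- cols] | x : bvec n <- rows]).
Proof.
elim: m k phi c xs => [|m IH] k phi c xs hk /=; first exact: hk.
apply: eq_bigr => x _; congr (_ * _); rewrite hprob_query_row.
rewrite (IH _ (fun l => phi ([seq x j | j <- cols] :: l))) // => l c' xs'.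
rewrite hk; congr (phi (_ :: _)); apply: eq_map => j.
by rewrite /ext_samples unlift_none.
Qed.

Lemma hprob_pick_from c s d (k : 'I_n -> alg c) xs : (0 < size s)%N ->
  hprob mu S (pick_from s d k) xs = (size s)%:R^-1 * \sum_(j <- s) hprob mu S (k j) xs.
Proof.
elim: s => // j s IH _; rewrite big_cons /=.
have -> : clamp01 ((size s).+1%:R^-1 : R) = (size s).+1%:R^-1.
  rewrite /clamp01 max_r ?invr_ge0 // min_r //.
  by rewrite invf_le1 ?ltr0n // ler1n.
rewrite mulrDr; congr (_ + _); case: s IH => [|j' s] IH.
  by rewrite big_nil mulr0 invr1 subrr mul0r.
rewrite (IH isT) mulrA; congr (_ * _) => /=.
have key (y : R) : y != 0 -> y + 1 != 0 -> (1 - (y + 1)^-1) * y^-1 = (y + 1)^-1.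
  by move=> h1 h2; field; rewrite h1 h2.
by rewrite -[(size s).+2%:R]natr1; apply: key; rewrite ?natr1 pnatr_eq0.
Qed.

Lemma hprob_pick_cols m c (k : seq 'I_n -> alg c) xs :
  hprob mu S (pick_cols m k) xs = seq_mean colw m (fun l => hprob mu S (k l) xs).
Proof.
elim: m k => [|m IH] k //=.
rewrite hprob_pick_from size_enum_ord // big_enum /= big_distrr /=.
by apply: eq_bigr => j _; rewrite IH.
Qed.
End Semantics.

Lemma nqueries_query_row c (i : 'I_c) cols (k : seq bool -> alg c) q :
  (forall l, nqueries (k l) <= q)%N -> (nqueries (query_row i cols k) <= size cols + q)%N.
Proof.
elim: cols k => [|j cols IH] k hk /=; first exact: hk.
by rewrite addSn ltnS geq_max !IH.
Qed.

Lemma nqueries_sample_rows m cols k c q :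
  (forall l c, nqueries (k l c) <= q)%N ->
  (nqueries (sample_rows m cols k c) <= m * size cols + q)%N.
Proof.
elim: m k c => [|m IH] k c hk /=; first exact: hk.
by rewrite mulSn -addnA; apply: nqueries_query_row => l; apply: IH.
Qed.

Lemma nqueries_pick_from c s d (k : 'I_n -> alg c) q :
  (forall j, nqueries (k j) <= q)%N -> (nqueries (pick_from s d k) <= q)%N.
Proof. by move=> hk; elim: s => [|j s IH] //=; rewrite geq_max IH hk. Qed.

Lemma nqueries_pick_cols c m (k : seq 'I_n -> alg c) q :
  (forall l, size l = m -> nqueries (k l) <= q)%N -> (nqueries (pick_cols m k) <= q)%N.
Proof.
elim: m k => [|m IH] k hk /=; first exact: hk.
by apply: nqueries_pick_from => j; apply: IH => l sl; apply: hk; rewrite /= sl.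
Qed.

Variable I : finType.
Local Notation array := {ffun I * I -> bool}.

Definition decode (d : seq (seq bool)) : array :=
  [ffun ij => nth false (nth [::] d (enum_rank ij.1)) (enum_rank ij.2)].

Definition draw_array (k : array -> forall c, alg c) (c : nat) : alg c :=
  pick_cols #|I| (fun cols => sample_rows #|I| cols (fun d => k (decode d)) c).

Fixpoint draw_arrays (N : nat) (k : seq array -> forall c, alg c) (c : nat) : alg c :=
  if N is N'.+1 then draw_array (fun a => draw_arrays N' (fun l => k (a :: l))) c
  else k [::] c.

Lemma nqueries_draw_arrays N k c q : (forall l c, nqueries (k l c) <= q)%N ->
  (nqueries (draw_arrays N k c) <= N * (#|I| * #|I|) + q)%N.
Proof.
elim: N k c => [|N IH] k c hk /=; first exact: hk.
apply: nqueries_pick_cols => cols sc; rewrite mulSn -addnA.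
have h := @nqueries_sample_rows #|I| cols (fun d => draw_arrays N (fun l => k (decode d :: l)))
  c (N * (#|I| * #|I|) + q).
by rewrite sc in h; apply: h => d c'; apply: IH.
Qed.

Section ArraySemantics.
Variables (mu : {ffun bvec n -> R}) (S : O -> bool).
Hypothesis mu_dist : pdist mu.
Local Notation colw := (fun _ : 'I_n => n%:R^-1 : R).
Local Notation bit := (fun (x : bvec n) (j : 'I_n) => x j).

Lemma hprob_draw_array k (phi : array -> R) c xs :
  (forall a c xs, hprob mu S (k a c) xs = phi a) ->
  hprob mu S (draw_array k c) xs = \sum_a xlaw mu colw bit a * phi a.
Proof.
move=> hk; rewrite /draw_array hprob_pick_cols.
transitivity (seq_mean colw #|I| (fun cols => seq_mean mu #|I| (fun rows : seq (bvec n) =>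
   phi (decode [seq [seq x j | j <- cols] | x : bvec n <- rows])))).
  apply: eq_seq_mean => cols.
  by rewrite (hprob_sample_rows _ _ (phi := fun d => phi (decode d))).
rewrite sum_array_law seq_mean_ffun weighted_exchange.
have eI : injective (@enum_rank I) by exact: enum_rank_inj.
rewrite -(@sum_prod_weight_inj R _ _ _ _ colw (fun c => \sum_(r : {ffun I -> bvec n})
   (\prod_i mu (r i)) * phi (xarray bit r c)) eI (pdist_uniform R n_gt0)).
apply: eq_bigr => cols _; congr (_ * _).
rewrite seq_mean_ffun.
rewrite -(@sum_prod_weight_inj R _ _ _ _ mu (fun r =>
   phi (xarray bit r [ffun j => cols (enum_rank j)])) eI mu_dist).
apply: eq_bigr => rows _; congr (_ * phi _); apply/ffunP => -[i j]; rewrite !ffunE /=.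
rewrite (nth_map (zero_row n)) ?size_codom ?card_ord //.
have cdE (T : Type) (r : {ffun 'I_#|I| -> T}) x0 (i0 : 'I_#|I|) : nth x0 (codom r) i0 = r i0.
  by rewrite (nth_map i0) ?size_enum_ord // nth_ord_enum.
rewrite (nth_map (Ordinal n_gt0)) ?size_codom ?card_ord //.
by rewrite !cdE.
Qed.

Lemma hprob_draw_arrays N k (phi : seq array -> R) c xs :
  (forall l c xs, hprob mu S (k l c) xs = phi l) ->
  hprob mu S (draw_arrays N k c) xs = seq_mean (xlaw mu colw bit) N phi.
Proof.
elim: N k phi c xs => [|N IH] k phi c xs hk /=; first exact: hk.
rewrite (hprob_draw_array (phi := fun a => seq_mean (xlaw mu colw bit) N (fun l => phi (a :: l)))) //.
by move=> a c' xs'; apply: IH => l *; rewrite hk.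
Qed.
End ArraySemantics.
End Sampler.

(** * Learning a finite law from samples *)

Section Chebyshev.
Variables (R : realType) (T : finType) (w : T -> R).
Hypothesis w_dist : pdist w.

(** The law [w'] is an argument because one sample is compared both with the true law and with a
    candidate for it. *)
Definition excess (N : nat) (w' : T -> R) (l : seq T) (a : T) : R :=
  (count_mem a l)%:R - N%:R * w' a.

Lemma excess_cons N l a b : excess N.+1 w (b :: l) a = ((b == a)%:R - w a) + excess N w l a.
Proof. by rewrite /excess /= natrD -natr1; ring. Qed.

Let sum_centered a : \sum_b w b * ((b == a)%:R - w a) = 0.
Proof.
under eq_bigr do rewrite mulrBr.
rewrite sumrB -big_distrl /=; have [_ ->] := w_dist; rewrite mul1r (bigD1 a) //= eqxx mulr1.
rewrite big1 ?addr0 ?subrr // => b ba; by rewrite (negbTE ba) mulr0.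
Qed.

Lemma seq_mean_excess N a : seq_mean w N (excess N w ^~ a) = 0.
Proof.
elim: N => [|N IH] /=; first by rewrite /excess /= mul0r subr0.
transitivity (\sum_b w b * (((b == a)%:R - w a) + seq_mean w N (excess N w ^~ a))).
  apply: eq_bigr => b _; congr (_ * _).
  rewrite -[X in X + _](seq_mean_cst w_dist N) -seq_meanD; apply: eq_seq_mean => l.
  exact: excess_cons.
by under eq_bigr do rewrite IH addr0; apply: sum_centered.
Qed.

Lemma seq_mean_excess_sqr N a : seq_mean w N (fun l => excess N w l a ^+ 2) <= N%:R * w a.
Proof.
elim: N => [|N IH] /=; first by rewrite /excess /= !mul0r subr0 expr0n.
have -> : \sum_b w b * seq_mean w N (fun l => excess N.+1 w (b :: l) a ^+ 2) =
   \sum_b w b * (((b == a)%:R - w a) ^+ 2) + seq_mean w N (fun l => excess N w l a ^+ 2).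
  have [_ w1] := w_dist; rewrite -[X in _ + X]mul1r -[X in _ + X * _]w1 big_distrl /= -big_split /=.
  apply: eq_bigr => b _; rewrite -mulrDr; congr (_ * _).
  transitivity (seq_mean w N (fun l => ((b == a)%:R - w a) ^+ 2 +
     ((2 * ((b == a)%:R - w a)) * excess N w l a + excess N w l a ^+ 2))).
    by apply: eq_seq_mean => l; rewrite excess_cons; ring.
  by rewrite !seq_meanD seq_mean_cst // seq_meanZ seq_mean_excess mulr0 add0r.
rewrite -natr1 mulrDl mul1r addrC; apply: lerD => //.
have w0 : 0 <= w a by have [] := w_dist.
have sa : \sum_b w b * (b == a)%:R = w a.
  rewrite (bigD1 a) //= eqxx mulr1 big1 ?addr0 // => b ba.
  by rewrite (negbTE ba) mulr0.
have -> : \sum_b w b * ((b == a)%:R - w a) ^+ 2 = w a - w a * w a.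
  transitivity (\sum_b (w b * (b == a)%:R - 2 * w a * (w b * (b == a)%:R) + w b * (w a * w a))).
    by apply: eq_bigr => b _; case: (b == a) => /=; ring.
  rewrite big_split sumrB /= -big_distrr -big_distrl /= sa.
  by have [_ ->] := w_dist; ring.
by rewrite gerBl mulr_ge0.
Qed.

(** Markov's inequality for the sum of squared excesses, whose mean is at most N by the variance
    bound; the indicator is at least 1 minus that sum over 3 N. *)
Lemma empirical_close N : (0 < N)%N ->
  2 / 3 <= seq_mean w N (fun l => ((\sum_a excess N w l a ^+ 2 <= 3 * N%:R)%R : bool)%:R).
Proof.
move=> N0; have NR : 0 < N%:R :> R by rewrite ltr0n.
apply: (@le_trans _ _ (seq_mean w N (fun l => 1 + - (3 * N%:R)^-1 * \sum_a excess N w l a ^+ 2))).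
  rewrite seq_meanD seq_mean_cst // seq_meanZ seq_mean_sum.
  have h : \sum_a seq_mean w N (fun l => excess N w l a ^+ 2) <= N%:R.
    apply: (le_trans (ler_sum _ (fun a _ => seq_mean_excess_sqr N a))).
    by rewrite -big_distrr /=; have [_ ->] := w_dist; rewrite mulr1.
  have -> : 2 / 3 = 1 + - (3 * N%:R)^-1 * N%:R :> R by field; rewrite gt_eqF.
  by rewrite lerD2l !mulNr lerN2 ler_wpM2l // invr_ge0 mulr_ge0 // ltW.
apply: le_seq_mean => // l; set Z := \sum_a _.
have Z0 : 0 <= Z by apply: sumr_ge0 => a _; apply: sqr_ge0.
have i0 : 0 <= (3 * N%:R)^-1 :> R by rewrite invr_ge0 mulr_ge0 // ltW.
case: (lerP Z (3 * N%:R)) => h; rewrite ?mulr1n ?mulr0n mulNr; first by rewrite gerBl mulr_ge0.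
rewrite subr_le0 mulrC ler_pdivlMr ?mulr_gt0 // mul1r; exact: ltW.
Qed.

(** Both laws are close in the squared norm to the same empirical counts, hence to each other;
    passing to the l1 norm costs a factor #|T|. *)
Lemma l1_of_excess N (w' : T -> R) (l : seq T) (eta : R) :
  0 < eta -> (0 < N)%N -> 12 * #|T|%:R / eta ^+ 2 <= N%:R ->
  \sum_a excess N w l a ^+ 2 <= 3 * N%:R -> \sum_a excess N w' l a ^+ 2 <= 3 * N%:R ->
  \sum_a `|w a - w' a| <= eta.
Proof.
move=> e0 N0 hN h1 h2; have NR : 0 < N%:R :> R by rewrite ltr0n.
have T0 : 0 < #|T|%:R :> R.
  rewrite ltr0n lt0n; apply/negP => /eqP T0; have [_] := w_dist.
  by rewrite big1 => [/esym/eqP|a]; [rewrite oner_eq0 | have := fintype0 a T0].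
have sq : \sum_a (w a - w' a) ^+ 2 <= 12 / N%:R.
  have : \sum_a (N%:R * (w a - w' a)) ^+ 2 <= 12 * N%:R.
    apply: (@le_trans _ _ (\sum_a (2 * excess N w l a ^+ 2 + 2 * excess N w' l a ^+ 2))).
      apply: ler_sum => a _; rewrite /excess; set c := _%:R - _; set d := _%:R - N%:R * w' a.
      have -> : N%:R * (w a - w' a) = d - c by rewrite /c /d; ring.
      have := sqr_ge0 (c + d); rewrite !expr2; nra.
    rewrite big_split /= -!big_distrr /=; lra.
  under eq_bigr do rewrite exprMn.
  rewrite -big_distrr /= => h.
  rewrite ler_pdivlMr // -(ler_pM2l NR) [leRHS]mulrC.
  by apply: le_trans h; rewrite expr2 (mulrC _ N%:R) mulrA.
(* This choice makes the constant terms add up to eta / 2; the lower bound on N makes the quadratic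
   part at most eta / 2. *)
set s : R := #|T|%:R / eta.
have s0 : 0 < s by rewrite divr_gt0.
apply: (@le_trans _ _ (\sum_a (s / 2 * (w a - w' a) ^+ 2 + s^-1 / 2))).
  apply: ler_sum => a _; set x := w a - w' a.
  have -> : x ^+ 2 = `|x| ^+ 2 by rewrite real_normK ?num_real.
  rewrite -subr_ge0.
  have -> : s / 2 * `|x| ^+ 2 + s^-1 / 2 - `|x| = s^-1 / 2 * (s * `|x| - 1) ^+ 2.
    by field; rewrite gt_eqF.
  by rewrite mulr_ge0 ?sqr_ge0 // divr_ge0 // invr_ge0 ltW.
rewrite big_split /= -big_distrr /=.
have -> : \sum_(a : T) s^-1 / 2 = eta / 2.
  have -> : \sum_(a : T) s^-1 / 2 = #|T|%:R * (s^-1 / 2) by rewrite sumr_const mulr_natl.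
  by rewrite /s; field; rewrite !gt_eqF.
have h3 : s / 2 * (\sum_a (w a - w' a) ^+ 2) <= s / 2 * (12 / N%:R).
  by rewrite ler_wpM2l // divr_ge0 // ltW.
have h4 : s / 2 * (12 / N%:R) <= eta / 2.
  have -> : s / 2 * (12 / N%:R) = eta / 2 * (12 * #|T|%:R / eta ^+ 2 / N%:R).
    by rewrite /s; field; rewrite !gt_eqF.
  rewrite -[leRHS]mulr1 ler_wpM2l ?divr_ge0 ?(ltW e0) //.
  by rewrite ler_pdivrMr // mul1r.
lra.
Qed.

End Chebyshev.

(** * Choice of parameters *)

Section Numerics.
Variable R : realType.

(* The exponent is 241 for the query count, 18 for [precision eps <= 2 / eps],
   and 18 for each of the two variables passed through [pow_le_geometric]. *)
Definition bound_poly : poly3 R := existT _ 18 (fun _ _ _ => 2 ^+ 295).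

Lemma pow_le_geometric (d : nat) (x : R) : 0 <= x ->
  (1 + x) ^+ d <= 2 ^+ d * \sum_(i < d.+1) x ^+ i.
Proof.
move=> x0; have t i : 0 <= x ^+ i by rewrite exprn_ge0.
case: (lerP x 1) => x1.
  apply: (@le_trans _ _ (2 ^+ d * 1)).
    by rewrite mulr1; apply: lerXn2r; rewrite ?nnegrE; lra.
  rewrite ler_wpM2l ?exprn_ge0 // big_ord_recl expr0 lerDl; exact: sumr_ge0.
apply: (@le_trans _ _ (2 ^+ d * x ^+ d)).
  by rewrite -exprMn; apply: lerXn2r; rewrite ?nnegrE; lra.
rewrite ler_wpM2l ?exprn_ge0 // big_ord_recr /= lerDr; exact: sumr_ge0.
Qed.

Lemma bound_poly_ge (x y z : R) : 0 <= x -> 0 <= y -> 0 <= z ->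
  2 ^+ 259 * (((1 + x) * (1 + y) * z) ^+ 18) <= peval3 bound_poly x y z.
Proof.
move=> x0 y0 z0; rewrite /peval3 /=.
have -> : \sum_(i < 19) \sum_(j < 19) \sum_(k < 19) 2 ^+ 295 * x ^+ i * y ^+ j * z ^+ k =
  2 ^+ 295 * (\sum_(i < 19) x ^+ i) * (\sum_(j < 19) y ^+ j) * (\sum_(k < 19) z ^+ k) :> R.
  under eq_bigr => i _ do under eq_bigr => j _ do rewrite -big_distrr.
  under eq_bigr => i _ do rewrite -big_distrl -big_distrr.
  by rewrite -!big_distrl -big_distrr.
have hx := @pow_le_geometric 18 x x0; have hy := @pow_le_geometric 18 y y0.
have hz : z ^+ 18 <= \sum_(k < 19) z ^+ k.
  by rewrite big_ord_recr /= lerDr; apply: sumr_ge0 => i _; rewrite exprn_ge0.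
have -> : 2 ^+ 295 = 2 ^+ 259 * 2 ^+ 18 * 2 ^+ 18 :> R by rewrite -!exprD.
set X := \sum_(i < 19) x ^+ i in hx *; set Y := \sum_(i < 19) y ^+ i in hy *.
set Z := \sum_(i < 19) z ^+ i in hz *.
rewrite !exprMn.
have -> : 2 ^+ 259 * 2 ^+ 18 * 2 ^+ 18 * X * Y * Z =
  2 ^+ 259 * ((2 ^+ 18 * X) * (2 ^+ 18 * Y) * Z) :> R.
  by move: (2 ^+ 259) (2 ^+ 18) => a b; ring.
rewrite ler_wpM2l ?exprn_ge0 // ; apply: ler_pM => //; rewrite ?mulr_ge0 ?exprn_ge0 ?addr_ge0 //.
by apply: ler_pM => //; rewrite exprn_ge0 // addr_ge0.
Qed.

Definition precision (eps : R) : nat := (Num.truncn eps^-1).+1.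

Lemma precision_bounds (eps : R) : 0 < eps < 1 ->
  eps^-1 <= (precision eps)%:R <= 2 * eps^-1.
Proof.
move=> /andP[e0 e1]; have z1 : 1 <= eps^-1 by rewrite invf_ge1 ?ltW.
have z0 : 0 <= eps^-1 by apply: le_trans z1.
have /andP[h1 h2] := truncn_itv z0; rewrite /precision; apply/andP; split; first exact: ltW.
by rewrite -natr1; lra.
Qed.

(** With u = t^2 D the bound equals 54 u^3 + 324 u^4, and 54 + 324 is rounded up to 512. *)
Lemma level_bound_le (t D : nat) : (0 < t)%N -> (0 < D)%N ->
  (level_bound t D <= 512 * (t ^ 2 * D) ^ 4)%N.
Proof.
move=> t0 D0; have u0 : (0 < t ^ 2 * D)%N by rewrite muln_gt0 expn_gt0 t0.
rewrite /level_bound /level_bound2 /level_bound1; set u := (t ^ 2 * D)%N in u0 *.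
have -> : (6 * (3 * t ^ 2 * D) * (3 * t ^ 2 * D + 6 * (3 * t ^ 2 * D) * t ^ 2 * D) * t ^ 2 * D
  = 54 * (u * (u * u)) + 324 * (u * (u * (u * u))))%N by rewrite /u; ring.
have -> : (u ^ 4 = u * (u * (u * u)))%N by rewrite !expnS expn0 muln1.
have h : (u * (u * u) <= u * (u * (u * u)))%N by rewrite !leq_pmul2l // leq_pmulr.
move: (u * (u * u))%N (u * (u * (u * u)))%N h => a b h; lia.
Qed.

(** Here t = 2 (k + 1), and the index set has t + 3 N t elements for N the level bound. As 1 + 3 *
    512 <= 2^11, this is at most 2^11 t (t^2 D)^4, with D the square of 2^11 Z. *)
Lemma card_sketch_idx (k Z : nat) : (0 < Z)%N ->
  (#|sketch_idx k (2 ^ 11 * Z)|)%:R <= 2 ^+ 108 * k.+1%:R ^+ 9 * Z%:R ^+ 8 :> R.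
Proof.
move=> Z0.
set t := #|test_idx k|; set D := ((2 ^ 11 * Z) ^ 2)%N.
have t0 : (0 < t)%N by rewrite /t card_sum card_ord addSn.
have D0 : (0 < D)%N by rewrite expn_gt0 muln_gt0 Z0 expn_gt0.
have -> : #|sketch_idx k (2 ^ 11 * Z)| = (t + 3 * level_bound t D * t)%N.
  by rewrite /sketch_idx card_sum !card_prod !card_ord.
apply: (@le_trans _ _ (2 ^ 11 * (t * (t ^ 2 * D) ^ 4))%:R).
  rewrite ler_nat.
  have := level_bound_le t0 D0; set u := ((t ^ 2 * D) ^ 4)%N; set Lv := level_bound t D => h.
  have u0 : (0 < u)%N by rewrite expn_gt0 muln_gt0 expn_gt0 t0 D0.
  have -> : (2 ^ 11 = 2048)%N by [].
  have h2 : (t * Lv <= t * (512 * u))%N by rewrite leq_pmul2l.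
  have h3 : (t <= t * u)%N by rewrite leq_pmulr.
  have -> : (3 * Lv * t = 3 * (t * Lv))%N by ring.
  have e : (t * (512 * u) = 512 * (t * u))%N by ring.
  rewrite e in h2; move: (t * Lv)%N (t * u)%N h2 h3 => a b; lia.
have tE : t%:R = 2 * k.+1%:R :> R.
  by rewrite /t card_sum card_ord addnn -muln2 natrM mulrC.
have DE : D%:R = (2 ^+ 11 * Z%:R) ^+ 2 :> R by rewrite /D natrX natrM natrX.
have -> : (2 ^ 11 * (t * (t ^ 2 * D) ^ 4))%:R =
    2 ^+ 11 * (t%:R * (t%:R ^+ 2 * D%:R) ^+ 4) :> R.
  by rewrite natrM natrX (natrM _ t) (natrX _ _ 4) (natrM _ (t ^ 2)) (natrX _ t).
rewrite DE tE.
move: (k.+1%:R) (Z%:R) => a b.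
by rewrite le_eqVlt; apply/orP; left; apply/eqP; ring.
Qed.

End Numerics.

(** * The estimator and its guarantees *)

Section Estimator.
Variables (R : realType) (n k m : nat) (P : dprop R).
Hypotheses (n_gt0 : (0 < n)%N) (m_gt0 : (0 < m)%N).
Hypotheses (P_prop : is_dprop P) (P_inv : index_invariant P).
Variables (A : halg R n bool 0) (eps' : R).
Hypotheses (nsA : (nsamples A <= k.+1)%N) (nqA : (nqueries A <= k.+1)%N).
Hypothesis tA : is_tester P eps' A.
Variables (eps eta : R) (Ns : nat).
Local Notation I := (sketch_idx k m).
Hypotheses (eta_gt0 : 0 < eta) (Ns_gt0 : (0 < Ns)%N).
Hypothesis Ns_large : 12 * #|{: {ffun I * I -> bool}}|%:R / eta ^+ 2 <= Ns%:R.
Hypothesis gamma_small : k.+1%:R * (k.+1%:R / n%:R) <= 1 / 100 :> R.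
Let err (e : R) := e + 101 * (2 / m%:R + eta) + 202 * ((#|test_idx k| ^ 2)%:R / n%:R).
Variable e : R.
Hypotheses (e_gt0 : 0 < e) (err_le1 : err e <= 1) (err_le : eps' + err e <= eps).

Definition matches (l : seq {ffun I * I -> bool}) (mu : {ffun bvec n -> R}) : Prop :=
  is_dist mu /\ \sum_a excess Ns (@sketch R n k m mu) l a ^+ 2 <= 3 * Ns%:R.

(** Any matching distribution serves, picked by classical choice. The default 0 is never taken when
    the true distribution matches. *)
Definition estimate (l : seq {ffun I * I -> bool}) : R :=
  if pselect (exists mu, matches l mu) is left h then dEMP P (projT1 (cid h)) else 0.

(** The true distribution and the chosen one match the same sample, so their sketches are within
    [eta]; [continuity] is applied in both directions. *)
Lemma estimate_close l mu : matches l mu -> `|estimate l - dEMP P mu| <= eps.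
Proof.
move=> hm; rewrite /estimate; case: pselect => [h|]; last by case; exists mu.
case: (cid h) => mu' [md' h'] /=; have [md h0] := hm.
have sk nu : is_dist nu -> pdist (@sketch R n k m nu).
  by move=> nd; apply: array_law_dist => //; apply: col_weight_dist.
have cont nu nu' : is_dist nu -> is_dist nu' ->
    \sum_a `|@sketch R n k m nu a - @sketch R n k m nu' a| <= eta ->
    dEMP P nu' <= dEMP P nu + eps' + err e.
  move=> nd nd' L1; exact: (continuity n_gt0 m_gt0 P_prop (test_fun01 A) gamma_small
    (tester_accept_P n_gt0 nsA nqA P_prop P_inv tA)
    (tester_accept_far n_gt0 nsA nqA P_prop P_inv tA) nd nd' e_gt0 L1 err_le1).
have L1 := l1_of_excess (sk mu md) eta_gt0 Ns_gt0 Ns_large h0 h'.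
have L1' := l1_of_excess (sk mu' md') eta_gt0 Ns_gt0 Ns_large h' h0.
have c1 := cont _ _ md md' L1; have c2 := cont _ _ md' md L1'.
by rewrite ler_norml; apply/andP; split; move: c1 c2 err_le; move: (err e) => er; lra.
Qed.

Definition estimator : halg R n R 0 :=
  draw_arrays n_gt0 Ns (fun (l : seq {ffun I * I -> bool}) c => HRet R n c (estimate l)) 0.

Lemma nqueries_estimator : (nqueries estimator <= Ns * (#|I| * #|I|))%N.
Proof. by rewrite -[leqRHS]addn0; apply: nqueries_draw_arrays. Qed.

Lemma estimator_correct mu : is_dist mu ->
  2 / 3 <= Pr mu estimator (fun d => `|d - dEMP P mu| <= eps).
Proof.
move=> md; rewrite /Pr /estimator.
rewrite (hprob_draw_arrays n_gt0 md Ns (phi := fun l =>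
  if `|estimate l - dEMP P mu| <= eps then 1 else 0)) //.
have sd : pdist (@sketch R n k m mu) by apply: array_law_dist => //; apply: col_weight_dist.
apply: (le_trans (empirical_close sd Ns_gt0)); apply: (le_seq_mean sd) => l.
case: (lerP (\sum_a _) _) => h /=; last by case: ifP.
by rewrite estimate_close.
Qed.

End Estimator.

Theorem theorem5p1 (R : realType) :
  exists (c : R) (p : poly3 R), 0 < c /\
  forall (P : dprop R) (s q : R -> nat),
    is_dprop P -> index_invariant P ->
    (forall eps' : R, 0 < eps' < 1 -> forall n : nat,
       exists A : halg R n bool 0,
         (nsamples A <= s eps')%N /\ (nqueries A <= q eps')%N /\
         is_tester P eps' A) ->
    forall eps : R, 0 < eps < 1 ->
    forall n : nat,
      powR 2 (peval3 p (2 ^+ q (c * eps)) (s (c * eps))%:R eps^-1) <= n%:R ->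
      exists A : halg R n R 0,
        (nqueries A)%:R <=
          expR (expR (2 ^+ q (c * eps) *
                      peval3 p (s (c * eps))%:R (q (c * eps))%:R eps^-1)) /\
        forall mu : {ffun bvec n -> R}, is_dist mu ->
          Pr mu A (fun d => `|d - dEMP P mu| <= eps) >= 2 / 3.
Proof.
(* The tester's radius takes eps / 4 of the error; all remaining errors are kept below eps / 2. *)
exists (1 / 4), (bound_poly R); split; first by lra.
move=> P s q P_prop P_inv testers eps heps n hn.
set eps' := 1 / 4 * eps in hn *; set s0 := s eps' in hn *; set q0 := q eps' in hn *.
have /andP[e0 e1] := heps.
have he' : 0 < eps' < 1 by rewrite /eps'; lra.
have [A [nsA [nqA tA]]] := testers eps' he' n.
set z := eps^-1 in hn *.
have z1 : 1 <= z by rewrite /z invf_ge1 // ltW.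
have z0 : 0 <= z by apply: le_trans z1.
(* [Z] is an integer stand-in for 1 / eps, and [K] bounds samples and queries at once, as test
   arrays are square. *)
pose Z := precision eps; pose k := (s0 + q0)%N; pose K := k.+1.
have /andP[Z1 Z2] := precision_bounds heps; rewrite -/Z -/z in Z1 Z2.
have Z_gt0 : (0 < Z)%N by [].
have ZR1 : 1 <= Z%:R :> R by rewrite ler1n.
have KR1 : 1 <= K%:R :> R by rewrite ler1n.
have KE : K%:R = 1 + s0%:R + q0%:R :> R by rewrite /K /k -natr1 natrD; ring.
have s0R : 0 <= s0%:R :> R by [].
have q0R : 0 <= q0%:R :> R by [].
have q2 : q0%:R <= 2 ^+ q0 :> R by rewrite -natrX ler_nat ltnW // ltn_expl.
(* From n >= W follows K^2 / n <= eps / 2^13, which bounds both the symmetrisation error and the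
   collision probability. *)
pose W := (2 ^ 13 * (K ^ 2 * Z))%N.
have WE : W%:R = 2 ^+ 13 * (K%:R ^+ 2 * Z%:R) :> R.
  by rewrite /W natrM natrX (natrM _ (K ^ 2)) (natrX _ K).
have n_ge : 2 ^+ 13 * (K%:R ^+ 2 * Z%:R) <= n%:R :> R.
  rewrite -WE; apply: le_trans hn.
  apply: (@le_trans _ _ (powR 2 W%:R)).
    by rewrite powR_mulrn // -natrX ler_nat ltnW // ltn_expl.
  rewrite ler_powR ?ler1n // WE; apply: le_trans (bound_poly_ge _ _ _) => //; last by rewrite exprn_ge0.
  set Y := (1 + 2 ^+ q0) * (1 + s0%:R) * z.
  have KY : K%:R * z <= Y.
    rewrite /Y ler_wpM2r // KE; move: q2 s0R; move: (2 ^+ q0) => v; nra.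
  have Y1 : 1 <= Y by apply: le_trans KY; rewrite -[leLHS]mulr1 ler_pM.
  apply: (@le_trans _ _ (2 ^+ 259 * Y ^+ 2)); last first.
    by rewrite ler_wpM2l ?exprn_ge0 // ler_weXn2l.
  apply: (@le_trans _ _ (2 ^+ 13 * (2 * (K%:R * z) ^+ 2))).
    rewrite ler_wpM2l ?exprn_ge0 // exprMn mulrCA ler_wpM2l ?exprn_ge0 //.
    by apply: (le_trans Z2); rewrite ler_wpM2l // expr2 ler_peMl.
  rewrite mulrA -exprSr; apply: ler_pM; rewrite ?exprn_ge0 ?mulr_ge0 ?exprn_ge0 ?mulr_ge0 //.
    by rewrite ler_weXn2l // ler1n.
  apply: lerXn2r => //; rewrite nnegrE; first by rewrite mulr_ge0.
  exact: le_trans ler01 Y1.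
have nR : 0 < n%:R :> R.
  apply: lt_le_trans n_ge; rewrite !mulr_gt0 ?exprn_gt0 //; exact: lt_le_trans KR1.
have n_gt0 : (0 < n)%N by rewrite ltr0n in nR.
(* Makes the regularity error 2 / m at most eps / 2^10, the same size as [eta]. *)
pose m := (2 ^ 11 * Z)%N.
have m_gt0 : (0 < m)%N by rewrite muln_gt0 Z_gt0 expn_gt0.
pose eta : R := eps / 2 ^+ 10.
have eta0 : 0 < eta by rewrite divr_gt0 ?exprn_gt0.
pose M := #|sketch_idx k m|.
(* The first factor counts the possible arrays; the second dominates 12 / eta^2, since 12 <= 2^4 and
   eta^2 = eps^2 / 2^20. *)
pose Ns := (2 ^ (M * M) * (2 ^ 24 * Z ^ 2))%N.
have Ns_gt0 : (0 < Ns)%N by rewrite !muln_gt0 !expn_gt0 Z_gt0.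
have NsE : Ns%:R = (2 ^ (M * M))%:R * (2 ^+ 24 * Z%:R ^+ 2) :> R.
  by rewrite /Ns natrM (natrM _ (2 ^ 24)) (natrX _ Z) (natrX _ 2 24).
have eZ : 1 <= eps * Z%:R.
  apply: (@le_trans _ _ (eps * z)); last by rewrite ler_pM2l.
  by rewrite /z divff ?gt_eqF.
have Ns_large : 12 * #|{: {ffun sketch_idx k m * sketch_idx k m -> bool}}|%:R / eta ^+ 2 <= Ns%:R.
  rewrite card_ffun card_bool card_prod -/M NsE.
  rewrite ler_pdivrMr ?exprn_gt0 // /eta.
  have -> : (2 ^ (M * M))%:R * (2 ^+ 24 * Z%:R ^+ 2) * (eps / 2 ^+ 10) ^+ 2 =
    2 ^+ 4 * (eps * Z%:R) ^+ 2 * (2 ^ (M * M))%:R :> R.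
    by move: (2 ^ (M * M))%:R (Z%:R) => a b; field.
  rewrite ler_wpM2r //.
  have : 1 <= (eps * Z%:R) ^+ 2 by rewrite exprn_ege1.
  move: ((eps * Z%:R) ^+ 2) => v hv.
  have -> : 2 ^+ 4 = 16 :> R by rewrite -natrX.
  by clear -hv; lra.
have Kn : (K%:R ^+ 2) / n%:R <= eps / 2 ^+ 13.
  rewrite ler_pdivrMr // mulrAC ler_pdivlMr ?exprn_gt0 //.
  have h := ler_wpM2l (ltW e0) n_ge; apply: le_trans h.
  have -> : eps * (2 ^+ 13 * (K%:R ^+ 2 * Z%:R)) = K%:R ^+ 2 * 2 ^+ 13 * (eps * Z%:R).
    by move: (2 ^+ 13) => v; ring.
  by rewrite ler_peMr // mulr_ge0 ?exprn_ge0.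
have p13 : 2 ^+ 13 = 8192 :> R by rewrite -natrX.
have p10 : 2 ^+ 10 = 1024 :> R by rewrite -natrX.
have gamma_small : K%:R * (K%:R / n%:R) <= 1 / 100 :> R.
  move: Kn; rewrite mulrA -expr2 p13; move: (K%:R ^+ 2 / n%:R) => a.
  by clear -e1; lra.
have tE : (#|test_idx k| ^ 2)%:R / n%:R = 4 * (K%:R ^+ 2 / n%:R) :> R.
  rewrite /test_idx card_sum card_ord addnn -muln2 natrX natrM -/K mulrA; congr (_ / _).
  by move: (K%:R) => a; ring.
have mE : 2 / m%:R <= eps / 2 ^+ 10 :> R.
  rewrite /m natrM natrX ler_pdivrMr; last by rewrite mulr_gt0 ?exprn_gt0 // (lt_le_trans _ ZR1).
  have -> : eps / 2 ^+ 10 * (2 ^+ 11 * Z%:R) = 2 * (eps * Z%:R) by move: Z%:R => b; field.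
  by rewrite -[leLHS]mulr1 ler_wpM2l.
(* The coefficients of eps are 1/8 + 202/1024 + 808/8192, which is below 1/2. *)
have errE : eps / 8 + 101 * (2 / m%:R + eta) + 202 * ((#|test_idx k| ^ 2)%:R / n%:R) <= eps / 2.
  rewrite tE /eta; move: mE Kn; rewrite p13 p10.
  by move: (2 / m%:R) (K%:R ^+ 2 / n%:R) => a b; clear -e0; lra.
have nsA' : (nsamples A <= k.+1)%N by apply: leq_trans nsA _; rewrite leqW // leq_addr.
have nqA' : (nqueries A <= k.+1)%N by apply: leq_trans nqA _; rewrite leqW // leq_addl.
exists (estimator k m P n_gt0 Ns); split; last first.
  move=> mu; apply: (@estimator_correct R n k m P n_gt0 m_gt0 P_prop P_inv A eps' nsA' nqA' tA
    eps eta Ns eta0 Ns_gt0 Ns_large gamma_small (eps / 8)).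
  - by rewrite divr_gt0.
  - by apply: le_trans errE _; clear -e1; lra.
  - by apply: (le_trans (lerD (lexx _) errE)); rewrite /eps'; clear -e0; lra.
have Mle := card_sketch_idx R k Z_gt0; rewrite -/m -/M -/K in Mle.
apply: (@le_trans _ _ (Ns * (M * M))%:R); first by rewrite ler_nat; apply: nqueries_estimator.
have eN v : (v%:R : R) <= expR v%:R.
  by apply: le_trans (expR_ge1Dx _); rewrite lerDr.
have e2N v : (2 ^ v)%:R <= expR v%:R :> R.
  rewrite natrX -[v%:R]mulr1 expRM_natl lerXn2r ?nnegrE ?expR_ge0 //.
  by apply: le_trans (expR_ge1Dx _); clear; lra.
(* The number of arrays and the remaining factor are each bounded by the exponential of their
   exponent or of themselves. *)
apply: (@le_trans _ _ (expR ((M * M)%:R + (2 ^ 24 * Z ^ 2 * (M * M))%:R))).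
  rewrite expRD /Ns -mulnA natrM; apply: ler_pM => //.
(* The exponent is itself polynomial in K and Z, so [1 + y <= expR y] passes to the outer
   exponential. *)
rewrite ler_expR; apply: le_trans (_ : _ <= 2 ^+ q0 * peval3 (bound_poly R) s0%:R q0%:R z) _; last first.
  by apply: le_trans (expR_ge1Dx _); rewrite lerDr.
apply: (@le_trans _ _ (peval3 (bound_poly R) s0%:R q0%:R z)); last first.
  rewrite ler_peMl //; last by rewrite exprn_ege1 // ler1n.
  by apply: le_trans (bound_poly_ge _ _ _) => //; rewrite mulr_ge0 ?exprn_ge0 ?mulr_ge0 ?addr_ge0.
apply: le_trans (bound_poly_ge _ _ _) => //.
apply: (@le_trans _ _ (2 ^+ 259 * (K%:R * z) ^+ 18)); last first.
  rewrite ler_wpM2l ?exprn_ge0 // lerXn2r ?nnegrE ?mulr_ge0 ?addr_ge0 //.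
  by rewrite ler_wpM2r // KE; clear -s0R q0R; nra.
apply: (@le_trans _ _ (2 ^+ 25 * Z%:R ^+ 2 * M%:R ^+ 2)).
  rewrite (natrM _ (2 ^ 24 * Z ^ 2)) (natrM _ M M) (natrM _ (2 ^ 24)) (natrX _ Z) (natrX _ 2 24).
  rewrite -expr2.
  have : 1 <= Z%:R ^+ 2 :> R by rewrite exprn_ege1.
  have : 0 <= M%:R ^+ 2 :> R by rewrite exprn_ge0.
  have -> : 2 ^+ 25 = 2 * 2 ^+ 24 :> R by rewrite -exprS.
  have : 1 <= 2 ^+ 24 :> R by rewrite exprn_ege1 // ler1n.
  move: (2 ^+ 24) (Z%:R ^+ 2) (M%:R ^+ 2) => a b d h1 h2 h3.
  have h4 : 1 <= a * b by rewrite -[leLHS]mulr1 ler_pM.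
  by rewrite -!mulrA [a * (b * d)]mulrA; move: (a * b) h4 => f h4; clear -h2 h4; nra.
apply: (@le_trans _ _ (2 ^+ 25 * Z%:R ^+ 2 * (2 ^+ 108 * K%:R ^+ 9 * Z%:R ^+ 8) ^+ 2)).
  by rewrite ler_wpM2l ?mulr_ge0 ?exprn_ge0 // lerXn2r ?nnegrE // ?mulr_ge0 ?exprn_ge0.
(* Exponents: 241 = 25 + 2 * 108 for the constant, 18 = 2 * 9 for K and 18 = 2 + 2 * 8 for Z.
   Replacing Z by 2 z then gives 259 = 241 + 18. *)
have -> : 2 ^+ 25 * Z%:R ^+ 2 * (2 ^+ 108 * K%:R ^+ 9 * Z%:R ^+ 8) ^+ 2 =
  2 ^+ 241 * (K%:R ^+ 18 * Z%:R ^+ 18) :> R.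
  by move: (K%:R) (Z%:R) => a b; ring.
have -> : 2 ^+ 259 * (K%:R * z) ^+ 18 = 2 ^+ 241 * (K%:R ^+ 18 * (2 * z) ^+ 18).
  by move: (K%:R) => a; ring.
rewrite ler_wpM2l ?exprn_ge0 // ler_wpM2l ?exprn_ge0 //.
by apply: lerXn2r; rewrite ?nnegrE ?mulr_ge0.
Qed.
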